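(* Let $n \geq 2$ and let $\lambda = a_1\omega_1 + \cdots + a_{2n-1}\omega_{2n-1}$ with all $a_i \in \mathbb{Z}_{\geq 0}$ be a dominant integral weight of $\mathfrak{sl}(2n,\mathbb{C})$. Assume that either $n = 2$, or $a_i = 0$ for all $i \geq 4$ (i.e. $\lambda = a_1\omega_1 + a_2\omega_2 + a_3\omega_3$). Then, as modules over $\mathfrak{g}^{\sigma} \cong \mathfrak{sp}(2n,\mathbb{C})$, $$\operatorname{res}^{\mathfrak{sl}(2n,\mathbb{C})}_{\mathfrak{g}^{\sigma}} {\rm L}(\lambda) \;\cong\; \bigoplus_{\mathscr{T} \in \operatorname{domres}(\lambda)} {\rm L}(\mu_{\mathscr{T}}),$$ where $\mu_{\mathscr{T}} = \sum_{j=1}^{k} \hat{\varepsilon}_{w_j}$ for $w(\mathscr{T}) = w_1 w_2 \cdots w_k$, and ${\rm L}(\mu)$ denotes the simple $\mathfrak{g}^{\sigma}$-module of highest weight $\mu$.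
   Context: Let $\mathfrak{g} = \mathfrak{sl}(2n,\mathbb{C})$ with Cartan subalgebra $\mathfrak{h}$ of diagonal matrices, Borel subalgebra of upper triangular matrices, Chevalley generators $x_i, y_i, h_i = E_{ii} - E_{i+1,i+1}$ ($1 \le i \le 2n-1$) for the simple roots $\alpha_i = \varepsilon_i - \varepsilon_{i+1}$, where $\varepsilon_i(\operatorname{diag}(a_1,\dots,a_{2n})) = a_i$; $\omega_1,\dots,\omega_{2n-1}$ are the fundamental weights. Let $\sigma$ be the diagram automorphism with $\sigma(x_i) = x_{2n-i}$, $\sigma(y_i) = y_{2n-i}$, $\sigma(h_i) = h_{2n-i}$. The fixed-point subalgebra $\mathfrak{g}^{\sigma}$ is isomorphic to $\mathfrak{sp}(2n,\mathbb{C})$, with Cartan subalgebra $\mathfrak{h}^{\sigma} = \mathfrak{h} \cap \mathfrak{g}^{\sigma}$ and Chevalley generators $\hat x_i = x_i + x_{2n-i}$, $\hat y_i = y_i + y_{2n-i}$, $\hat h_i = h_i + h_{2n-i}$ for $1 \le i < n$ and $\hat x_n = x_n$, $\hat y_n = y_n$, $\hat h_n = h_n$; highest weights of $\mathfrak{g}^{\sigma}$-modules are taken with respect to this choice. Set $\hat\varepsilon_i = \varepsilon_i|_{\mathfrak{h}^\sigma}$ for $1 \le i \le 2n$; then $\hat\varepsilon_{2n+1-i} = -\hat\varepsilon_i$, the fundamental weights of $\mathfrak{g}^\sigma$ are $\hat\omega_i = \hat\varepsilon_1 + \cdots + \hat\varepsilon_i$ ($1 \le i \le n$), and a weight $\sum_{i=1}^n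 c_i \hat\varepsilon_i$ is dominant iff $c_1 \ge c_2 \ge \cdots \ge c_n \ge 0$. Shapes and tableaux: to $\lambda = \sum a_i \omega_i$ associate the arrangement of boxes (Young diagram, left- and top-justified) having $a_i$ columns of length $i$, with longer columns to the left (so row $r$ has $a_r + a_{r+1} + \cdots + a_{2n-1}$ boxes). A semi-standard Young tableau of this shape is a filling with letters from $\{1 < 2 < \cdots < 2n\}$, weakly increasing along rows from left to right and strictly increasing down columns. The word $w(\mathscr{T})$ of a tableau is obtained by reading its rows from right to left, starting with the top row and proceeding downwards. Restricted dominance: $\operatorname{domres}(\lambda)$ is the set of semi-standard Young tableaux $\mathscr{T}$ of the shape of $\lambda$ whose word $w(\mathscr{T}) = w_1\cdots w_k$ satisfies: for every prefix $w_1\cdots w_j$ ($0 \le j \le k$), writing $\sum_{l \le j}\hat\varepsilon_{w_l} = \sum_{i=1}^n c_i \hat\varepsilon_i$ (i.e. $c_i$ = number of letters $i$ minus number of letters $2n+1-i$ in the prefix), one has $c_1 \ge c_2 \ge \cdots \ge c_n \ge 0$. (Equivalently, the piecewise linear path $t \mapsto$ concatenation of the segments $\hat\varepsilon_{w_1}, \dots, \hat\varepsilon_{w_k}$ stays in the dominant Weyl chamber of $\mathfrak{g}^\sigma$.) *)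

(* Defs.v *)
From HB Require Import structures.
From mathcomp Require Import all_boot all_order all_algebra.
Set Implicit Arguments. Unset Strict Implicit. Unset Printing Implicit Defensive.
Import Order.TTheory GRing.Theory Num.Theory.
Local Open Scope ring_scope.

(* Conventions: N = 2n; matrix indices are 0-based ('I_N), whereas the paper's
   indices (generators, fundamental weights, tableau letters) are 1-based. *)

Section LieData.
Variables (F : fieldType) (n : nat).
Local Notation N := (n.*2).

Definition Emx (p q : nat) : 'M[F]_N :=
  \matrix_(r < N, c < N) ((val r == p) && (val c == q))%:R.

Definition xg (i : nat) : 'M[F]_N := Emx i.-1 i.
Definition yg (i : nat) : 'M[F]_N := Emx i i.-1.

Definition in_sl (X : 'M[F]_N) : bool := \tr X == 0.
Definition in_h (H : 'M[F]_N) : bool := is_diag_mx H && in_sl H.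

(* The diagram automorphism sigma, written out explicitly:
   sigma(X) = - J X^T J^{-1},  J = sum_k (-1)^k E_{k,2n+1-k}  (1-based k);
   entrywise  sigma(X)_{r,c} = -(-1)^(r+c) X_{N-1-c, N-1-r}  (0-based).
   It is the unique automorphism with sigma(x_i)=x_{2n-i}, sigma(y_i)=y_{2n-i},
   sigma(h_i)=h_{2n-i}. *)
Definition sigma (X : 'M[F]_N) : 'M[F]_N :=
  \matrix_(r < N, c < N) (- ((-1) ^+ (val r + val c)) * X (rev_ord c) (rev_ord r)).

Definition in_gsig (X : 'M[F]_N) : bool := in_sl X && (sigma X == X).
Definition in_hsig (H : 'M[F]_N) : bool := is_diag_mx H && in_gsig H.

Definition xhat (i : nat) : 'M[F]_N := if (i < n)%N then xg i + xg (N - i) else xg n.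

(* diagonal entry at 0-based nat index p (0 if out of range) *)
Definition dg (H : 'M[F]_N) (p : nat) : F := \sum_(k < N | val k == p) H k k.

(* weight lambda = sum_i a_i omega_i of sl(2n), evaluated on H in h;
   omega_i = eps_1 + ... + eps_i *)
Definition omega (i : nat) (H : 'M[F]_N) : F := \sum_(k < N | (val k < i)%N) H k k.
Definition wt_sl (a : nat -> nat) (H : 'M[F]_N) : F :=
  \sum_(1 <= i < N) (a i)%:R * omega i H.

(* Representations of sl(2n) on F^d.  A vector is a row vector v, and
   X acts by  X.v := v *m (rho X)^T  (so that it is a left action). *)
Definition is_sl_rep (d : nat) (rho : 'M[F]_N -> 'M[F]_d) : Prop :=
  (forall (c : F) (X Y : 'M[F]_N), rho (c *: X + Y) = c *: rho X + rho Y) /\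
  (forall X Y : 'M[F]_N, in_sl X -> in_sl Y ->
     rho (X *m Y - Y *m X) = rho X *m rho Y - rho Y *m rho X).

Definition stable (P : pred 'M[F]_N) (d k : nat) (rho : 'M[F]_N -> 'M[F]_d)
  (W : 'M[F]_(k, d)) : Prop :=
  forall X, P X -> (W *m (rho X)^T <= W)%MS.

Definition simple_sub (P : pred 'M[F]_N) (d : nat) (rho : 'M[F]_N -> 'M[F]_d)
  (U : 'M[F]_d) : Prop :=
  (U != 0 :> 'M[F]_d) /\ stable P rho U /\
  forall W : 'M[F]_d, (W <= U)%MS -> stable P rho W -> (W == 0 :> 'M[F]_d) \/ (W == U)%MS.

Definition has_hw_vector (E : nat -> 'M[F]_N) (m : nat) (Cartan : pred 'M[F]_N)
  (wt : 'M[F]_N -> F) (d : nat) (rho : 'M[F]_N -> 'M[F]_d) (U : 'M[F]_d) : Prop :=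
  exists v : 'rV[F]_d, [/\ (v <= U)%MS, v != 0,
    (forall i, (1 <= i <= m)%N -> v *m (rho (E i))^T = 0) &
    (forall H, Cartan H -> v *m (rho H)^T = wt H *: v)].

Definition is_L_sl (a : nat -> nat) (d : nat) (rho : 'M[F]_N -> 'M[F]_d) : Prop :=
  simple_sub in_sl rho 1%:M /\ has_hw_vector xg N.-1 in_h (wt_sl a) rho 1%:M.

Definition is_L_gsig (mu : 'M[F]_N -> F) (d : nat) (rho : 'M[F]_N -> 'M[F]_d)
  (U : 'M[F]_d) : Prop :=
  simple_sub in_gsig rho U /\ has_hw_vector xhat n in_hsig mu rho U.

End LieData.

Section Tableaux.
Variable n : nat.
Local Notation N := (n.*2).

(* a tableau is the list of its rows (top to bottom), row r = 1..2n-1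
   (rows may be empty); letters are 1..2n *)
Definition tableau := seq (seq nat).

(* length of row r (1-based) of the shape of lambda = sum a_i omega_i *)
Definition rowlen (a : nat -> nat) (r : nat) : nat := (\sum_(r <= i < N) a i)%N.

Definition row (t : tableau) (r : nat) : seq nat := nth [::] t r.

Definition is_ssyt (a : nat -> nat) (t : tableau) : Prop :=
  [/\ size t = N.-1,
      (forall r, (r < N.-1)%N -> size (row t r) = rowlen a r.+1),
      (forall r, all (fun l => (1 <= l <= N)%N) (row t r)),
      (forall r, sorted leq (row t r)) &
      (forall r j, (r.+1 < N.-1)%N -> (j < size (row t r.+1))%N ->
         (nth 0 (row t r) j < nth 0 (row t r.+1) j)%N)].

Definition word (t : tableau) : seq nat := flatten (map rev t).

Definition cco (w : seq nat) (i : nat) : int :=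
  (count_mem i w)%:Z - (count_mem (N.+1 - i)%N w)%:Z.

Definition dominant_prefixes (w : seq nat) : Prop :=
  forall j, (j <= size w)%N ->
    (forall i, (1 <= i < n)%N -> cco (take j w) i.+1 <= cco (take j w) i) /\
    0 <= cco (take j w) n.

Definition domres (a : nat -> nat) (t : tableau) : Prop :=
  is_ssyt a t /\ dominant_prefixes (word t).

Definition muT (F : fieldType) (t : tableau) (H : 'M[F]_N) : F :=
  \sum_(l <- word t) dg H l.-1.

End Tableaux.

(* Main.v *)
(* The assumptions make lambda = a_1 omega_1 + a_2 omega_2 + a_3 omega_3 in both
   cases.  Polynomials in the entries of a 2n x 3 matrix, killed by the upper
   triangular column operations and of the right weight, then form a model of
   L(lambda), on which sp(2n) acts through row operations.

   Every sp(2n)-highest weight vector of the model is a monomial in six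
   covariants.  Such a vector f is an eigenvector of a Borel subalgebra, so it
   does not vanish at a point whose orbit is open; some monomial of f is then
   supported on the nonzero entries of that point, and its exponents are read
   off from the weights of f.  Three points give all the inequalities, and
   these are the inequalities that describe the tableaux in domres(lambda).

   Complete reducibility comes from the form <x^m, x^m'> = m! [m = m'], for
   which transposed matrices act by adjoint operators: the monomials in the
   covariants have integer coefficients, hence are not isotropic, while a
   highest weight vector in the orthogonal complement of the sum of the
   submodules they generate would be isotropic. *)

Require Import Defs.
From HB Require Import structures.
From mathcomp Require Import all_boot all_order all_algebra.
From mathcomp Require Import mpoly.
From mathcomp Require Import ring zify.
From Stdlib Require Import Classical.
Set Implicit Arguments. Unset Strict Implicit. Unset Printing Implicit Defensive.
Import Order.TTheory GRing.Theory Num.Theory.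
Local Open Scope ring_scope.

(** * Linear vector fields on a polynomial ring *)

(** The restriction is multiplicity free: a dominant tableau is described by four counts [k], [z],
    [x], [y], and these can be recovered from its weight. So different covariants of one model are
    orthogonal because their weights differ.

    The point [slice1] is read off from the tableaux: the nonzero entries of its three columns sit
    in the rows indexed by the letters that the three rows of a dominant tableau may contain, so a
    monomial supported there has the content of a tableau. The other two points are needed because
    this monomial does not show that the exponents of [gen1] and [gen2] are nonnegative.

    No group occurs. An open orbit is replaced by vector fields spanning the tangent space at a
    point, and an eigenvector vanishing there has all its partial derivatives vanishing there, order
    by order.

    The module is given abstractly. Inside its product with the polynomial ring, the submodule
    generated by the two highest weight vectors is shown to be the graph of an isomorphism onto the
    model.

    For [n = 2] the letters 3 and 2n-1 coincide, and so do [gen4] and [gen5] up to sign; the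
    convention [x = 0] removes this ambiguity. *)

Section LinearVectorFields.
Variables (F : fieldType) (k : nat).
Local Notation P := {mpoly F[k]}.
Implicit Types (A B : 'M[F]_k) (f g : P).

Definition vf A f : P := \sum_l \sum_i A l i *: ('X_l * f^`M(i)).

Lemma vf_is_linear A : linear (vf A).
Proof.
move=> c f g; rewrite /vf scaler_sumr -big_split; apply: eq_bigr => l _ /=.
rewrite scaler_sumr -big_split; apply: eq_bigr => i _ /=.
by rewrite linearP mulrDr scalerDr -scalerAr !scalerA mulrC.
Qed.
HB.instance Definition _ A := GRing.isLinear.Build F P P _ (vf A) (vf_is_linear A).

Lemma vfP c A B f : vf (c *: A + B) f = c *: vf A f + vf B f.
Proof.
rewrite /vf scaler_sumr -big_split; apply: eq_bigr => l _ /=.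
rewrite scaler_sumr -big_split; apply: eq_bigr => i _ /=.
by rewrite !mxE scalerDl scalerA.
Qed.

Lemma vfD A B f : vf (A + B) f = vf A f + vf B f.
Proof. by rewrite -{1}(scale1r A) vfP scale1r. Qed.

Lemma vf0 f : vf 0 f = 0.
Proof. by rewrite /vf big1 // => l _; rewrite big1 // => i _; rewrite mxE scale0r. Qed.

Lemma vfN A f : vf (- A) f = - vf A f.
Proof. by apply/eqP; rewrite -addr_eq0 -vfD addNr vf0. Qed.

Lemma vfB A B f : vf (A - B) f = vf A f - vf B f.
Proof. by rewrite vfD vfN. Qed.

Lemma vfM A f g : vf A (f * g) = vf A f * g + f * vf A g.
Proof.
rewrite /vf mulr_suml mulr_sumr -big_split; apply: eq_bigr => l _ /=.
rewrite mulr_suml mulr_sumr -big_split; apply: eq_bigr => i _ /=.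
by rewrite mderivM -scalerAl -scalerAr -scalerDr; congr (_ *: _); ring.
Qed.

Lemma vf1 A : vf A 1 = 0.
Proof.
have := vfM A 1 1; rewrite !mulr1 mul1r => /eqP.
by rewrite -subr_eq0 opprD addrA subrr sub0r oppr_eq0 => /eqP.
Qed.

Lemma mnm_subUU (j : 'I_k) : (U_(j) - U_(j))%MM = 0%MM.
Proof. by apply/mnmP => i; rewrite mnmBE subnn mnm0E. Qed.

Lemma vfX A j : vf A 'X_j = \sum_l A l j *: 'X_l.
Proof.
apply: eq_bigr => l _; rewrite (bigD1 j) //= big1 ?addr0 => [|i ij].
  rewrite mderivX mnm1E eqxx scale1r.
  by rewrite mnm_subUU mpolyX0 mulr1.
by rewrite mderivX mnm1E eq_sym (negPf ij) scale0r mulr0 scaler0.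
Qed.

Lemma vf_prod_eigen A (f g : P) x y :
  vf A f = x *: f -> vf A g = y *: g -> vf A (f * g) = (x + y) *: (f * g).
Proof. by move=> hf hg; rewrite vfM hf hg -scalerAl -scalerAr scalerDl. Qed.

Lemma vf_exp_eigen A f x e : vf A f = x *: f -> vf A (f ^+ e) = (e%:R * x) *: f ^+ e.
Proof.
move=> hf; elim: e => [|e IHe]; first by rewrite expr0 vf1 mul0r scale0r.
by rewrite exprS (vf_prod_eigen hf IHe) -addn1 natrD mulrDl mul1r addrC.
Qed.

(** The second-order part is symmetric in the two operators, so it cancels in a commutator, and only
    the first-order part [vf (A *m B)] contributes to the bracket. *)
Lemma vf_vf A B f : vf A (vf B f) = vf (A *m B) f +
  \sum_l \sum_i \sum_l' \sum_i'
    (A l i * B l' i') *: ('X_l * 'X_l' * f^`M(i)^`M(i')).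
Proof.
rewrite {1}/vf.
transitivity (\sum_l \sum_i \sum_l' \sum_i' ((A l i * B l' i') *:
   ('X_l * 'X_l' * f^`M(i)^`M(i')) + (A l i * B l' i' * (l' == i)%:R) *: ('X_l * f^`M(i')))).
  apply: eq_bigr => l _; apply: eq_bigr => i _.
  rewrite /vf linear_sum mulr_sumr scaler_sumr; apply: eq_bigr => l' _.
  rewrite linear_sum mulr_sumr scaler_sumr; apply: eq_bigr => i' _.
  rewrite linearZ /= mderivM mderivX mnm1E.
  case: eqP => [->|_].
    rewrite mnm_subUU.
    rewrite mpolyX0 scale1r mul1r mderiv_comm -scalerAr scalerA mulr1 -scalerDr.
    by congr (_ *: _); rewrite mulrDr addrC mulrA.
  by rewrite scale0r mul0r add0r mderiv_comm -scalerAr scalerA mulr0 scale0r addr0 mulrA.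
rewrite addrC /vf -big_split; apply: eq_bigr => l _ /=.
transitivity (\sum_i ((\sum_l' \sum_i'
  (A l i * B l' i') *: ('X_l * 'X_l' * f^`M(i)^`M(i'))) +
  \sum_i' (A l i * B i i') *: ('X_l * f^`M(i')))).
  apply: eq_bigr => i _.
  under eq_bigr => l' _ do rewrite big_split /=.
  rewrite big_split /=; congr (_ + _).
  rewrite (bigD1 i) //= [X in _ + X]big1 ?addr0 => [|l' /negPf ->]; last first.
    by apply: big1 => i' _; rewrite mulr0 scale0r.
  by apply: eq_bigr => i' _; rewrite eqxx mulr1.
rewrite big_split /=; congr (_ + _).
rewrite exchange_big /=; apply: eq_bigr => i' _.
by rewrite mxE scaler_suml.
Qed.

Lemma vf_bracket A B f : vf (A *m B - B *m A) f = vf A (vf B f) - vf B (vf A f).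
Proof.
rewrite vfB !vf_vf opprD addrACA -[LHS]addr0; congr (_ + _).
apply/esym/eqP; rewrite subr_eq0; apply/eqP.
rewrite pair_bigA [RHS]pair_bigA /=; under eq_bigr do rewrite pair_bigA; under [RHS]eq_bigr do rewrite pair_bigA.
rewrite exchange_big; apply: eq_bigr => -[l i] _; apply: eq_bigr => -[l' i'] _ /=.
by rewrite [B _ _ * _]mulrC mderiv_comm ['X_l * _]mulrC.
Qed.

Lemma meval_vf A f (v : 'rV[F]_k) :
  (vf A f).@[v 0] = (v *m A *m (\col_i (f^`M(i)).@[v 0])) 0 0.
Proof.
rewrite /vf raddf_sum mxE.
under eq_bigr => l _ do rewrite raddf_sum /=.
rewrite exchange_big /=; apply: eq_bigr => i _.
rewrite !mxE mulr_suml; apply: eq_bigr => l _.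
by rewrite mevalZ mevalM mevalXU mulrA [A l i * _]mulrC.
Qed.

Lemma mderiv_vf A f j : (vf A f)^`M(j) = vf A (f^`M(j)) + \sum_i A j i *: f^`M(i).
Proof.
rewrite /vf linear_sum (bigD1 j) //= [in RHS](bigD1 j) //= addrAC.
congr (_ + _); last first.
  apply: eq_bigr => l lj; rewrite linear_sum; apply: eq_bigr => i _.
  by rewrite /= linearZ /= mderivM mderivX mnm1E (negPf lj) scale0r mul0r add0r mderiv_comm.
rewrite linear_sum -big_split; apply: eq_bigr => i _.
rewrite /= linearZ /= mderivM mderivX mnm1E eqxx scale1r mderiv_comm.
by rewrite mnm_subUU mpolyX0 mul1r addrC scalerDr.
Qed.

Section CharZero.
Hypothesis hF : [pchar F] =i pred0.

Lemma natrF_eq0 m : (m%:R == 0 :> F) = (m == 0%N).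
Proof. by move/pcharf0P: hF => ->. Qed.

(** The span of the partial derivatives of [f] of order exactly [m], given by closure rules so that
    no multi-index appears and every later argument is a structural induction. *)
Inductive dspan f : nat -> P -> Prop :=
| dspan_base : dspan f 0 f
| dspan_zero m : dspan f m 0
| dspan_comb m c g h : dspan f m g -> dspan f m h -> dspan f m (c *: g + h)
| dspan_deriv m i g : dspan f m g -> dspan f m.+1 (g^`M(i)).

Lemma dspan_sum f m (I : Type) (r : seq I) (c : I -> F) (h : I -> P) :
  (forall i, dspan f m (h i)) -> dspan f m (\sum_(i <- r) c i *: h i).
Proof.
move=> hh; elim: r => [|i r IHr]; rewrite ?big_nil ?big_cons; first exact: dspan_zero.
exact: dspan_comb.
Qed.

Lemma dspan_succ f i m g : dspan (f^`M(i)) m g -> dspan f m.+1 g.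
Proof.
elim=> [|m'|m' c g1 g2 _ h1 _ h2|m' j g1 _ h1].
- exact/dspan_deriv/dspan_base.
- exact: dspan_zero.
- exact: dspan_comb.
- exact: dspan_deriv.
Qed.

(** Taylor expansion at [v], by induction on the degree: the first derivatives vanish identically,
    so in characteristic zero [f] is a constant, equal to its value at [v]. *)
Lemma dspan_zero_eq f (v : 'rV[F]_k) :
  (forall m g, dspan f m g -> g.@[v 0] = 0) -> f = 0.
Proof.
move: {2}(msize f) (leqnn (msize f)) => s; elim: s f => [|s IHs] f.
  by rewrite leqn0 msize_poly_eq0 => /eqP.
move=> hs hd.
have d0 i : f^`M(i) = 0.
  apply: IHs => [|m g /dspan_succ]; last exact: hd.
  rewrite msizeE; apply/bigmax_leqP_seq => m hm _.
  have : (m + U_(i))%MM \in msupp f.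
    move: hm; rewrite !mcoeff_msupp mcoeff_mderiv; apply: contraNneq => ->.
    by rewrite mul0rn.
  by move/msize_mdeg_lt; rewrite mdegD mdeg1 addn1 => h; rewrite -ltnS (leq_trans h hs).
have fC : f = (f@_0)%:MP.
  apply/mpolyP => m; rewrite mcoeffC; case: eqP => [->|/eqP m0]; first by rewrite mulr1.
  rewrite mulr0; have [i mi] : exists i, m i != 0%N.
    by apply/existsP; apply: contraNT m0 => /existsPn h; apply/eqP/mnmP => i; rewrite mnm0E; move/negbNE/eqP: (h i).
  have := congr1 (mcoeff (m - U_(i))%MM) (d0 i).
  rewrite mcoeff_mderiv mcoeff0 submK; last by rewrite lep1mP.
  move/eqP; rewrite -mulr_natr mulf_eq0 natrF_eq0 orbF => /eqP ->; exact: erefl.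
by have := hd _ _ (dspan_base f); rewrite fC mevalC => ->.
Qed.

(** The commutator of a linear vector field with a partial derivative is a combination of partial
    derivatives, so it does not change the order. *)
Lemma dspan_vf A f x m g : vf A f = x *: f -> dspan f m g -> dspan f m (vf A g).
Proof.
move=> hf; elim=> [|m'|m' c g1 g2 _ h1 _ h2|m' j g1 d1 h1].
- by rewrite hf -[_ *: _]addr0; apply: dspan_comb; [exact: dspan_base|exact: dspan_zero].
- by rewrite linear0; exact: dspan_zero.
- by rewrite linearP; exact: dspan_comb.
- have -> : vf A g1^`M(j) = (-1) *: (\sum_i A j i *: g1^`M(i)) + (vf A g1)^`M(j).
    by rewrite mderiv_vf scaleN1r addrCA addNr addr0.
  by apply: dspan_comb; [apply: dspan_sum => i|]; exact: dspan_deriv.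
Qed.

(* The hypothesis on c says that the vector fields in T span the tangent space
   at v: the orbit of v under the group they generate is open. *)
Lemma open_orbit_eq0 (T : 'M[F]_k -> Prop) f (v : 'rV[F]_k) :
  (forall A, T A -> exists x, vf A f = x *: f) ->
  (forall c : 'cV[F]_k, (forall A, T A -> (v *m A *m c) 0 0 = 0) -> c = 0) ->
  f.@[v 0] = 0 -> f = 0.
Proof.
move=> hT hv fv; apply: (@dspan_zero_eq _ v) => m; elim: m => [|m IHm] g.
  move E : {1}0%N => z hg; elim: hg E => {z g} //= [m _|m c g h _ IHg _ IHh E].
    by rewrite meval0.
  by rewrite mevalD mevalZ IHg // IHh // mulr0 addr0.
move E : {1}m.+1 => z hg; elim: hg E => {z g} //= [m' _|m' c g h _ IHg _ IHh E|m' i g hg _ [E]].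
- by rewrite meval0.
- by rewrite mevalD mevalZ IHg // IHh // mulr0 addr0.
- rewrite -E in hg.
  (* The gradient of [g] at [v] annihilates every tangent direction [v *m A]: [vf A g] still has
     order [m], so it vanishes at [v] by induction. *)
  have /matrixP/(_ i 0) : \col_i (g^`M(i)).@[v 0] = 0.
    apply: hv => A /hT[x hx]; rewrite -meval_vf; apply: IHm; exact: dspan_vf hx hg.
  by rewrite !mxE.
Qed.

End CharZero.
End LinearVectorFields.

(** * The apolar form and weights of monomials *)

Lemma not_all_imply (T : Type) (Q R : T -> Prop) :
  ~ (forall x, Q x -> R x) -> exists2 x, Q x & ~ R x.
Proof.
move=> h; apply: NNPP => h'; apply: h => x Qx; apply: NNPP => nR.
by apply: h'; exists x.
Qed.

Section FischerForm.
Variables (F : fieldType) (k : nat).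
Local Notation P := {mpoly F[k]}.
Implicit Types (A B : 'M[F]_k) (f g : P) (m : 'X_{1..k}).

Definition mfact m : nat := \prod_i (m i)`!.

Definition fischer f g : F := \sum_(m <- msupp f) f@_m * g@_m * (mfact m)%:R.

Lemma fischer_seq f g (s : seq 'X_{1..k}) : uniq s -> {subset msupp f <= s} ->
  fischer f g = \sum_(m <- s) f@_m * g@_m * (mfact m)%:R.
Proof.
move=> us hs; rewrite [RHS](bigID (mem (msupp f))) /= [X in _ + X]big1 => [|m /memN_msupp_eq0 ->].
  rewrite addr0 -big_filter; apply: perm_big; apply: uniq_perm.
  - exact: msupp_uniq.
  - exact: filter_uniq.
  - by move=> m; rewrite mem_filter /=; case E: (m \in msupp f) => //=; rewrite hs.
by rewrite !mul0r.
Qed.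

Lemma fischerC f g : fischer f g = fischer g f.
Proof.
pose s := undup (msupp f ++ msupp g).
rewrite !(@fischer_seq _ _ s) ?undup_uniq // => [|m mg|m mf].
- by apply: eq_bigr => m _; rewrite [f@_m * _]mulrC.
- by rewrite mem_undup mem_cat mg orbT.
- by rewrite mem_undup mem_cat mf.
Qed.

Lemma fischerPr c f g h : fischer f (c *: g + h) = c * fischer f g + fischer f h.
Proof.
rewrite /fischer mulr_sumr -big_split; apply: eq_bigr => m _ /=.
by rewrite mcoeffD mcoeffZ; ring.
Qed.

Lemma fischer_is_scalar f : scalar (fischer f).
Proof. by move=> c g h; exact: fischerPr. Qed.
HB.instance Definition _ f := GRing.isLinear.Build F P F _ (fischer f) (fischer_is_scalar f).

Lemma fischerZr c f g : fischer f (c *: g) = c * fischer f g.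
Proof. exact: linearZ. Qed.

Lemma fischerX m g : fischer 'X_[m] g = g@_m * (mfact m)%:R.
Proof. by rewrite /fischer msuppX big_seq1 mcoeffX eqxx mul1r. Qed.

Lemma mfactU m i : mfact (m + U_(i)) = ((m i).+1 * mfact m)%N.
Proof.
rewrite /mfact (bigD1 i) //= [in RHS](bigD1 i) //= mulnA; congr (_ * _)%N.
  by rewrite mnmDE mnm1E eqxx addn1 factS.
by apply: eq_bigr => j ji; rewrite mnmDE mnm1E eq_sym (negPf ji) addn0.
Qed.

(** The weight [mfact] is chosen for this: raising the exponent of ['X_i] multiplies the factorial
    by [(m i).+1], which is the coefficient that differentiation produces. *)
Lemma fischer_mulX i f g : fischer ('X_i * f) g = fischer f g^`M(i).
Proof.
rewrite fischerC [RHS]fischerC.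
have [r [c ->]] : exists r, exists c, f = \sum_(m <- r) c m *: 'X_[m].
  by exists (msupp f), (fun m => f@_m); exact: mpolyE.
rewrite mulr_sumr !linear_sum; apply: eq_bigr => m _ /=.
rewrite -scalerAr !fischerZr; congr (_ * _).
rewrite fischerC [RHS]fischerC -mpolyXD !fischerX addmC mfactU mcoeff_mderiv natrM.
by rewrite mulrA [_ * (m i).+1%:R]mulr_natr.
Qed.

Lemma fischer_vf A f g : fischer (vf A f) g = fischer f (vf A^T g).
Proof.
rewrite fischerC /vf linear_sum [in RHS]linear_sum /=.
under eq_bigr do rewrite linear_sum /=; under [RHS]eq_bigr do rewrite linear_sum /=.
rewrite exchange_big; apply: eq_bigr => i _; apply: eq_bigr => l _ /=.
by rewrite !fischerZr mxE; congr (_ * _); rewrite fischerC fischer_mulX fischerC [RHS]fischerC fischer_mulX.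
Qed.

(** [F] carries no order, so positivity is used over the integers: the value is the image of a sum
    of squares with positive weights, and characteristic zero keeps a positive integer nonzero. *)
Lemma fischer_int_neq0 (p : {mpoly int[k]}) : [pchar F] =i pred0 -> p != 0 ->
  fischer (map_mpoly intr p) (map_mpoly intr p) != 0.
Proof.
move=> hF p0; rewrite (@fischer_seq _ _ (msupp p)) ?msupp_uniq //; last first.
  by move=> m; rewrite !mcoeff_msupp mcoeff_map_mpoly; apply: contraNneq => ->.
pose z := (\sum_(m <- msupp p) p@_m * p@_m * (mfact m)%:R)%R.
have -> : \sum_(m <- msupp p) (map_mpoly intr p)@_m * (map_mpoly intr p)@_m * (mfact m)%:R
          = z%:~R :> F.
  rewrite rmorph_sum; apply: eq_bigr => m _ /=.
  by rewrite mcoeff_map_mpoly !rmorphM /= natz.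
have z0 : 0 < z.
  rewrite /z; case E: (msupp p) => [|m s]; first by rewrite -(msuppnil0 E) eqxx in p0.
  have pm : p@_m != 0 by rewrite -mcoeff_msupp E mem_head.
  rewrite big_cons; apply: ltr_wpDr.
    by apply: sumr_ge0 => i _; rewrite mulr_ge0 ?ler0n // -expr2 sqr_ge0.
  rewrite mulr_gt0 // -?expr2 ?exprn_even_gt0 //=.
  by rewrite ltr0n /mfact prodn_gt0 // => i; rewrite fact_gt0.
by case: z z0 => // -[//|z] _; rewrite -pmulrn (natrF_eq0 hF).
Qed.
End FischerForm.

Section WeightsOfMonomials.
Variables (F : fieldType) (k : nat).
Local Notation P := {mpoly F[k]}.
Implicit Types (A B : 'M[F]_k) (f g : P) (m : 'X_{1..k}).

Lemma mcoeff_XD i f m : ('X_i * f^`M(i))@_m = f@_m *+ m i.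
Proof.
have [mi|mi] := eqVneq (m i) 0%N; last first.
  rewrite -(submK (_ : (U_(i) <= m)%MM)) ?lep1mP // addmC mulrC mcoeffMX.
  by rewrite mcoeff_mderiv addmC mnmDE mnm1E eqxx add1n.
rewrite mi mulr0n; apply/eqP; rewrite mcoeff_eq0; apply/negP => /msuppM_le /allpairsP[[m1 m2] /=].
rewrite msuppX inE => -[/eqP -> _ E].
by move: mi; rewrite E mnmDE mnm1E eqxx.
Qed.

Lemma mcoeff_vf_diag A f m : is_diag_mx A -> (vf A f)@_m = (\sum_i A i i *+ m i) * f@_m.
Proof.
move=> /is_diag_mxP dA; rewrite /vf linear_sum mulr_suml; apply: eq_bigr => l _ /=.
rewrite linear_sum (bigD1 l) //= big1 => [|i il].
  by rewrite addr0 mcoeffZ mcoeff_XD mulrnAl mulrnAr.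
by rewrite dA ?scale0r ?mcoeff0 // eq_sym.
Qed.

Lemma msupp_vf A f m : m \in msupp (vf A f) ->
  exists l i m', [/\ A l i != 0, m = (U_(l) + m')%MM & (m' + U_(i))%MM \in msupp f].
Proof.
rewrite mcoeff_msupp linear_sum /=.
case: (boolP [exists l, exists i, A l i * ('X_l * f^`M(i))@_m != 0]) => [|/existsPn h].
  move=> /existsP[l /existsP[i]]; rewrite mulf_eq0 negb_or => /andP[Ali].
  rewrite -mcoeff_msupp => /msuppM_le /allpairsP[[m1 m2] /=].
  rewrite msuppX inE => -[/eqP -> h2 E] _; exists l, i, m2; split=> //.
  by move: h2; rewrite !mcoeff_msupp mcoeff_mderiv; apply: contraNneq => ->; rewrite mul0rn.
rewrite big1 ?eqxx // => l _; rewrite linear_sum big1 //= => i _.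
by move/existsPn: (h l) => /(_ i) /negbNE/eqP; rewrite mcoeffZ.
Qed.

(* A nilpotent action has a nonzero kernel: raising operators increase the
   bounded weight ht of monomials. *)
Lemma exists_vf_killed (N : P -> Prop) (U : 'M[F]_k -> Prop) (w : 'I_k -> nat) (K : nat) :
  (forall A f, U A -> N f -> N (vf A f)) ->
  (forall A l i, U A -> A l i != 0 -> (w i < w l)%N) ->
  (forall f m, N f -> m \in msupp f -> (\sum_i w i * m i <= K)%N) ->
  (exists2 f, N f & f != 0) ->
  exists2 f, N f & f != 0 /\ (forall A, U A -> vf A f = 0).
Proof.
pose ht m := (\sum_i w i * m i)%N.
have htU m i : ht (m + U_(i))%MM = (ht m + w i)%N.
  rewrite /ht (bigD1 i) //= [in RHS](bigD1 i) //= mnmDE mnm1E eqxx mulnDr muln1 addnAC.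
  by congr (_ + _ + _)%N; apply: eq_bigr => j ji; rewrite mnmDE mnm1E eq_sym (negPf ji) addn0.
move=> NU Uw NK [f Nf f0].
(* [j] measures the room left between the lowest monomial of [f] and the bound [K]; an operator of
   [U] that does not kill [f] uses up at least one unit of it. *)
have [j hf] : exists j, forall m, m \in msupp f -> (K < ht m + j)%N.
  by exists K.+1 => m _; rewrite addnS ltnS leq_addl.
elim: j f Nf f0 hf => [|j IHj] f Nf f0 hf.
  have m0 := mlead_supp f0; have := hf _ m0.
  by rewrite addn0 ltnNge (NK _ _ Nf m0).
case: (classic (forall A, U A -> vf A f = 0)) => [h|/not_all_imply[A UA /eqP A0]].
  by exists f.
apply: (IHj _ (NU _ _ UA Nf) A0) => m /msupp_vf[l [i [m' [Ali -> /hf]]]].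
have := Uw _ _ _ UA Ali; rewrite [(U_(l) + m')%MM]addmC !htU; lia.
Qed.

(* An element with the fewest monomials is a simultaneous eigenvector of the
   diagonal operators. *)
Lemma exists_vf_eigen (N : P -> Prop) (H : 'M[F]_k -> Prop) :
  (forall c f g, N f -> N g -> N (c *: f + g)) ->
  (forall A f, H A -> N f -> N (vf A f)) ->
  (forall A, H A -> is_diag_mx A) ->
  (exists2 f, N f & f != 0) ->
  exists2 f, N f & f != 0 /\ (forall A, H A -> exists x, vf A f = x *: f).
Proof.
move=> Nlin NH Hd [f]; move: {2}(size (msupp f)) (leqnn (size (msupp f))) => s.
elim: s f => [|s IHs] f hs Nf f0.
  by move: hs f0; rewrite leqn0 size_eq0 msupp_eq0 => ->.
(* The eigenvalue of [A] on the leading monomial: subtracting it from [vf A] removes that monomial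
   from the support and adds none. *)
pose x A := \sum_i A i i *+ (mlead f i).
case: (classic (forall A, H A -> - x A *: f + vf A f = 0)) => [h|]; last first.
  move=> /not_all_imply[A HA /eqP A0].
  apply: (IHs _ _ _ A0); last by apply: Nlin => //; exact: NH.
  rewrite -ltnS; apply: leq_trans hs.
  have sub : {subset msupp (- x A *: f + vf A f) <= rem (mlead f) (msupp f)}.
    move=> m; rewrite mem_rem_uniq ?msupp_uniq // !inE !mcoeff_msupp mcoeffD mcoeffZ.
    rewrite (mcoeff_vf_diag _ _ (Hd _ HA)) -mulrDl mulf_eq0 negb_or => /andP[h ->]; rewrite andbT.
    by apply: contraNneq h => ->; rewrite addNr.
  have m0 := mlead_supp f0.
  apply: (leq_ltn_trans (uniq_leq_size (msupp_uniq _) sub)).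
  by rewrite size_rem // prednK //; case: (msupp f) m0.
exists f => //; split=> // A /h/eqP; rewrite addrC scaleNr subr_eq0 => /eqP ->; by exists (x A).
Qed.

Lemma msupp_meval_neq0 f (v : 'I_k -> F) : f.@[v] != 0 ->
  exists2 m, m \in msupp f & forall i, v i = 0 -> m i = 0%N.
Proof.
move=> fv; case: (boolP (has (fun m => [forall i, (v i == 0) ==> (m i == 0%N)]) (msupp f))).
  move=> /hasP[m mf /forallP h]; exists m => // i /eqP vi; apply/eqP.
  by have := h i; rewrite vi.
move=> /hasPn h; case/negP: fv; apply/eqP; rewrite mevalE big_seq big1 // => m /h.
rewrite negb_forall => /existsP[i]; rewrite negb_imply => /andP[/eqP vi mi].
by rewrite (bigD1 i) //= vi expr0n (negPf mi) mul0r mulr0.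
Qed.
End WeightsOfMonomials.

(** * Row and column operations on a matrix of variables *)

Section Triangular.
Variables (F : fieldType) (N : nat).
Implicit Types X Y H : 'M[F]_N.

Definition supper X := forall p q : 'I_N, (q <= p)%N -> X p q = 0.
Definition supper_part X : 'M[F]_N := \matrix_(p, q) if (p < q)%N then X p q else 0.
Definition diag_part X : 'M[F]_N := \matrix_(p, q) if p == q then X p q else 0.

Lemma supper_partP X : supper (supper_part X).
Proof. by move=> p q; rewrite mxE ltnNge => ->. Qed.

Lemma diag_partP X : is_diag_mx (diag_part X).
Proof. by apply/is_diag_mxP => p q pq; rewrite mxE -val_eqE (negPf pq). Qed.

Lemma triangular_decomp X : X = (supper_part X^T)^T + (diag_part X + supper_part X).
Proof.
apply/matrixP => p q; rewrite !mxE -val_eqE /=.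
by case: ltngtP => // h; rewrite ?add0r ?addr0.
Qed.

Lemma supper_comm_diag X H : supper X -> is_diag_mx H -> supper (X *m H - H *m X).
Proof.
move=> sX /is_diag_mxP dH p q qp; rewrite !mxE (bigD1 q) //= big1 => [|k kq]; last by rewrite dH ?mulr0.
rewrite (bigD1 p) //= big1 => [|k kp]; last by rewrite dH ?mul0r // eq_sym.
by rewrite sX // mul0r mulr0 !addr0 subrr.
Qed.

(* what the arguments use of sl and of the fixed subalgebra *)
Record split_subalg (g : pred 'M[F]_N) : Prop := SplitSubalg {
  split_lin : forall c X Y, g X -> g Y -> g (c *: X + Y);
  split_tr : forall X, g X -> g X^T;
  split_bracket : forall X Y, g X -> g Y -> g (X *m Y - Y *m X);
  split_supper : forall X, g X -> g (supper_part X);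
  split_diag : forall X, g X -> g (diag_part X) }.

(** * Submodules generated by lowering operators *)

Section Cyclic.
Variables (E : lmodType F) (op : 'M[F]_N -> E -> E) (g : pred 'M[F]_N).
Hypothesis gS : split_subalg g.
Hypothesis opX : forall c X Y e, op (c *: X + Y) e = c *: op X e + op Y e.
Hypothesis opE : forall X c e e', op X (c *: e + e') = c *: op X e + op X e'.
Hypothesis opB : forall X Y e, g X -> g Y -> op (X *m Y - Y *m X) e = op X (op Y e) - op Y (op X e).

(** The module [E] is kept abstract because two are needed: the product of the given module with the
    polynomial ring, and the polynomial ring alone under the fixed subalgebra. Only strictly lower
    elements are applied, so that properties of the span can be proved by looking at lowering
    operators. *)
Inductive cyclic e0 : E -> Prop :=
| cyclic_base : cyclic e0 e0
| cyclic_zero : cyclic e0 0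
| cyclic_comb c e e' : cyclic e0 e -> cyclic e0 e' -> cyclic e0 (c *: e + e')
| cyclic_lower X e : g X -> supper X^T -> cyclic e0 e -> cyclic e0 (op X e).

Lemma op_add X Y e : op (X + Y) e = op X e + op Y e.
Proof. by have := opX 1 X Y e; rewrite !scale1r. Qed.

Lemma op_zero X : op X 0 = 0.
Proof.
have := opE X 1 0 0; rewrite !scale1r addr0 => /eqP.
by rewrite -subr_eq0 opprD addrA subrr sub0r oppr_eq0 => /eqP.
Qed.

(** The identity [X Y = Y X + [X, Y]] moves any element past a lowering operator; as the induction
    treats all elements of [g] at once, the bracket is covered too. At [e0] itself the triangular
    decomposition applies. No ordering of products as in the Poincaré-Birkhoff-Witt theorem is
    involved. *)
Lemma cyclic_stable e0 :
  (forall X, g X -> supper X -> op X e0 = 0) ->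
  (forall H, g H -> is_diag_mx H -> exists x, op H e0 = x *: e0) ->
  forall e, cyclic e0 e -> forall X, g X -> cyclic e0 (op X e).
Proof.
move=> kill eigen e; elim=> [||c e1 e2 _ h1 _ h2|Y e1 gY lY c1 h1] X0 gX; last 1 first.
- have -> : op X0 (op Y e1) = 1 *: op Y (op X0 e1) + op (X0 *m Y - Y *m X0) e1.
    by rewrite opB // scale1r addrCA subrr addr0.
  apply: cyclic_comb; first by apply: cyclic_lower => //; exact: h1.
  by apply: h1; exact: split_bracket.
- have gl : g (supper_part X0^T)^T by do !apply: split_tr => //; apply: split_supper => //; apply: split_tr.
  rewrite [X0]triangular_decomp !op_add (kill _ (split_supper gS gX) (@supper_partP _)) addr0.
  have [x ->] := eigen _ (split_diag gS gX) (diag_partP _).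
  rewrite addrC; apply: cyclic_comb; first exact: cyclic_base.
  by apply: cyclic_lower (cyclic_base _); rewrite ?trmxK //; exact: supper_partP.
- by rewrite op_zero; exact: cyclic_zero.
- by rewrite opE; apply: cyclic_comb; [exact: h1|exact: h2].
Qed.
End Cyclic.
End Triangular.

Section Model.
Variables (F : fieldType) (N : nat).
Local Notation P := {mpoly F[N * 3]}.
Implicit Types (X Y H : 'M[F]_N) (B : 'M[F]_3) (f g : P).

(** The transpose makes [rowmx] multiplicative, as points are row vectors acted on from the right.
    On the variables it makes each column a copy of the standard representation. *)
Definition rowmx X : 'M[F]_(N * 3) := lin_mulmx X^T.
Definition colmx B : 'M[F]_(N * 3) := lin_mulmxr B.

Lemma lin_mx_delta (f : {linear 'M[F]_(N, 3) -> 'M[F]_(N, 3)}) p j q j' :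
  lin_mx f (mxvec_index p j) (mxvec_index q j') = f (delta_mx p j) q j'.
Proof.
rewrite -(mxvecE (f _)) -mul_vec_lin mxvec_delta.
by rewrite -rowE [RHS]mxE.
Qed.

Lemma rowmxE X p j q j' : rowmx X (mxvec_index p j) (mxvec_index q j') = X p q *+ (j == j').
Proof.
rewrite lin_mx_delta /= mxE (bigD1 p) //= big1 => [|k kp].
  by rewrite !mxE eqxx eq_sym addr0 mulr_natr.
by rewrite !mxE (negPf kp) mulr0.
Qed.

Lemma colmxE B p j q j' : colmx B (mxvec_index p j) (mxvec_index q j') = B j j' *+ (p == q).
Proof.
rewrite lin_mx_delta /= mxE (bigD1 j) //= big1 => [|k kp].
  by rewrite !mxE eqxx andbT eq_sym addr0 mulr_natl.
by rewrite !mxE (negPf kp) andbF mul0r.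
Qed.

Lemma lin_mx_eq (A B : 'M[F]_(N * 3)) :
  (forall M : 'M[F]_(N, 3), mxvec M *m A = mxvec M *m B) -> A = B.
Proof.
by move=> h; apply/row_matrixP => i; rewrite !rowE -[delta_mx 0 i]vec_mxK h.
Qed.

Lemma mxvec_rowmx (M : 'M[F]_(N, 3)) X : mxvec M *m rowmx X = mxvec (X^T *m M).
Proof. by rewrite mul_vec_lin. Qed.

Lemma mxvec_colmx (M : 'M[F]_(N, 3)) B : mxvec M *m colmx B = mxvec (M *m B).
Proof. by rewrite mul_vec_lin. Qed.

Lemma rowmxP c X Y : rowmx (c *: X + Y) = c *: rowmx X + rowmx Y.
Proof.
apply: lin_mx_eq => M; rewrite mulmxDr -scalemxAr !mxvec_rowmx.
by rewrite linearP mulmxDl -scalemxAl linearP.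
Qed.

Lemma rowmxM X Y : rowmx (X *m Y) = rowmx X *m rowmx Y.
Proof. by apply: lin_mx_eq => M; rewrite mulmxA !mxvec_rowmx trmx_mul mulmxA. Qed.

Lemma rowmx_bracket X Y : rowmx (X *m Y - Y *m X) = rowmx X *m rowmx Y - rowmx Y *m rowmx X.
Proof. by rewrite addrC -scaleN1r rowmxP scaleN1r addrC !rowmxM. Qed.

Lemma rowmx_colmx X B : rowmx X *m colmx B = colmx B *m rowmx X.
Proof. by apply: lin_mx_eq => M; rewrite !mulmxA !mxvec_rowmx !mxvec_colmx mxvec_rowmx mulmxA. Qed.

Lemma rowmx_tr X : (rowmx X)^T = rowmx X^T.
Proof.
apply/matrixP => l i; case/mxvec_indexP: l => p j; case/mxvec_indexP: i => q j'.
by rewrite mxE !rowmxE mxE eq_sym.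
Qed.

Lemma rowmx_diag H : is_diag_mx H -> is_diag_mx (rowmx H).
Proof.
move/is_diag_mxP => dH; apply/is_diag_mxP => l i.
case/mxvec_indexP: l => p j; case/mxvec_indexP: i => q j'; rewrite rowmxE.
have [-> h|ne _] := eqVneq j j'; last by [].
by rewrite dH //; apply: contraNneq h => /val_inj ->.
Qed.

Lemma colmx_diag j : is_diag_mx (colmx (delta_mx j j)).
Proof.
apply/is_diag_mxP => l i; case/mxvec_indexP: l => p j1; case/mxvec_indexP: i => q j2.
rewrite colmxE !mxE; have [<-|//] := eqVneq p q.
by have [->|//] := eqVneq j1 j; have [->|//] := eqVneq j2 j; rewrite eqxx.
Qed.

Lemma sum_mxvec (V : nmodType) (h : 'I_(N * 3) -> V) :
  \sum_i h i = \sum_p \sum_j h (mxvec_index p j).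
Proof.
rewrite pair_bigA /= (reindex (uncurry (@mxvec_index N 3))) /=; last first.
  by have [k h1 h2] := curry_mxvec_bij N 3; exists k => x _; [exact: h1|exact: h2].
by apply: eq_bigr => -[].
Qed.

Definition xv p j : P := 'X_(mxvec_index p j).
Definition row_act X f := vf (rowmx X) f.
Definition col_act B f := vf (colmx B) f.

Lemma row_act_xv X q j : row_act X (xv q j) = \sum_p X p q *: xv p j.
Proof.
rewrite /row_act vfX sum_mxvec; apply: eq_bigr => p _.
rewrite (bigD1 j) //= big1 => [|i ij]; first by rewrite rowmxE eqxx addr0.
by rewrite rowmxE (negPf ij) scale0r.
Qed.

Lemma col_act_xv B p j : col_act B (xv p j) = \sum_i B i j *: xv p i.
Proof.
rewrite /col_act vfX sum_mxvec (bigD1 p) //= [X in _ + X]big1 => [|q qp].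
  by rewrite addr0; apply: eq_bigr => i _; rewrite colmxE eqxx.
by rewrite big1 // => i _; rewrite colmxE (negPf qp) scale0r.
Qed.

Lemma row_col_act X B f : row_act X (col_act B f) = col_act B (row_act X f).
Proof.
by apply/eqP; rewrite -subr_eq0 -vf_bracket rowmx_colmx subrr vf0.
Qed.

(* The lam-weight vectors killed by the upper triangular column operations form
   a model of the simple module of highest weight lam. *)
Definition colhw (lam : 'I_3 -> nat) f :=
  (forall i j : 'I_3, (i < j)%N -> col_act (delta_mx i j) f = 0) /\
  (forall j, col_act (delta_mx j j) f = (lam j)%:R *: f).

Lemma colhw_comb lam c f g : colhw lam f -> colhw lam g -> colhw lam (c *: f + g).
Proof.
move=> [f1 f2] [g1 g2]; split=> [i j ij|j]; rewrite /col_act linearP /=.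
  by rewrite [vf _ f]f1 // [vf _ g]g1 // scaler0 addr0.
by rewrite [vf _ f]f2 // [vf _ g]g2 // scalerDr !scalerA mulrC.
Qed.

Lemma colhw0 lam : colhw lam 0.
Proof. by split=> *; rewrite /col_act linear0 ?scaler0. Qed.

Lemma colhw_row_act lam X f : colhw lam f -> colhw lam (row_act X f).
Proof.
move=> [f1 f2]; split=> [i j ij|j]; rewrite -row_col_act.
  by rewrite f1 // /row_act linear0.
by rewrite f2 /row_act linearZ.
Qed.

Section Highest.
Hypothesis hF : [pchar F] =i pred0.

Lemma natrF_inj m1 m2 : m1%:R = m2%:R :> F -> m1 = m2.
Proof.
wlog le12 : m1 m2 / (m1 <= m2)%N => [hw|/eqP].
  by case/orP: (leq_total m1 m2) => h e; [exact: hw|apply/esym/hw].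
rewrite eq_sym -subr_eq0 -natrB // (natrF_eq0 hF) subn_eq0 => h; lia.
Qed.

(** The operator of [delta_mx j j] is the Euler operator of column [j], so its eigenvalue is the
    degree in that column. These degrees being fixed, the model is bounded in degree. *)
Lemma colhw_mcoeff lam f m j : colhw lam f -> m \in msupp f ->
  (\sum_p m (mxvec_index p j))%N = lam j.
Proof.
move=> [_ /(_ j)/(congr1 (mcoeff m))]; rewrite mcoeffZ mcoeff_vf_diag ?colmx_diag //.
rewrite mcoeff_msupp => e h; move/(mulIf h): e => e; apply: natrF_inj; rewrite -e sum_mxvec natr_sum.
apply: eq_bigr => p _; rewrite (bigD1 j) //= big1 => [|i ij].
  by rewrite colmxE mxE !eqxx addr0 mulr1n.
by rewrite colmxE mxE (negPf ij) !mul0rn.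
Qed.

(** Raising operators act nilpotently on [V]. The vectors they kill are stable under the diagonal
    elements, since the bracket of a strictly upper matrix with a diagonal one is strictly upper, so
    an eigenvector can be found among them. *)
Lemma exists_highest (g : pred 'M[F]_N) lam (V : P -> Prop) : split_subalg g ->
  (forall c f1 f2, V f1 -> V f2 -> V (c *: f1 + f2)) ->
  (forall f, V f -> colhw lam f) ->
  (forall X f, g X -> V f -> V (row_act X f)) ->
  (exists2 f, V f & f != 0) ->
  exists2 f, V f & [/\ f != 0, (forall X, g X -> supper X -> row_act X f = 0) &
    (forall H, g H -> is_diag_mx H -> exists x, row_act H f = x *: f)].
Proof.
move=> gS Vl VR Vg Vf.
(* A strictly upper matrix replaces a variable of row [q] by variables of rows [p < q], which
   increases [N - p]; the total degree is the sum of [lam], whence the bound. *)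
pose w l : nat := mxvec (\matrix_(p < N, j < 3) (N - p)%N) 0 l.
pose U A := exists2 X, g X /\ supper X & A = rowmx X.
pose D A := exists2 X, g X /\ is_diag_mx X & A = rowmx X.
have [f Uf [f0 kf]] : exists2 f, V f & f != 0 /\ (forall A, U A -> vf A f = 0).
  apply: (@exists_vf_killed _ _ V U w (N * \sum_j lam j)) => //.
  - by move=> _ f [X [gX _] ->]; exact: Vg.
  - move=> _ l i [X [_ sX] ->]; case/mxvec_indexP: l => p j; case/mxvec_indexP: i => q j'.
    rewrite rowmxE /w !mxvecE !mxE => h.
    have pq : (p < q)%N by rewrite ltnNge; apply: contra h => /sX ->; rewrite mul0rn.
    have := ltn_ord p; have := ltn_ord q; lia.
  - move=> f m Vf0 mf; rewrite sum_mxvec exchange_big big_distrr leq_sum // => j _ /=.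
    rewrite -(colhw_mcoeff j (VR _ Vf0) mf) big_distrr leq_sum // => p _ /=.
    by rewrite leq_mul2r /w mxvecE mxE leq_subr orbT.
have [h Vh [h0 eh]] : exists2 f, V f /\ (forall A, U A -> vf A f = 0) &
    f != 0 /\ (forall A, D A -> exists x, vf A f = x *: f).
  apply: exists_vf_eigen => [c f1 f2 [V1 k1] [V2 k2]|_ f1 [H [gH dH] ->] [V1 k1]|_ [H [gH dH] ->]|].
  - by split=> [|A UA]; [exact: Vl|rewrite linearP /= k1 // k2 // scaler0 addr0].
  - split=> [|_ [X [gX sX] ->]]; first exact: Vg.
    have kX : vf (rowmx X) f1 = 0 by apply: k1; exists X.
    have := vf_bracket (rowmx X) (rowmx H) f1; rewrite -rowmx_bracket kX linear0 subr0 => <-.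
    apply: k1; exists (X *m H - H *m X) => //.
    by split; [exact: split_bracket|exact: supper_comm_diag].
  - exact: rowmx_diag.
  - by exists f.
exists h; first by case: Vh.
split=> // [X gX sX|H gH dH]; first by apply: (proj2 Vh); exists X.
by apply: eh; exists H.
Qed.
End Highest.
End Model.

(** * The covariants *)

Definition c0 : 'I_3 := @Ordinal 3 0 isT.
Definition c1 : 'I_3 := @Ordinal 3 1 isT.
Definition c2 : 'I_3 := @Ordinal 3 2 isT.

Lemma ord3P (Q : 'I_3 -> Prop) : Q c0 -> Q c1 -> Q c2 -> forall j, Q j.
Proof.
move=> q0 q1 q2 [[|[|[|//]]] h].
- by rewrite (_ : Ordinal h = c0) //; apply: val_inj.
- by rewrite (_ : Ordinal h = c1) //; apply: val_inj.
- by rewrite (_ : Ordinal h = c2) //; apply: val_inj.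
Qed.

Lemma sum3 (V : nmodType) (h : 'I_3 -> V) : \sum_j h j = h c0 + h c1 + h c2.
Proof.
rewrite !big_ord_recl big_ord0 addr0 addrA.
by congr (h _ + h _ + h _); apply: val_inj.
Qed.

Lemma sign_rev (R : pzRingType) n (r : 'I_(n.*2)) : (-1) ^+ rev_ord r = - (-1) ^+ r :> R.
Proof.
rewrite /= -signr_odd -[in RHS]signr_odd.
have -> : odd (n.*2 - r.+1) = ~~ odd r.
  by rewrite oddB ?ltn_ord // odd_double.
by case: (odd r); rewrite /= ?expr1 ?expr0 ?opprK.
Qed.

Section Generators.
Variables (R : comNzRingType) (n : nat).
Local Notation N := (n.*2).
Local Notation P := {mpoly R[N * 3]}.
Variables (r0 r1 r2 : 'I_N).

(** The covariants are defined over any commutative ring, so that those over [F] are images of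
    integral ones. *)
Definition xR (p : 'I_N) (j : 'I_3) : P := 'X_(mxvec_index p j).
(* the symplectic pairing of columns i and j *)
Definition zR (i j : 'I_3) : P := \sum_(r < N) (-1) ^+ r * (xR r i * xR (rev_ord r) j).
Definition minor2 (i j : 'I_3) : P := xR r0 i * xR r1 j - xR r0 j * xR r1 i.

(** By shape and symplectic weight: [gen1], [gen2], [gen4] are the leading minors of sizes 1, 2, 3,
    highest weight vectors of the fundamental modules. [gen3] is the invariant form, of shape
    omega_2 and weight 0. [gen5] is the Pfaffian of the pairings bordered by the first row, of shape
    omega_3 and the weight of [gen1]. [gen6] antisymmetrizes a minor times a pairing in the last two
    columns; it has shape omega_1 + omega_3 and the weight of [gen2]. For [n = 2] one has
    [gen5 = - gen4]. *)
Definition gen1 : P := xR r0 c0.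
Definition gen2 : P := minor2 c0 c1.
Definition gen3 : P := zR c0 c1.
Definition gen4 : P := minor2 c0 c1 * xR r2 c2 - minor2 c0 c2 * xR r2 c1 + minor2 c1 c2 * xR r2 c0.
Definition gen5 : P := xR r0 c0 * zR c1 c2 - xR r0 c1 * zR c0 c2 + xR r0 c2 * zR c0 c1.
Definition gen6 : P := minor2 c0 c1 * zR c0 c2 - minor2 c0 c2 * zR c0 c1.

(* e1, ..., e6 are the exponents of the generators of the algebra of covariants *)
Definition covariant (e1 e2 e3 e4 e5 e6 : nat) : P :=
  gen1 ^+ e1 * gen2 ^+ e2 * gen3 ^+ e3 * gen4 ^+ e4 * gen5 ^+ e5 * gen6 ^+ e6.

Lemma zR_anti i j : zR j i = - zR i j.
Proof.
rewrite /zR (reindex_inj rev_ord_inj) -sumrN; apply: eq_bigr => r _.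
by rewrite rev_ordK sign_rev mulNr [xR _ j * _]mulrC.
Qed.
End Generators.

Lemma map_covariant (R S : comNzRingType) (f : {rmorphism R -> S}) n (r0 r1 r2 : 'I_(n.*2)) e1 e2 e3 e4 e5 e6 :
  map_mpoly f (covariant R r0 r1 r2 e1 e2 e3 e4 e5 e6) = covariant S r0 r1 r2 e1 e2 e3 e4 e5 e6.
Proof.
have hx p j : map_mpoly f (xR R p j) = xR S p j by rewrite map_mpolyX.
have hz i j : map_mpoly f (zR R n i j) = zR S n i j.
  by rewrite rmorph_sum; apply: eq_bigr => r _ /=; rewrite !rmorphM rmorphXn rmorphN1 /= !hx.
have hm i j : map_mpoly f (minor2 R r0 r1 i j) = minor2 S r0 r1 i j.
  by rewrite rmorphB !rmorphM /= !hx.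
have h4 : map_mpoly f (gen4 R r0 r1 r2) = gen4 S r0 r1 r2.
  by rewrite rmorphD rmorphB !rmorphM /= !hm !hx.
have h5 : map_mpoly f (gen5 R r0) = gen5 S r0.
  by rewrite rmorphD rmorphB !rmorphM /= !hz !hx.
have h6 : map_mpoly f (gen6 R r0 r1) = gen6 S r0 r1.
  by rewrite rmorphB !rmorphM /= !hz !hm.
by rewrite !rmorphM !rmorphXn /= hx hm hz h4 h5 h6.
Qed.

Section InitialSums.
Variables (V : nmodType) (N : nat) (h : 'I_N -> V) (r0 r1 r2 : 'I_N).
Hypothesis v0 : r0 = 0%N :> nat.

Lemma sum_le0 : \sum_(p < N | (p <= r0)%N) h p = h r0.
Proof.
rewrite (bigD1 r0) //= big1 ?addr0 // => p /andP[]; rewrite v0 leqn0 => /eqP p0.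
by rewrite -val_eqE /= p0 v0.
Qed.

Hypothesis v1 : r1 = 1%N :> nat.

Lemma sum_le1 : \sum_(p < N | (p <= r1)%N) h p = h r0 + h r1.
Proof.
rewrite (bigD1 r1) //= addrC; congr (_ + _); rewrite -sum_le0; apply: eq_bigl => p.
by rewrite -val_eqE /= v0 v1; lia.
Qed.

Hypothesis v2 : r2 = 2%N :> nat.

Lemma sum_le2 : \sum_(p < N | (p <= r2)%N) h p = h r0 + h r1 + h r2.
Proof.
rewrite (bigD1 r2) //= addrC; congr (_ + _); rewrite -sum_le1; apply: eq_bigl => p.
by rewrite -val_eqE /= v1 v2; lia.
Qed.

End InitialSums.

(** * Row and column operations on the covariants *)

Section Actions.
Variables (F : fieldType) (n : nat).
Local Notation N := (n.*2).
Local Notation P := {mpoly F[N * 3]}.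
Variables (r0 r1 r2 : 'I_N).
Hypotheses (v0 : r0 = 0%N :> nat) (v1 : r1 = 1%N :> nat) (v2 : r2 = 2%N :> nat).
Implicit Types (X Y H : 'M[F]_N) (B : 'M[F]_3) (f g : P).
Local Notation x := (@xR F n).
Local Notation z := (zR F n).
Local Notation col_act := (@col_act F N).
Local Notation row_act := (@row_act F N).

Lemma col_act_x (a b : 'I_3) p j : col_act (delta_mx a b) (x p j) = if j == b then x p a else 0.
Proof.
rewrite [LHS](col_act_xv _ p j) (bigD1 a) //= big1 => [|i ia].
  by rewrite mxE eqxx addr0 /=; case: eqP => _; rewrite ?scale1r ?scale0r.
by rewrite mxE (negPf ia) scale0r.
Qed.

Lemma col_actM B f g : col_act B (f * g) = col_act B f * g + f * col_act B g.
Proof. exact: vfM. Qed.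

Lemma col_actB B f g : col_act B (f - g) = col_act B f - col_act B g.
Proof. exact: linearB. Qed.

Lemma col_actD B f g : col_act B (f + g) = col_act B f + col_act B g.
Proof. exact: linearD. Qed.

Lemma row_actM X f g : row_act X (f * g) = row_act X f * g + f * row_act X g.
Proof. exact: vfM. Qed.

Lemma row_actB X f g : row_act X (f - g) = row_act X f - row_act X g.
Proof. exact: linearB. Qed.

Lemma row_actD X f g : row_act X (f + g) = row_act X f + row_act X g.
Proof. exact: linearD. Qed.

Lemma vf_sign A k f : vf A ((-1) ^+ k * f) = (-1) ^+ k * vf A f :> P.
Proof. by rewrite -signr_odd; case: odd; rewrite ?expr0 ?mul1r // expr1 !mulN1r linearN. Qed.

Lemma col_act_z (a b : 'I_3) i j : col_act (delta_mx a b) (z i j) =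
  (if i == b then z a j else 0) + (if j == b then z i a else 0).
Proof.
rewrite /zR /col_act linear_sum /=.
transitivity (\sum_(r < N) ((if i == b then (-1) ^+ r * (x r a * x (rev_ord r) j) else 0)
   + (if j == b then (-1) ^+ r * (x r i * x (rev_ord r) a) else 0))).
  apply: eq_bigr => r _; rewrite vf_sign vfM [vf _ (x r i)]col_act_x [vf _ (x (rev_ord r) j)]col_act_x.
  by case: (i == b); case: (j == b); rewrite ?mul0r ?mulr0 ?add0r ?addr0 ?mulrDr ?mulr0.
by rewrite big_split; case: (i == b); case: (j == b) => /=; rewrite ?big1_eq.
Qed.

Lemma z_diag i : (2%:R : F) != 0 -> z i i = 0.
Proof.
move=> two0; apply/eqP; have /eqP := zR_anti F n i i; rewrite -addr_eq0 -mulr2n -scaler_nat scaler_eq0.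
by rewrite (negPf two0).
Qed.

Lemma row_act_x X q j : row_act X (x q j) = \sum_p X p q *: x p j.
Proof. exact: row_act_xv. Qed.

Definition utri X := forall p q : 'I_N, (q < p)%N -> X p q = 0.

Lemma sum_utri (V : lmodType F) X (q : 'I_N) (h : 'I_N -> V) : utri X ->
  \sum_p X p q *: h p = \sum_(p < N | (p <= q)%N) X p q *: h p.
Proof.
move=> uX; rewrite [LHS](bigID (fun p : 'I_N => (p <= q)%N)) /= [X in _ + X]big1 ?addr0 // => p.
by rewrite -ltnNge => /uX ->; rewrite scale0r.
Qed.

Section RowActions.
Variables (X : 'M[F]_N).
Hypothesis uX : utri X.

Lemma row_act_x0 j : row_act X (x r0 j) = (X r0 r0)%:MP * x r0 j.
Proof. by rewrite row_act_x sum_utri // (sum_le0 _ v0) mul_mpolyC. Qed.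

Lemma row_act_x1 j : row_act X (x r1 j) = (X r0 r1)%:MP * x r0 j + (X r1 r1)%:MP * x r1 j.
Proof. by rewrite row_act_x sum_utri // (sum_le1 _ v0 v1) !mul_mpolyC. Qed.

Lemma row_act_x2 j : row_act X (x r2 j) =
  (X r0 r2)%:MP * x r0 j + (X r1 r2)%:MP * x r1 j + (X r2 r2)%:MP * x r2 j.
Proof. by rewrite row_act_x sum_utri // (sum_le2 _ v0 v1 v2) !mul_mpolyC. Qed.

Lemma row_gen1 : row_act X (gen1 F r0) = X r0 r0 *: gen1 F r0.
Proof. by rewrite /gen1 row_act_x0 mul_mpolyC. Qed.

Lemma row_gen2 : row_act X (gen2 F r0 r1) = (X r0 r0 + X r1 r1) *: gen2 F r0 r1.
Proof.
rewrite /gen2 /minor2 row_actB !row_actM !row_act_x0 !row_act_x1 -mul_mpolyC mpolyCD; ring.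
Qed.

Lemma row_gen4 : row_act X (gen4 F r0 r1 r2) = (X r0 r0 + X r1 r1 + X r2 r2) *: gen4 F r0 r1 r2.
Proof.
rewrite /gen4 /minor2 !(row_actB, row_actD, row_actM) !row_act_x0 !row_act_x1 !row_act_x2.
rewrite -mul_mpolyC !mpolyCD; ring.
Qed.

Hypothesis zX : forall i j, row_act X (z i j) = 0.

Lemma row_gen3 : row_act X (gen3 F n) = 0 *: gen3 F n.
Proof. by rewrite zX scale0r. Qed.

Lemma row_gen5 : row_act X (gen5 F r0) = X r0 r0 *: gen5 F r0.
Proof.
rewrite /gen5 !(row_actB, row_actD, row_actM) !row_act_x0 !zX -mul_mpolyC; ring.
Qed.

Lemma row_gen6 : row_act X (gen6 F r0 r1) = (X r0 r0 + X r1 r1) *: gen6 F r0 r1.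
Proof.
rewrite /gen6 /minor2 !(row_actB, row_actD, row_actM) !zX !row_act_x0 !row_act_x1.
rewrite -mul_mpolyC !mpolyCD; ring.
Qed.

Lemma row_covariant e1 e2 e3 e4 e5 e6 :
  row_act X (covariant F r0 r1 r2 e1 e2 e3 e4 e5 e6) =
  ((e1 + e2 + e4 + e5 + e6)%N%:R * X r0 r0 + (e2 + e4 + e6)%N%:R * X r1 r1 + e4%:R * X r2 r2)
    *: covariant F r0 r1 r2 e1 e2 e3 e4 e5 e6.
Proof.
rewrite /row_act (vf_prod_eigen (vf_prod_eigen (vf_prod_eigen (vf_prod_eigen (vf_prod_eigen
  (vf_exp_eigen e1 row_gen1) (vf_exp_eigen e2 row_gen2)) (vf_exp_eigen e3 row_gen3))
  (vf_exp_eigen e4 row_gen4)) (vf_exp_eigen e5 row_gen5)) (vf_exp_eigen e6 row_gen6)).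
by congr (_ *: _); rewrite !natrD; ring.
Qed.
End RowActions.

(** Without [gen3], [gen5], [gen6] no pairing occurs, so every upper triangular matrix acts by a
    scalar and not only the symplectic ones. *)
Lemma row_covariant_sl X e1 e2 e4 : utri X ->
  row_act X (covariant F r0 r1 r2 e1 e2 0 e4 0 0) =
  ((e1 + e2 + e4)%N%:R * X r0 r0 + (e2 + e4)%N%:R * X r1 r1 + e4%:R * X r2 r2)
    *: covariant F r0 r1 r2 e1 e2 0 e4 0 0.
Proof.
move=> uX; rewrite /covariant !expr0 !mulr1.
rewrite /row_act (vf_prod_eigen (vf_prod_eigen
  (vf_exp_eigen e1 (row_gen1 uX)) (vf_exp_eigen e2 (row_gen2 uX))) (vf_exp_eigen e4 (row_gen4 uX))).
by congr (_ *: _); rewrite !natrD; ring.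
Qed.

(** Infinitesimal invariance of the symplectic form: after reindexing by [rev_ord], the two halves
    of the Leibniz rule cancel term by term. *)
Lemma row_act_z X : (forall r c : 'I_N, X r c = - (-1) ^+ (r + c) * X (rev_ord c) (rev_ord r)) ->
  forall i j, row_act X (z i j) = 0.
Proof.
have sgZ k a (f : P) : (-1) ^+ k * (a *: f) = ((-1) ^+ k * a) *: f.
  rewrite -[in LHS]signr_odd -[in RHS]signr_odd.
  by case: odd; rewrite ?expr0 ?expr1 ?mul1r ?mulN1r ?scaleNr.
move=> sX i j; rewrite /zR /row_act linear_sum /=.
transitivity (\sum_(r < N) ((\sum_p ((-1) ^+ r * X p r) *: (x p i * x (rev_ord r) j)) +
   \sum_p ((-1) ^+ r * X p (rev_ord r)) *: (x r i * x p j))).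
  apply: eq_bigr => r _; rewrite vf_sign vfM [vf _ (x r i)]row_act_x [vf _ (x (rev_ord r) j)]row_act_x.
  rewrite mulrDr mulr_suml !mulr_sumr; congr (_ + _); apply: eq_bigr => p _;
  first [by rewrite -scalerAl sgZ | by rewrite -scalerAr sgZ].
rewrite big_split /= [X in _ + X]exchange_big /= [X in X + _](reindex_inj rev_ord_inj) /=.
rewrite -big_split big1 //= => q _; rewrite -big_split big1 //= => p _.
rewrite rev_ordK -scalerDl sX rev_ordK.
have -> : (-1) ^+ (p + (N - q.+1)) = (-1) ^+ p * (-1) ^+ rev_ord q :> F by rewrite exprD.
rewrite -[(N - q.+1)%N]/(rev_ord q : nat) !sign_rev.
set s := (-1) ^+ q; have ss : s * s = 1 by rewrite -expr2 sqrr_sign.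
rewrite (_ : _ + _ = (1 - s * s) * ((-1) ^+ p * X q (rev_ord p))); last by ring.
by rewrite ss subrr mul0r scale0r.
Qed.

Lemma col_gen (g : P) (w0 w1 w2 : nat) :
  col_act (delta_mx c0 c1) g = 0 -> col_act (delta_mx c1 c2) g = 0 ->
  col_act (delta_mx c0 c2) g = 0 -> col_act (delta_mx c0 c0) g = g *+ w0 ->
  col_act (delta_mx c1 c1) g = g *+ w1 -> col_act (delta_mx c2 c2) g = g *+ w2 ->
  colhw (fun j => nth 0%N [:: w0; w1; w2] j) g.
Proof.
move=> h01 h12 h02 h0 h1 h2; split; last by apply: ord3P; rewrite /= scaler_nat.
by apply: ord3P; apply: ord3P.
Qed.

Let zN10 : z c1 c0 = - z c0 c1 := zR_anti F n c0 c1.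
Let zN20 : z c2 c0 = - z c0 c2 := zR_anti F n c0 c2.
Let zN21 : z c2 c1 = - z c1 c2 := zR_anti F n c1 c2.

Hypothesis two0 : (2%:R : F) != 0.

Local Ltac colgen := apply: col_gen;
  rewrite /gen1 /gen2 /gen3 /gen4 /gen5 /gen6 /minor2 ?(col_actB, col_actD, col_actM)
   ?(col_act_x, col_act_z) /= ?(z_diag _ two0) ?zN10 ?zN20 ?zN21; ring.

Lemma col_gen1 : colhw (fun j => nth 0%N [:: 1; 0; 0]%N j) (gen1 F r0).
Proof. colgen. Qed.
Lemma col_gen2 : colhw (fun j => nth 0%N [:: 1; 1; 0]%N j) (gen2 F r0 r1).
Proof. colgen. Qed.
Lemma col_gen3 : colhw (fun j => nth 0%N [:: 1; 1; 0]%N j) (gen3 F n).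
Proof. colgen. Qed.
Lemma col_gen4 : colhw (fun j => nth 0%N [:: 1; 1; 1]%N j) (gen4 F r0 r1 r2).
Proof. colgen. Qed.
Lemma col_gen5 : colhw (fun j => nth 0%N [:: 1; 1; 1]%N j) (gen5 F r0).
Proof. colgen. Qed.
Lemma col_gen6 : colhw (fun j => nth 0%N [:: 2; 1; 1]%N j) (gen6 F r0 r1).
Proof. colgen. Qed.

Lemma colhw_mul lam lam' f g : colhw lam f -> colhw lam' g ->
  colhw (fun j => (lam j + lam' j)%N) (f * g).
Proof.
move=> [f1 f2] [g1 g2]; split=> [i j ij|j].
  by rewrite col_actM f1 // g1 // mul0r mulr0 addr0.
by rewrite col_actM f2 g2 -scalerAl -scalerAr -scalerDl natrD.
Qed.

Lemma colhw_exp lam f e : colhw lam f -> colhw (fun j => (e * lam j)%N) (f ^+ e).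
Proof.
move=> hf; elim: e => [|e IHe]; last by rewrite exprS; exact: colhw_mul.
by rewrite expr0; split=> *; rewrite /col_act vf1 ?scale0r.
Qed.

Lemma colhw_covariant (lam : 'I_3 -> nat) e1 e2 e3 e4 e5 e6 :
  lam c0 = (e1 + e2 + e3 + e4 + e5 + 2 * e6)%N -> lam c1 = (e2 + e3 + e4 + e5 + e6)%N ->
  lam c2 = (e4 + e5 + e6)%N ->
  colhw lam (covariant F r0 r1 r2 e1 e2 e3 e4 e5 e6).
Proof.
move=> l0 l1 l2.
have := colhw_mul (colhw_mul (colhw_mul (colhw_mul (colhw_mul
  (colhw_exp e1 col_gen1) (colhw_exp e2 col_gen2)) (colhw_exp e3 col_gen3))
  (colhw_exp e4 col_gen4)) (colhw_exp e5 col_gen5)) (colhw_exp e6 col_gen6).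
move=> [h1 h2]; split=> // j; rewrite h2; congr (_%:R *: _).
by move: j; apply: ord3P => /=; rewrite ?l0 ?l1 ?l2; lia.
Qed.
End Actions.

(** * Slices: conormal equations *)

Section Slices.
Variables (F : fieldType) (N : nat).
Hypothesis two0 : (2%:R : F) != 0.
Variables (a : nat -> 'I_3 -> nat) (c : nat -> 'I_3 -> F).

Definition pairing p q : F := c q c0 *+ a p c0 + c q c1 *+ a p c1 + c q c2 *+ a p c2.

(* c is conormal to the orbit of the point with entries a: the equations come
   from the diagonal, the long-root and the remaining root vectors of the
   symplectic algebra, and from the upper triangular column operations. *)
Record conormal : Prop := Conormal {
  con_diag : forall p p', (p + p').+1 = N -> pairing p p = pairing p' p';
  con_long : forall p p', (p + p').+1 = N -> (p <= p')%N -> pairing p p' = 0;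
  con_short : forall p q p' q', (p + p').+1 = N -> (q + q').+1 = N -> (p <= q)%N ->
    pairing q' p' = 0 -> pairing p q = 0;
  con_col : forall i j : 'I_3, (i <= j)%N -> \sum_(p < N) c p j *+ a p i = 0 }.

Lemma sum_pick k j : (k < N)%N -> \sum_(p < N) c p j *+ (p == k :> nat) = c k j.
Proof.
move=> kN; rewrite (bigD1 (Ordinal kN)) //= eqxx big1 ?addr0 // => p pk.
by rewrite (_ : (p == k :> nat) = false) //; apply: contraNF pk => /eqP e; apply/eqP/val_inj.
Qed.

Lemma double_eq0 (x : F) : x + x = 0 -> x = 0.
Proof. by move/eqP; rewrite -mulr2n -mulr_natl mulf_eq0 (negPf two0) => /eqP. Qed.

Lemma addr0_eq0 (x y : F) : x + y = 0 -> x = 0 -> y = 0.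
Proof. by move=> h x0; rewrite x0 add0r in h. Qed.
End Slices.

(* No covariant vanishes at the points below.  The exponents of a monomial
   supported on slice1 give the last four exponents of a covariant monomial;
   slice2 and slice3 are adjusted to the exponents of gen1 and gen2. *)
Definition slice1 N (p : nat) (j : 'I_3) : nat :=
  match val j with
  | 0 => (p == 0) : nat | 1 => (p == 1) + (p == N - 1)
  | _ => (p == 2) + (p == N - 2) + (p == N - 1) end%N.
Definition slice2 N (p : nat) (j : 'I_3) : nat :=
  match val j with
  | 0 => (p == 0) + (p == 1) | 1 => (p == 0) + (p == N - 2)
  | _ => (p == 2) + (p == N - 2) end%N.
Definition slice3 N (p : nat) (j : 'I_3) : nat :=
  match val j with
  | 0 => (p == 0) : nat | 1 => (p == 1) + (p == 2) + (p == N - 1)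
  | _ => (p == 1) + (p == N - 3) end%N.

Ltac eqb := repeat match goal with |- context [@eq_op _ ?x ?y] =>
  first [have -> : (x == y) = true by lia | have -> : (x == y) = false by lia] end.
Ltac row := move=> *; rewrite /pairing /slice1 /slice2 /slice3 /=; eqb;
  rewrite /= ?addn0 ?add0n ?mulr0n ?mulr1n ?addr0 ?add0r.
Ltac colsum hc i j := have := con_col hc (isT : (i <= j)%N);
  rewrite /slice1 /slice2 /slice3 /=;
  under eq_bigr do rewrite ?mulrnDr; rewrite ?big_split /= ?sum_pick; try lia.

Section Slice1.
Variables (F : fieldType) (N : nat) (c : nat -> 'I_3 -> F).
Hypothesis two0 : (2%:R : F) != 0.

(** The torus and column equations form a small linear system for the entries of [c] in the support
    of the point, solvable because 2 is invertible. Every other entry is, up to entries already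
    known, a pairing with a row of the point, and a root vector equates it up to sign with a pairing
    already known to vanish, or with itself for a long root. [6 <= N] keeps the rows 0, 1, 2, N-3,
    N-2, N-1 distinct. The other two points are treated alike. *)
Lemma slice1_open : (6 <= N)%N -> conormal N (slice1 N) c -> forall p j, (p < N)%N -> c p j = 0.
Proof.
move=> N6 hc.
have R0 q : pairing (slice1 N) c 0 q = c q c0 by row.
have R1 q : pairing (slice1 N) c 1 q = c q c1 by row.
have R2 q : pairing (slice1 N) c 2 q = c q c2 by row.
have Rn2 q : pairing (slice1 N) c (N - 2) q = c q c2 by row.
have Rn1 q : pairing (slice1 N) c (N - 1) q = c q c1 + c q c2 by row.
have Rz p q : (2 < p < N - 2)%N -> pairing (slice1 N) c p q = 0 by row.
colsum hc c0 c0 => k00; colsum hc c0 c1 => k01; colsum hc c0 c2 => k02.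
colsum hc c1 c1 => k11; colsum hc c1 c2 => k12; colsum hc c2 c2 => k22.
have d0 := con_diag hc (_ : (0 + (N - 1)).+1 = N)%N; rewrite R0 Rn1 in d0.
have {}d0 := d0 ltac:(lia).
have := con_diag hc (_ : (1 + (N - 2)).+1 = N)%N; rewrite R1 Rn2 => /(_ ltac:(lia)) d1.
have := con_diag hc (_ : (2 + (N - 3)).+1 = N)%N; rewrite R2 Rz; last lia.
move=> /(_ ltac:(lia)) d2.
have e1 : c (N - 2)%N c2 = 0.
  apply: double_eq0 => //; rewrite k00 in d0; rewrite d2 add0r in k22; rewrite d1 in k11.
  transitivity (c (N - 2)%N c2 + c (N - 1)%N c1 + (c (N - 2)%N c2 + c (N - 1)%N c2) - (c (N - 1)%N c1 + c (N - 1)%N c2)).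
    by ring.
  by rewrite k11 k22 -d0 !addr0 subr0.
have e2 := d1; rewrite e1 in e2.
have e3 := addr0_eq0 k11 e2.
have e4 : c (N - 1)%N c2 = 0 by rewrite d2 e1 !add0r in k22.
have e5 : c 1%N c2 = 0 by rewrite e4 addr0 in k12.
have z0 p : (0 < p < N - 1)%N -> pairing (slice1 N) c p (N - 1) = 0.
  move=> hp; have [->|p1] := eqVneq p 1%N; first by rewrite R1.
  have [->|p2] := eqVneq p 2%N; first by rewrite R2.
  have [->|p3] := eqVneq p (N - 2)%N; first by rewrite Rn2.
  by rewrite Rz //; lia.
have f0 p : (p < N)%N -> c p c0 = 0.
  move=> hp; have [->|p0] := eqVneq p 0%N; first by [].
  rewrite -R0; have [->|p1] := eqVneq p (N - 1)%N; first by apply: (con_long hc); lia.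
  by apply: (con_short hc (_ : (0 + (N - 1)).+1 = N)%N (_ : (p + (N - 1 - p)).+1 = N)%N); try lia;
    rewrite z0 //; lia.
have f1 p : (p < N)%N -> c p c1 = 0.
  move=> hp; have [->|p0] := eqVneq p 0%N; first by [].
  have [->|p1] := eqVneq p 1%N; first by [].
  have [->|p2] := eqVneq p (N - 1)%N; first by [].
  rewrite -R1; have [->|p3] := eqVneq p (N - 2)%N; first by apply: (con_long hc); lia.
  apply: (con_short hc (_ : (1 + (N - 2)).+1 = N)%N (_ : (p + (N - 1 - p)).+1 = N)%N); try lia.
  have [->|p4] := eqVneq (N - 1 - p)%N 2%N; first by rewrite R2.
  by rewrite Rz //; lia.
have f2 p : (p < N)%N -> c p c2 = 0.
  move=> hp; have [->|p0] := eqVneq p 0%N; first by [].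
  have [->|p1] := eqVneq p 1%N; first by [].
  have [->|p2] := eqVneq p 2%N; first by [].
  have [->|p3] := eqVneq p (N - 2)%N; first by [].
  have [->|p4] := eqVneq p (N - 1)%N; first by [].
  rewrite -R2; have [->|p5] := eqVneq p (N - 3)%N; first by apply: (con_long hc); lia.
  apply: (con_short hc (_ : (2 + (N - 3)).+1 = N)%N (_ : (p + (N - 1 - p)).+1 = N)%N); try lia.
  by rewrite Rz //; lia.
by move=> p; apply: ord3P => hp; auto.
Qed.
End Slice1.

Section Slice2.
Variables (F : fieldType) (N : nat) (c : nat -> 'I_3 -> F).
Hypothesis two0 : (2%:R : F) != 0.

Lemma slice2_open : (6 <= N)%N -> conormal N (slice2 N) c -> forall p j, (p < N)%N -> c p j = 0.
Proof.
move=> N6 hc.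
have R0 q : pairing (slice2 N) c 0 q = c q c0 + c q c1 by row.
have R1 q : pairing (slice2 N) c 1 q = c q c0 by row.
have R2 q : pairing (slice2 N) c 2 q = c q c2 by row.
have Rn2 q : pairing (slice2 N) c (N - 2) q = c q c1 + c q c2 by row.
have Rn1 q : pairing (slice2 N) c (N - 1) q = 0 by row.
have Rz p q : (2 < p < N - 2)%N -> pairing (slice2 N) c p q = 0 by row.
colsum hc c0 c0 => k00; colsum hc c0 c1 => k01; colsum hc c0 c2 => k02.
colsum hc c1 c1 => k11; colsum hc c1 c2 => k12; colsum hc c2 c2 => k22.
have := con_diag hc (_ : (0 + (N - 1)).+1 = N)%N; rewrite R0 Rn1 => /(_ ltac:(lia)) d0.
have := con_diag hc (_ : (1 + (N - 2)).+1 = N)%N; rewrite R1 Rn2 => /(_ ltac:(lia)) d1.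
have := con_diag hc (_ : (2 + (N - 3)).+1 = N)%N; rewrite R2 Rz; last lia.
move=> /(_ ltac:(lia)) d2.
have e1 := addr0_eq0 k22 d2.
have e2 : c 0%N c2 = 0 by rewrite e1 addr0 in k12.
have e3 := addr0_eq0 k02 e2.
rewrite e1 addr0 in d1.
have e4 : c 0%N c0 = 0.
  apply: (double_eq0 two0); rewrite d1 in k00.
  transitivity (c 0%N c0 + c (N - 2)%N c1 + (c 0%N c0 + c 0%N c1) - (c 0%N c1 + c (N - 2)%N c1)).
    by ring.
  by rewrite k00 d0 k11 addr0 subr0.
have e5 := addr0_eq0 k00 e4; have e6 := addr0_eq0 d0 e4.
have e7 := addr0_eq0 k01 e6; have e8 := addr0_eq0 k11 e6.
have e9 : c (N - 2)%N c0 = 0 by rewrite -R1; apply: (con_long hc); lia.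
have e10 : c (N - 1)%N c0 = 0.
  rewrite -R1; apply: (con_short hc (_ : (1 + (N - 2)).+1 = N)%N (_ : ((N - 1) + 0).+1 = N)%N); try lia.
  by rewrite R0 e9 e8 addr0.
have e11 : c (N - 1)%N c1 = 0.
  by apply: addr0_eq0 e10; rewrite -R0; apply: (con_long hc); lia.
have e12 : c (N - 1)%N c2 = 0.
  apply: addr0_eq0 e11; rewrite -Rn2.
  apply: (con_short hc (_ : ((N - 2) + 1).+1 = N)%N (_ : ((N - 1) + 0).+1 = N)%N); try lia.
  by rewrite R0 e5 e7 addr0.
have zn1 p : pairing (slice2 N) c p (N - 1) = 0.
  by rewrite /pairing e10 e11 e12 !mul0rn !addr0.
have f0 p : (p < N)%N -> c p c0 = 0.
  move=> hp; have [->|p0] := eqVneq p 0%N; first by [].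
  have [->|p1] := eqVneq p 1%N; first by [].
  have [->|p2] := eqVneq p (N - 2)%N; first by [].
  have [->|p3] := eqVneq p (N - 1)%N; first by [].
  rewrite -R1; apply: (con_short hc (_ : (1 + (N - 2)).+1 = N)%N (_ : (p + (N - 1 - p)).+1 = N)%N); try lia.
  have [->|p4] := eqVneq (N - 1 - p)%N 2%N; first by rewrite R2.
  by rewrite Rz //; lia.
have f1 p : (p < N)%N -> c p c1 = 0.
  move=> hp; have [->|p0] := eqVneq p 0%N; first by [].
  have [->|p1] := eqVneq p (N - 1)%N; first by [].
  apply: addr0_eq0 (f0 p hp); rewrite -R0.
  by apply: (con_short hc (_ : (0 + (N - 1)).+1 = N)%N (_ : (p + (N - 1 - p)).+1 = N)%N); try lia.
have f2 p : (p < N)%N -> c p c2 = 0.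
  move=> hp; have [->|p0] := eqVneq p 0%N; first by [].
  have [->|p1] := eqVneq p 1%N; first by [].
  have [->|p2] := eqVneq p 2%N; first by [].
  have [->|p3] := eqVneq p (N - 2)%N; first by [].
  have [->|p4] := eqVneq p (N - 1)%N; first by [].
  rewrite -R2; have [->|p5] := eqVneq p (N - 3)%N; first by apply: (con_long hc); lia.
  apply: (con_short hc (_ : (2 + (N - 3)).+1 = N)%N (_ : (p + (N - 1 - p)).+1 = N)%N); try lia.
  by rewrite Rz //; lia.
by move=> p; apply: ord3P => hp; auto.
Qed.
End Slice2.

Section Slice3.
Variables (F : fieldType) (N : nat) (c : nat -> 'I_3 -> F).
Hypothesis two0 : (2%:R : F) != 0.

Lemma slice3_open : (6 <= N)%N -> conormal N (slice3 N) c -> forall p j, (p < N)%N -> c p j = 0.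
Proof.
move=> N6 hc.
have R0 q : pairing (slice3 N) c 0 q = c q c0 by row.
have R1 q : pairing (slice3 N) c 1 q = c q c1 + c q c2 by row.
have R2 q : pairing (slice3 N) c 2 q = c q c1 by row.
have Rn3 q : pairing (slice3 N) c (N - 3) q = c q c2 by row.
have Rn2 q : pairing (slice3 N) c (N - 2) q = 0 by row.
have Rn1 q : pairing (slice3 N) c (N - 1) q = c q c1 by row.
have Rz p q : (2 < p < N - 3)%N -> pairing (slice3 N) c p q = 0 by row.
colsum hc c0 c0 => k00; colsum hc c0 c1 => k01; colsum hc c0 c2 => k02.
colsum hc c1 c1 => k11; colsum hc c1 c2 => k12; colsum hc c2 c2 => k22.
have := con_diag hc (_ : (0 + (N - 1)).+1 = N)%N; rewrite R0 Rn1 => /(_ ltac:(lia)) d0.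
have := con_diag hc (_ : (1 + (N - 2)).+1 = N)%N; rewrite R1 Rn2 => /(_ ltac:(lia)) d1.
have := con_diag hc (_ : (2 + (N - 3)).+1 = N)%N; rewrite R2 Rn3 => /(_ ltac:(lia)) d2.
rewrite k00 in d0; rewrite -d0 addr0 d2 in k11.
have e1 : c 1%N c1 = 0.
  apply: (double_eq0 two0).
  transitivity (c 1%N c1 + c 1%N c2 + (c 1%N c1 + c (N - 3)%N c2) - (c 1%N c2 + c (N - 3)%N c2)).
    by ring.
  by rewrite d1 k11 k22 addr0 subr0.
have e2 := addr0_eq0 d1 e1; have e3 := addr0_eq0 k11 e1; rewrite e3 in d2.
have e4 : c (N - 3)%N c1 = 0 by rewrite -R2; apply: (con_long hc); lia.
have e5 : c (N - 2)%N c1 = 0.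
  rewrite -R2; apply: (con_short hc (_ : (2 + (N - 3)).+1 = N)%N (_ : ((N - 2) + 1).+1 = N)%N); try lia.
  by rewrite R1 e3 e4 addr0.
have e6 : c (N - 2)%N c2 = 0.
  by apply: addr0_eq0 e5; rewrite -R1; apply: (con_long hc); lia.
have e7 : c 2%N c2 = 0.
  apply: addr0_eq0 d2; rewrite -R1.
  by apply: (con_short hc (_ : (1 + (N - 2)).+1 = N)%N (_ : (2 + (N - 3)).+1 = N)%N); try lia; rewrite Rn3.
have e8 : c (N - 1)%N c2 = 0 by rewrite e2 e7 !add0r in k12.
have e9 : c (N - 1)%N c0 = 0 by rewrite -R0; apply: (con_long hc); lia.
have zn1 p : pairing (slice3 N) c p (N - 1) = 0.
  by rewrite /pairing e8 e9 -d0 !mul0rn !addr0.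
have f0 p : (p < N)%N -> c p c0 = 0.
  move=> hp; have [->|p0] := eqVneq p 0%N; first by [].
  have [->|p3] := eqVneq p (N - 1)%N; first by [].
  by rewrite -R0; apply: (con_short hc (_ : (0 + (N - 1)).+1 = N)%N (_ : (p + (N - 1 - p)).+1 = N)%N); try lia.
have zn2 p : pairing (slice3 N) c p (N - 2) = 0.
  by rewrite /pairing e5 e6 f0 ?mul0rn ?addr0 //; lia.
have f1 p : (p < N)%N -> c p c1 = 0.
  move=> hp; have [->|p0] := eqVneq p 0%N; first by [].
  have [->|p1] := eqVneq p 1%N; first by [].
  have [->|p2] := eqVneq p 2%N; first by [].
  have [->|p3] := eqVneq p (N - 3)%N; first by [].
  have [->|p4] := eqVneq p (N - 2)%N; first by [].
  have [->|p5] := eqVneq p (N - 1)%N; first by [].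
  rewrite -R2; apply: (con_short hc (_ : (2 + (N - 3)).+1 = N)%N (_ : (p + (N - 1 - p)).+1 = N)%N); try lia.
  by rewrite Rz //; lia.
have f2 p : (p < N)%N -> c p c2 = 0.
  move=> hp; have [->|p0] := eqVneq p 0%N; first by [].
  have [->|p1] := eqVneq p 1%N; first by [].
  have [->|p2] := eqVneq p (N - 2)%N; first by [].
  have [->|p3] := eqVneq p (N - 1)%N; first by [].
  apply: addr0_eq0 (f1 p hp); rewrite -R1.
  by apply: (con_short hc (_ : (1 + (N - 2)).+1 = N)%N (_ : (p + (N - 1 - p)).+1 = N)%N); try lia.
by move=> p; apply: ord3P => hp; auto.
Qed.
End Slice3.

(** * The same three points for [n = 2], where some of their rows coincide *)

Section SlicesN4.
Variables (F : fieldType) (c : nat -> 'I_3 -> F).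
Hypothesis two0 : (2%:R : F) != 0.
Let db := double_eq0 two0.

Lemma ltn4P (Q : nat -> Prop) : Q 0%N -> Q 1%N -> Q 2%N -> Q 3%N -> forall p, (p < 4)%N -> Q p.
Proof. by move=> q0 q1 q2 q3 [|[|[|[|]]]]. Qed.

(** Rows 2 and N-2 are now the same, so the third column has an entry 2; for [slice3] this happens
    to rows 1 and N-3. Hence the additional halvings. *)
Lemma slice1_open4 : conormal 4 (slice1 4) c -> forall p j, (p < 4)%N -> c p j = 0.
Proof.
move=> hc.
have R0 q : pairing (slice1 4) c 0 q = c q c0 by row.
have R1 q : pairing (slice1 4) c 1 q = c q c1 by row.
have R2 q : pairing (slice1 4) c 2 q = c q c2 + c q c2 by row.
have R3 q : pairing (slice1 4) c 3 q = c q c1 + c q c2 by row.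
have k00 : c 0%N c0 = 0 by colsum hc c0 c0.
have k01 : c 0%N c1 = 0 by colsum hc c0 c1.
have k02 : c 0%N c2 = 0 by colsum hc c0 c2.
have k11 : c 1%N c1 + c 3%N c1 = 0 by colsum hc c1 c1.
have k12 : c 1%N c2 + c 3%N c2 = 0 by colsum hc c1 c2.
have k22 : c 2%N c2 + c 2%N c2 + c 3%N c2 = 0 by colsum hc c2 c2.
have := con_diag hc (erefl : (0 + 3).+1 = 4)%N; rewrite R0 R3 k00 => d0.
have := con_diag hc (erefl : (1 + 2).+1 = 4)%N; rewrite R1 R2 => d1.
have e1 : c 1%N c1 = 0.
  apply: db; rewrite -d1 in k22.
  transitivity (c 1%N c1 + c 3%N c1 + (c 1%N c1 + c 3%N c2) - (c 3%N c1 + c 3%N c2)); first by ring.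
  by rewrite k11 k22 -d0 addr0 subr0.
have e2 := addr0_eq0 k11 e1; rewrite -d1 e1 add0r in k22; have e3 := k22.
rewrite e3 addr0 in k12; have e4 : c 2%N c2 = 0 by apply: db; rewrite -d1.
have e5 : c 1%N c0 = 0.
  by rewrite -R0; apply: (con_short hc (p' := 3) (q' := 2)) => //; rewrite R2 e3 addr0.
have e6 : c 2%N c0 = 0.
  by rewrite -R0; apply: (con_short hc (p' := 3) (q' := 1)) => //; rewrite R1.
have e7 : c 3%N c0 = 0 by rewrite -R0; apply: (con_long hc).
have e8 : c 2%N c1 = 0 by rewrite -R1; apply: (con_long hc).
by move=> p j; move: p; apply: ltn4P; move: j; apply: ord3P.
Qed.

Lemma slice2_open4 : conormal 4 (slice2 4) c -> forall p j, (p < 4)%N -> c p j = 0.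
Proof.
move=> hc.
have R0 q : pairing (slice2 4) c 0 q = c q c0 + c q c1 by row.
have R1 q : pairing (slice2 4) c 1 q = c q c0 by row.
have R2 q : pairing (slice2 4) c 2 q = c q c1 + (c q c2 + c q c2) by row.
have R3 q : pairing (slice2 4) c 3 q = 0 by row.
have k00 : c 0%N c0 + c 1%N c0 = 0 by colsum hc c0 c0.
have k01 : c 0%N c1 + c 1%N c1 = 0 by colsum hc c0 c1.
have k02 : c 0%N c2 + c 1%N c2 = 0 by colsum hc c0 c2.
have k11 : c 0%N c1 + c 2%N c1 = 0 by colsum hc c1 c1.
have k12 : c 0%N c2 + c 2%N c2 = 0 by colsum hc c1 c2.
have k22 : c 2%N c2 + c 2%N c2 = 0 by colsum hc c2 c2.
have := con_diag hc (erefl : (0 + 3).+1 = 4)%N; rewrite R0 R3 => d0.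
have := con_diag hc (erefl : (1 + 2).+1 = 4)%N; rewrite R1 R2 k22 addr0 => d1.
have e1 := db k22; have e2 : c 0%N c2 = 0 by rewrite e1 addr0 in k12.
have e3 := addr0_eq0 k02 e2.
have e4 : c 0%N c0 = 0.
  apply: db; rewrite d1 in k00.
  transitivity (c 0%N c0 + c 2%N c1 + (c 0%N c0 + c 0%N c1) - (c 0%N c1 + c 2%N c1)); first by ring.
  by rewrite k00 d0 k11 addr0 subr0.
have e5 := addr0_eq0 k00 e4; have e6 := addr0_eq0 d0 e4.
have e7 := addr0_eq0 k01 e6; have e8 := addr0_eq0 k11 e6.
have e9 : c 2%N c0 = 0 by rewrite -R1; apply: (con_long hc).
have e10 : c 3%N c0 = 0.
  by rewrite -R1; apply: (con_short hc (p' := 2) (q' := 0)) => //; rewrite R0 e9 e8 addr0.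
have e11 : c 3%N c1 = 0 by apply: addr0_eq0 e10; rewrite -R0; apply: (con_long hc).
have e12 : c 3%N c2 = 0.
  apply: db; apply: addr0_eq0 e11; rewrite -R2.
  by apply: (con_short hc (p' := 1) (q' := 0)) => //; rewrite R0 e5 e7 addr0.
by move=> p j; move: p; apply: ltn4P; move: j; apply: ord3P.
Qed.

Lemma slice3_open4 : conormal 4 (slice3 4) c -> forall p j, (p < 4)%N -> c p j = 0.
Proof.
move=> hc.
have R0 q : pairing (slice3 4) c 0 q = c q c0 by row.
have R1 q : pairing (slice3 4) c 1 q = c q c1 + (c q c2 + c q c2) by row.
have R2 q : pairing (slice3 4) c 2 q = c q c1 by row.
have R3 q : pairing (slice3 4) c 3 q = c q c1 by row.
have k00 : c 0%N c0 = 0 by colsum hc c0 c0.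
have k01 : c 0%N c1 = 0 by colsum hc c0 c1.
have k02 : c 0%N c2 = 0 by colsum hc c0 c2.
have k11 : c 1%N c1 + c 2%N c1 + c 3%N c1 = 0 by colsum hc c1 c1.
have k12 : c 1%N c2 + c 2%N c2 + c 3%N c2 = 0 by colsum hc c1 c2.
have k22 : c 1%N c2 + c 1%N c2 = 0 by colsum hc c2 c2.
have := con_diag hc (erefl : (0 + 3).+1 = 4)%N; rewrite R0 R3 k00 => d0.
have := con_diag hc (erefl : (1 + 2).+1 = 4)%N; rewrite R1 R2 k22 addr0 => d1.
have e1 := db k22; rewrite -d0 addr0 -d1 in k11; have e2 := db k11; rewrite e2 in d1.
have e3 : c 2%N c2 = 0.
  by apply: db; apply: addr0_eq0 (esym d1); rewrite -R1; apply: (con_long hc).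
have e4 : c 3%N c2 = 0 by rewrite e1 e3 !add0r in k12.
have e5 : c 3%N c0 = 0 by rewrite -R0; apply: (con_long hc).
have e6 : c 1%N c0 = 0.
  by rewrite -R0; apply: (con_short hc (p' := 3) (q' := 2)) => //; rewrite R2.
have e7 : c 2%N c0 = 0.
  by rewrite -R0; apply: (con_short hc (p' := 3) (q' := 1)) => //; rewrite R1 -d0 e4 !addr0.
by move=> p j; move: p; apply: ltn4P; move: j; apply: ord3P.
Qed.
End SlicesN4.

(** * Open orbits *)

Section OpenOrbits.
Variables (F : fieldType) (N : nat).
Hypothesis hF : [pchar F] =i pred0.
Local Notation P := {mpoly F[N * 3]}.

(** To the row operations of [T] the upper triangular column operations are added, for which a
    vector of the model is an eigenvector by definition. The matrix [C] is a covector at [A],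
    annihilating all these tangent directions. *)
Lemma colhw_open_eq0 (T : 'M[F]_N -> Prop) lam (f : P) (A : 'M[F]_(N, 3)) : colhw lam f ->
  (forall X, T X -> exists x, row_act X f = x *: f) ->
  (forall C : 'M[F]_(N, 3),
    (forall X, T X -> \sum_p \sum_j (X^T *m A) p j * C p j = 0) ->
    (forall i j : 'I_3, (i <= j)%N -> \sum_p A p i * C p j = 0) -> C = 0) ->
  f.@[mxvec A 0] = 0 -> f = 0.
Proof.
move=> [fU fD] fT hC fA.
pose T' (M : 'M[F]_(N * 3)) := (exists2 X, T X & M = rowmx X) \/
  (exists i j : 'I_3, (i <= j)%N /\ M = colmx N (delta_mx i j)).
apply: (@open_orbit_eq0 _ _ hF T' f (mxvec A)) => // [M [[X TX ->]|[i [j [ij ->]]]]|c hc].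
- exact: fT.
- move: ij; rewrite leq_eqVlt => /orP[/eqP/val_inj <-|ij]; first by eexists; exact: fD.
  by exists 0; rewrite scale0r; exact: fU.
have dot (Y : 'M[F]_(N, 3)) : (mxvec Y *m c) 0 0 = \sum_p \sum_j Y p j * vec_mx c^T p j.
  rewrite mxE sum_mxvec; apply: eq_bigr => p _; apply: eq_bigr => j _.
  by rewrite mxvecE !mxE.
have C0 : vec_mx c^T = 0 :> 'M_(N, 3).
  apply: hC => [X TX|i j ij].
    by rewrite -dot -mxvec_rowmx; apply: hc; left; exists X.
  have := hc (colmx N (delta_mx i j)); rewrite mxvec_colmx dot.
  move=> h; rewrite -[RHS]h; last by right; exists i, j.
  have md p k : (A *m delta_mx i j) p k = if k == j then A p i else 0.
    rewrite mxE (bigD1 i) //= big1 => [|l li]; last by rewrite mxE (negPf li) mulr0.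
    by rewrite mxE eqxx addr0; case: eqP; rewrite ?mulr1 ?mulr0.
  apply: eq_bigr => p _; rewrite (bigD1 j) //= big1 => [|k kj]; first by rewrite addr0 md eqxx.
  by rewrite md (negPf kj) mul0r.
by apply/trmx_inj/(can_inj vec_mxK); rewrite C0 trmx0 linear0.
Qed.

End OpenOrbits.

(** * The two Lie algebras, and root vectors of the symplectic one *)

Section SplitForms.
Variables (F : fieldType) (n : nat).
Local Notation N := (n.*2).
Implicit Types X Y : 'M[F]_N.

(** This is [E_pq + sigma(E_pq)]: a coroot direction for [p = q], and twice the long root vector for
    [q = rev_ord p], where the two terms agree. *)
Definition gsym (p q : 'I_N) : 'M[F]_N :=
  delta_mx p q - (-1) ^+ (p + q) *: delta_mx (rev_ord q) (rev_ord p).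

Lemma gsym_utri (p q : 'I_N) : (p <= q)%N -> utri (gsym p q).
Proof.
move=> pq r s sr; rewrite !mxE -!val_eqE /=.
have h1 : (r == p :> nat) && (s == q :> nat) = false by lia.
have h2 : (r == n.*2 - q.+1 :> nat)%N && (s == n.*2 - p.+1 :> nat)%N = false.
  by have := ltn_ord p; have := ltn_ord q; lia.
by rewrite h1 h2 mulr0 subr0.
Qed.

Lemma gsym_supper (p q : 'I_N) : (p < q)%N -> supper (gsym p q).
Proof.
move=> pq r s sr; rewrite !mxE -!val_eqE /=.
have h1 : (r == p :> nat) && (s == q :> nat) = false by lia.
have h2 : (r == n.*2 - q.+1 :> nat)%N && (s == n.*2 - p.+1 :> nat)%N = false.
  by have := ltn_ord p; have := ltn_ord q; lia.
by rewrite h1 h2 mulr0 subr0.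
Qed.

Lemma gsym_diag p : is_diag_mx (gsym p p).
Proof.
apply/is_diag_mxP => r s rs; rewrite !mxE.
have h (u : 'I_N) : (r == u) && (s == u) = false.
  by apply/negP => /andP[/eqP e /eqP e']; rewrite e e' eqxx in rs.
by rewrite !h mulr0 subr0.
Qed.
Hypothesis two0 : (2%:R : F) != 0.

Definition sigma_fixed X :=
  forall r c, X r c = - (-1) ^+ (r + c) * X (rev_ord c) (rev_ord r).

Lemma in_gsigP X : reflect (sigma_fixed X) (in_gsig X).
Proof.
apply: (iffP andP) => [[_ /eqP/matrixP sX] r c|sX]; first by rewrite -[LHS](sX r c) mxE.
split; last by apply/eqP/matrixP => r c; rewrite mxE [RHS]sX.
rewrite /in_sl; apply/eqP/(double_eq0 two0).
rewrite {2}/mxtrace (reindex_inj rev_ord_inj) -big_split big1 //= => r _.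
by rewrite sX addnn -signr_odd odd_double expr0 mulN1r addNr.
Qed.

Lemma sl_split : split_subalg (@in_sl F n).
Proof.
split; rewrite /in_sl.
- by move=> c X Y /eqP hX /eqP hY; rewrite linearP /= hX hY mulr0 addr0.
- by move=> X; rewrite mxtrace_tr.
- by move=> X Y _ _; rewrite linearB /= mxtrace_mulC subrr.
- by move=> X _; rewrite /mxtrace big1 // => i _; rewrite mxE ltnn.
- move=> X /eqP <-; apply/eqP; apply: eq_bigr => i _; by rewrite mxE eqxx.
Qed.

Lemma gsig_split : split_subalg (@in_gsig F n).
Proof.
split.
- move=> c X Y /in_gsigP hX /in_gsigP hY; apply/in_gsigP => r s.
  by rewrite !mxE hX hY; ring.
- by move=> X /in_gsigP hX; apply/in_gsigP => r s; rewrite !mxE hX addnC.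
- have mul X Y : sigma_fixed X -> sigma_fixed Y ->
      forall r s, (X *m Y) r s = (-1) ^+ (r + s) * (Y *m X) (rev_ord s) (rev_ord r).
    move=> hX hY r s; rewrite !mxE mulr_sumr (reindex_inj rev_ord_inj); apply: eq_bigr => k _.
    rewrite hX [Y _ s]hY rev_ordK !exprD sign_rev.
    set t := (-1) ^+ k; have tt : t * t = 1 by rewrite -expr2 sqrr_sign.
    rewrite -[RHS]mul1r -tt; ring.
  move=> X Y /in_gsigP hX /in_gsigP hY; apply/in_gsigP => r s.
  have sub (A B : 'M[F]_N) i j : (A - B) i j = A i j - B i j by rewrite !mxE.
  by rewrite !sub (mul X Y hX hY r s) (mul Y X hY hX r s); ring.
- move=> X /in_gsigP hX; apply/in_gsigP => r s; rewrite !mxE /= hX.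
  have -> : (n.*2 - s.+1 < n.*2 - r.+1)%N = (r < s)%N.
    by have := ltn_ord r; have := ltn_ord s; lia.
  by case: ifP; rewrite ?mulr0.
- move=> X /in_gsigP hX; apply/in_gsigP => r s; rewrite !mxE hX.
  rewrite (inj_eq rev_ord_inj) [s == r]eq_sym.
  by case: ifP; rewrite ?mulr0.
Qed.

Lemma gsym_gsig p q : in_gsig (gsym p q).
Proof.
apply/in_gsigP => r s; rewrite /gsym !mxE.
have rev_eq (u v : 'I_N) : (rev_ord u == v) = (u == rev_ord v).
  by rewrite (can2_eq (@rev_ordK _) (@rev_ordK _)).
rewrite (rev_eq s p) (rev_eq r q) !(inj_eq rev_ord_inj).
rewrite [(s == rev_ord p) && _]andbC [(s == q) && _]andbC.
have sgn (u v : 'I_N) : (-1) ^+ (rev_ord u + rev_ord v) = (-1) ^+ (v + u) :> F.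
  by rewrite !exprD !sign_rev mulrNN mulrC.
have sgn2 (u v : 'I_N) : (-1) ^+ (u + v) * (-1) ^+ (u + v) = 1 :> F.
  by rewrite -expr2 sqrr_sign.
have [/andP[/eqP -> /eqP ->]|_] := boolP ((r == p) && (s == q)); rewrite /=.
  case: (_ && _) => /=; last by rewrite !mulr0 mulr1 sub0r mulrNN sgn2 subr0.
  by rewrite !mulr1 mulrBr mulr1 !mulNr opprK sgn2 addrC.
have [/andP[/eqP -> /eqP ->]|_] := boolP ((r == rev_ord q) && (s == rev_ord p)); rewrite /=.
  by rewrite sgn; ring.
by rewrite !mulr0 subr0 mulr0.
Qed.

End SplitForms.

(** * From tangent directions to conormal equations *)

Section Pairing.
Variables (F : fieldType) (n : nat).
Local Notation N := (n.*2).
Hypothesis two0 : (2%:R : F) != 0.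
Variables (A C : 'M[F]_(N, 3)).

Definition tangent_dot (X : 'M[F]_N) : F := \sum_p \sum_j (X^T *m A) p j * C p j.

Lemma tangent_dotP c X Y : tangent_dot (c *: X + Y) = c * tangent_dot X + tangent_dot Y.
Proof.
rewrite /tangent_dot mulr_sumr -big_split; apply: eq_bigr => p _ /=.
rewrite mulr_sumr -big_split; apply: eq_bigr => j _ /=.
by rewrite linearP /= mulmxDl -scalemxAl !mxE; ring.
Qed.

Lemma tangent_dot_delta p q : tangent_dot (delta_mx p q) = \sum_j A p j * C q j.
Proof.
have dA r j : ((delta_mx p q)^T *m A) r j = if r == q then A p j else 0.
  rewrite mxE (bigD1 p) //= big1 => [|l li]; last by rewrite !mxE (negPf li) mul0r.
  by rewrite !mxE eqxx addr0 /=; case: eqP; rewrite ?mul1r ?mul0r.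
rewrite /tangent_dot (bigD1 q) //= [X in _ + X]big1 ?addr0 => [|r rq].
  by apply: eq_bigr => j _; rewrite dA eqxx.
by apply: big1 => j _; rewrite dA (negPf rq) mul0r.
Qed.

Lemma tangent_dot_gsym p q : tangent_dot (gsym F p q) =
  \sum_j A p j * C q j - (-1) ^+ (p + q) * \sum_j A (rev_ord q) j * C (rev_ord p) j.
Proof. by rewrite /gsym addrC -scaleNr tangent_dotP !tangent_dot_delta mulNr addrC. Qed.

Variable a : nat -> 'I_3 -> nat.
Hypothesis Aa : forall p j, A p j = (a p j)%:R.
Let c (r : nat) (j : 'I_3) : F := if insub r is Some i then C i j else 0.

(** Orthogonality to [gsym p q] says that the pairing of rows [p], [q] is a sign times the pairing
    of the opposite rows in reversed order. For [p = q] the sign is 1; for opposite rows it is -1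
    and the pairing equals its own negative. *)
Lemma conormal_of_tangent :
  (forall p q : 'I_N, (p <= q)%N -> tangent_dot (gsym F p q) = 0) ->
  (forall i j : 'I_3, (i <= j)%N -> \sum_p A p i * C p j = 0) -> conormal N a c.
Proof.
move=> hX hB; have cE (i : 'I_N) j : c i j = C i j by rewrite /c valK.
have pE (p q : 'I_N) : pairing a c p q = \sum_j A p j * C q j.
  by rewrite sum3 /pairing !cE !Aa !mulr_natl.
have hE (p q p' q' : nat) : (p + p').+1 = N -> (q + q').+1 = N -> (p <= q)%N ->
    pairing a c p q = (-1) ^+ (p + q) * pairing a c q' p'.
  move=> hp hq pq.
  have lp : (p < N)%N by lia.
  have lq : (q < N)%N by lia.
  pose p1 := Ordinal lp; pose q1 := Ordinal lq.
  have rp : p' = rev_ord p1 by rewrite /=; lia.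
  have rq : q' = rev_ord q1 by rewrite /=; lia.
  have := hX p1 q1 pq; rewrite tangent_dot_gsym -!pE -rp -rq => /eqP.
  by rewrite subr_eq0 => /eqP.
split.
- move=> p p' h; rewrite (hE p p p' p') //.
  by rewrite addnn -signr_odd odd_double expr0 mul1r.
- move=> p p' h pp; have := hE p p' p' p h; rewrite addnC => /(_ h pp) e.
  apply: (double_eq0 two0); rewrite {1}e addnC -signr_odd.
  have -> : odd (p' + p) = true by move: h; rewrite addnC; lia.
  by rewrite expr1 mulN1r addNr.
- by move=> p q p' q' hp hq pq e; rewrite (hE p q p' q') // e mulr0.
- move=> i j ij; apply: etrans (hB i j ij); apply: eq_bigr => p _.
  by rewrite cE Aa mulr_natl.
Qed.

Lemma conormal_eq0 : (forall p j, (p < N)%N -> c p j = 0) -> C = 0.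
Proof. by move=> h; apply/matrixP => p j; rewrite mxE; apply: etrans (h p j (ltn_ord p)); rewrite /c valK. Qed.
End Pairing.

(** * Exponents of highest weight vectors *)

Section Classification.
Variables (F : fieldType) (n : nat).
Local Notation N := (n.*2).
Local Notation P := {mpoly F[N * 3]}.
Hypothesis hF : [pchar F] =i pred0.
Hypothesis n2 : (2 <= n)%N.

Lemma two_neq0 : (2%:R : F) != 0.
Proof. by rewrite (natrF_eq0 hF). Qed.

Definition base_point : 'M[F]_(N, 3) := \matrix_(p, j) (p == j :> nat)%:R.

(* the orbit of the base point under the upper triangular groups is open *)
Lemma sl_highest_eq0 lam (f : P) : colhw lam f ->
  (forall X, in_sl X -> supper X -> row_act X f = 0) -> f.@[mxvec base_point 0] = 0 -> f = 0.
Proof.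
move=> fR fU; apply: (colhw_open_eq0 hF (T := fun X => in_sl X /\ supper X)) fR _ _.
  by move=> X [sX uX]; exists 0; rewrite scale0r; exact: fU.
move=> C hX hB; apply/matrixP => q j; rewrite [RHS]mxE.
have j3 : (j < N)%N by have := ltn_ord j; lia.
pose p := Ordinal j3.
have sum_base (h : 'I_3 -> F) : \sum_i base_point p i * h i = h j.
  rewrite (bigD1 j) //= big1 => [|i ij]; first by rewrite mxE eqxx mul1r addr0.
  by rewrite mxE (_ : (p == i :> nat) = false) ?mul0r //= [_ == _]eq_sym; apply/negbTE.
have [pq|qp] := ltnP j q.
  have := hX (delta_mx p q); rewrite -/(tangent_dot base_point C (delta_mx p q)) tangent_dot_delta.
  rewrite sum_base; apply; split; last first.
    by move=> r s sr; rewrite mxE -!val_eqE /=; case: eqP => // e; case: eqP => // e'; lia.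
  rewrite /in_sl /mxtrace big1 // => i _; rewrite mxE.
  by case: eqP => // ->; rewrite -val_eqE /= (ltn_eqF pq).
have q3 : (q < 3)%N := leq_ltn_trans qp (ltn_ord j).
rewrite -[RHS](hB (Ordinal q3) j qp) (bigD1 q) //= big1 => [|i ij].
  by rewrite mxE eqxx mul1r addr0.
by rewrite mxE; move: ij; rewrite -val_eqE /= => /negPf ->; rewrite mul0r.
Qed.

Lemma slice_neq0 (a : nat -> nat -> 'I_3 -> nat) lam (f : P) :
  (forall c : nat -> 'I_3 -> F, conormal N (a N) c -> forall p j, (p < N)%N -> c p j = 0) ->
  colhw lam f -> f != 0 ->
  (forall p q : 'I_N, (p <= q)%N -> exists x, row_act (gsym F p q) f = x *: f) ->
  f.@[mxvec (\matrix_(p < N, j < 3) (a N p j)%:R) 0] != 0.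
Proof.
move=> ha fR f0 fX; apply: contraNneq f0 => fA; apply/eqP; move: fA.
apply: (colhw_open_eq0 hF (T := fun X => exists p q : 'I_N, (p <= q)%N /\ X = gsym F p q)) fR _ _.
  by move=> _ [p [q [pq ->]]]; exact: fX.
move=> C hX hB; apply: conormal_eq0; apply: ha.
apply: (conormal_of_tangent two_neq0 _ _ hB) => [p j|p q pq]; first by rewrite mxE.
by apply: hX; exists p, q.
Qed.

Lemma slice_monomial (a : nat -> nat -> 'I_3 -> nat) lam (f : P) :
  (forall c : nat -> 'I_3 -> F, conormal N (a N) c -> forall p j, (p < N)%N -> c p j = 0) ->
  colhw lam f -> f != 0 ->
  (forall p q : 'I_N, (p <= q)%N -> exists x, row_act (gsym F p q) f = x *: f) ->
  exists2 m, m \in msupp f & forall p j, a N (val p) j = 0%N -> m (mxvec_index p j) = 0%N.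
Proof.
move=> ha fR f0 fX; have [m mf hm] := msupp_meval_neq0 (slice_neq0 ha fR f0 fX).
by exists m => // p j apj; apply: hm; rewrite mxvecE mxE apj.
Qed.

Lemma slice1_conormal c : conormal N (slice1 N) c -> forall p j, (p < N)%N -> c p j = 0 :> F.
Proof.
have [n2' | n3] := eqVneq n 2%N; last by apply: slice1_open; rewrite ?two_neq0 //; lia.
by rewrite n2'; apply: slice1_open4; exact: two_neq0.
Qed.
Lemma slice2_conormal c : conormal N (slice2 N) c -> forall p j, (p < N)%N -> c p j = 0 :> F.
Proof.
have [n2' | n3] := eqVneq n 2%N; last by apply: slice2_open; rewrite ?two_neq0 //; lia.
by rewrite n2'; apply: slice2_open4; exact: two_neq0.
Qed.
Lemma slice3_conormal c : conormal N (slice3 N) c -> forall p j, (p < N)%N -> c p j = 0 :> F.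
Proof.
have [n2' | n3] := eqVneq n 2%N; last by apply: slice3_open; rewrite ?two_neq0 //; lia.
by rewrite n2'; apply: slice3_open4; exact: two_neq0.
Qed.

Definition rowdeg (m : 'X_{1..N * 3}) (p : 'I_N) : nat :=
  (m (mxvec_index p c0) + m (mxvec_index p c1) + m (mxvec_index p c2))%N.

Lemma row_act_diag_mcoeff H (f : P) m : is_diag_mx H ->
  (row_act H f)@_m = (\sum_p H p p *+ rowdeg m p) * f@_m.
Proof.
move=> dH; rewrite /row_act mcoeff_vf_diag ?rowmx_diag //; congr (_ * _).
rewrite sum_mxvec; apply: eq_bigr => p _.
by rewrite sum3 !rowmxE !eqxx !mulr1n -!mulrnDr.
Qed.

Lemma row_act_diag_eigen H (f : P) m x : is_diag_mx H -> row_act H f = x *: f -> m \in msupp f ->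
  x = \sum_p H p p *+ rowdeg m p.
Proof.
move=> dH e; rewrite mcoeff_msupp => fm; apply: (mulIf fm).
by rewrite -row_act_diag_mcoeff // e mcoeffZ.
Qed.

Lemma gsym_rowdeg (m : 'X_{1..N * 3}) p :
  \sum_q gsym F p p q q *+ rowdeg m q = (rowdeg m p)%:R - (rowdeg m (rev_ord p))%:R.
Proof.
have pp : rev_ord p != p by rewrite -val_eqE /=; have := ltn_ord p; lia.
have e q : gsym F p p q q = (q == p)%:R - (q == rev_ord p)%:R.
  rewrite !mxE addnn -signr_odd odd_double expr0 mul1r.
  by rewrite !andbb.
rewrite (bigD1 p) //= (bigD1 (rev_ord p)) //= big1 => [|q /andP[q1 q2]].
  by rewrite !e !eqxx (negPf pp) [p == _]eq_sym (negPf pp) subr0 sub0r addr0 mulNrn.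
by rewrite e (negPf q1) (negPf q2) subr0 mul0rn.
Qed.

(** All monomials of [f] have the same weight, but a symplectic weight only sees the difference of
    the degrees in rows [p] and [rev_ord p]. *)
Lemma rowdeg_msupp (f : P) m m' p : m \in msupp f -> m' \in msupp f ->
  (exists x, row_act (gsym F p p) f = x *: f) ->
  (rowdeg m p + rowdeg m' (rev_ord p) = rowdeg m' p + rowdeg m (rev_ord p))%N.
Proof.
move=> fm fm' [x e]; have dG := gsym_diag F p.
have := row_act_diag_eigen dG e fm; have := row_act_diag_eigen dG e fm'.
rewrite !gsym_rowdeg => -> /eqP; rewrite subr_eq addrAC eq_sym subr_eq -!natrD => /eqP.
by move/(natrF_inj hF).
Qed.

Lemma sum_support (V : nmodType) (s : seq 'I_N) (h : 'I_N -> V) : uniq s ->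
  (forall p, p \notin s -> h p = 0) -> \sum_p h p = \sum_(p <- s) h p.
Proof.
move=> us hs; rewrite (bigID (mem s)) /= [X in _ + X]big1 // addr0.
by rewrite big_uniq.
Qed.

Section Exponents.
Variables (r0 r1 r2 : 'I_N).
Hypotheses (v0 : r0 = 0%N :> nat) (v1 : r1 = 1%N :> nat) (v2 : r2 = 2%N :> nat).

Local Ltac colz colv m fm h hn j s := have := colv m fm j s ltac:(by clear -v0 v1 v2 n2 hn; rewrite /= ?inE //; lia)
   ltac:(by move=> p /=; rewrite ?inE => hp; apply: h; move: hp; clear -v0 v1 v2 n2 hn; move=> hp; rewrite /slice1 /slice2 /slice3 /=; lia);
   rewrite ?big_cons big_nil addn0.
Local Ltac kill m h hn := repeat match goal with |- context [fun_of_multinom m (mxvec_index ?p ?j)] =>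
   rewrite (_ : m (mxvec_index p j) = 0%N); [|by apply: h; clear -v0 v1 v2 n2 hn; rewrite /slice1 /slice2 /slice3 /=; lia] end.

(** The witnesses are exponents of the [slice1] monomial. Comparing weights, the exponent at [r0],
    [c0] in the [slice2] monomial is [lam c0 - lam c1 - z], and the one at [r1], [c1] in the
    [slice3] monomial is [lam c1 - lam c2 - k]. As natural numbers they give the two
    inequalities. *)
Lemma gsig_highest_exponents lam (f : P) : colhw lam f -> f != 0 ->
  (forall p q : 'I_N, (p <= q)%N -> exists x, row_act (gsym F p q) f = x *: f) ->
  exists k z x y m, [/\ (x + y + z = lam c2 /\ (n = 2%N -> x = 0%N))%N, (k + lam c2 <= lam c1)%N,
    (z + lam c1 <= lam c0)%N, m \in msupp f &
    forall p, rowdeg m p = (lam c0 * (p == r0) + (lam c1 - k) * (p == r1) + x * (p == r2)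
      + y * (p == rev_ord r1) + (k + z) * (p == rev_ord r0))%N].
Proof.
move=> fR f0 fX.
have [m1 f1 h1] := slice_monomial slice1_conormal fR f0 fX.
have [m2 f2 h2] := slice_monomial slice2_conormal fR f0 fX.
have [m3 f3 h3] := slice_monomial slice3_conormal fR f0 fX.
have rd m m' p (fm : m \in msupp f) (fm' : m' \in msupp f) := rowdeg_msupp fm fm' (fX p p (leqnn p)).
have uq (s : seq 'I_N) : uniq (map val s) -> uniq s by rewrite (map_inj_uniq val_inj).
have colv m (fm : m \in msupp f) j (s : seq 'I_N) : uniq (map val s) ->
    (forall p : 'I_N, val p \notin map val s -> m (mxvec_index p j) = 0%N) ->
    (\sum_(p <- s) m (mxvec_index p j))%N = lam j.
  move=> us hs; rewrite -(colhw_mcoeff hF j fR fm) (@sum_support _ s) //; first exact: uq.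
  by move=> p ps; apply: hs; rewrite (mem_map val_inj).
have [hn|hn] := eqVneq n 2%N.
  have e1 : rev_ord r1 = r2 by apply: val_inj => /=; lia.
  have e2 : rev_ord r2 = r1 by rewrite -e1 rev_ordK.
  have := rd _ _ r0 f1 f2; have := rd _ _ r0 f1 f3.
  have := rd _ _ r1 f1 f2; have := rd _ _ r1 f1 f3.
  rewrite e1 /rowdeg; kill m1 h1 hn; kill m2 h2 hn; kill m3 h3 hn.
  colz colv m1 f1 h1 hn c0 [:: r0]; colz colv m1 f1 h1 hn c1 [:: r1; rev_ord r0].
  colz colv m1 f1 h1 hn c2 [:: r2; rev_ord r0].
  colz colv m2 f2 h2 hn c0 [:: r0; r1]; colz colv m2 f2 h2 hn c1 [:: r0; r2]; colz colv m2 f2 h2 hn c2 [:: r2].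
  colz colv m3 f3 h3 hn c0 [:: r0]; colz colv m3 f3 h3 hn c1 [:: r1; r2; rev_ord r0]; colz colv m3 f3 h3 hn c2 [:: r1].
  move=> ? ? ? ? ? ? K2 K1 K0 *.
  (* Here [rev_ord r1] is [r2]; the exponent in this common row is counted as [y], leaving
     [x = 0]. *)
  exists (m1 (mxvec_index (rev_ord r0) c1)), (m1 (mxvec_index (rev_ord r0) c2)), 0%N,
    (m1 (mxvec_index r2 c2)), m1; split; [split; [lia|by []]|lia|lia|exact: f1|].
  move=> p; clear -K0 K1 K2 h1 hn v0 v1 v2 n2.
  have [->|p0] := eqVneq p r0; first by kill m1 h1 hn; rewrite -?val_eqE /=; eqb; lia.
  have [->|p1] := eqVneq p r1; first by kill m1 h1 hn; rewrite -?val_eqE /=; eqb; lia.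
  have [->|p2] := eqVneq p r2; first by kill m1 h1 hn; rewrite -?val_eqE /=; eqb; lia.
  have [->|p3] := eqVneq p (rev_ord r0); first by kill m1 h1 hn; rewrite -?val_eqE /=; eqb; lia.
  have p4 : p <> 0%N :> nat /\ p <> 1%N :> nat /\ p <> 2%N :> nat /\ p <> 3%N :> nat.
    by move: p0 p1 p2 p3; rewrite -!val_eqE /=; lia.
  have lp := ltn_ord p.
  rewrite !muln0 !(h1 p) //;
    clear -p4 lp hn v0 v1 v2; rewrite /slice1 /=; lia.
have := rd _ _ r0 f1 f2; have := rd _ _ r0 f1 f3.
have := rd _ _ r1 f1 f2; have := rd _ _ r1 f1 f3.
have := rd _ _ r2 f1 f2; have := rd _ _ r2 f1 f3.
rewrite /rowdeg; kill m1 h1 hn; kill m2 h2 hn; kill m3 h3 hn.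
colz colv m1 f1 h1 hn c0 [:: r0]; colz colv m1 f1 h1 hn c1 [:: r1; rev_ord r0].
colz colv m1 f1 h1 hn c2 [:: r2; rev_ord r1; rev_ord r0].
colz colv m2 f2 h2 hn c0 [:: r0; r1]; colz colv m2 f2 h2 hn c1 [:: r0; rev_ord r1]; colz colv m2 f2 h2 hn c2 [:: r2; rev_ord r1].
colz colv m3 f3 h3 hn c0 [:: r0]; colz colv m3 f3 h3 hn c1 [:: r1; r2; rev_ord r0]; colz colv m3 f3 h3 hn c2 [:: r1; rev_ord r2].
move=> ? ? ? ? ? ? K2 K1 K0 *.
exists (m1 (mxvec_index (rev_ord r0) c1)), (m1 (mxvec_index (rev_ord r0) c2)),
  (m1 (mxvec_index r2 c2)), (m1 (mxvec_index (rev_ord r1) c2)), m1.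
split; [split; lia|lia|lia|exact: f1|].
move=> p; clear -K0 K1 K2 h1 hn v0 v1 v2 n2.
have [->|p0] := eqVneq p r0; first by kill m1 h1 hn; rewrite -?val_eqE /=; eqb; lia.
have [->|p1] := eqVneq p r1; first by kill m1 h1 hn; rewrite -?val_eqE /=; eqb; lia.
have [->|p2] := eqVneq p r2; first by kill m1 h1 hn; rewrite -?val_eqE /=; eqb; lia.
have [->|p3] := eqVneq p (rev_ord r0); first by kill m1 h1 hn; rewrite -?val_eqE /=; eqb; lia.
have [->|p4] := eqVneq p (rev_ord r1); first by kill m1 h1 hn; rewrite -?val_eqE /=; eqb; lia.
have p5 : p <> 0%N :> nat /\ p <> 1%N :> nat /\ p <> 2%N :> nat /\ p <> N.-1 :> nat /\ p <> N.-2 :> nat.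
  by move: p0 p1 p2 p3 p4; rewrite -!val_eqE /=; lia.
have lp := ltn_ord p.
rewrite !muln0 !(h1 p) //;
  clear -p5 lp v0 v1 v2 n2; rewrite /slice1 /=; lia.
Qed.
End Exponents.
End Classification.

(** * Nonvanishing of the covariants and classification of highest weight vectors *)

Section Nonvanishing.
Variables (n : nat).
Local Notation N := (n.*2).
Hypothesis n2 : (2 <= n)%N.
Variables (r0 r1 r2 : 'I_N).
Hypotheses (v0 : r0 = 0%N :> nat) (v1 : r1 = 1%N :> nat) (v2 : r2 = 2%N :> nat).

Lemma meval_xR (R : comNzRingType) (A : 'M[R]_(N, 3)) p j : (xR R p j).@[mxvec A 0] = A p j.
Proof. by rewrite mevalXU mxvecE. Qed.

Lemma meval_zR (R : comNzRingType) (A : 'M[R]_(N, 3)) i j :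
  (zR R n i j).@[mxvec A 0] = \sum_(r < N) (-1) ^+ r * (A r i * A (rev_ord r) j).
Proof.
rewrite raddf_sum; apply: eq_bigr => r _ /=.
by rewrite !mevalM rmorphXn rmorphN1 !meval_xR.
Qed.

Lemma covariant_neq0 (R : idomainType) e1 e2 e3 e4 e5 e6 :
  covariant R r0 r1 r2 e1 e2 e3 e4 e5 e6 != 0.
Proof.
(* A variant of [slice1] whose third column has boolean entries: they stay 1 when [r2 = rev_ord r1],
   so every generator takes the value 1 or -1, over any domain. *)
pose A : 'M[R]_(N, 3) := \matrix_(p, j) match val j with
  | 0 => (p == r0)%:R | 1 => (p == r1)%:R + (p == rev_ord r0)%:R
  | _ => [|| p == r2, p == rev_ord r1 | p == rev_ord r0]%:R end.
have d01 : (r1 == r0) = false by rewrite -val_eqE /=; lia.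
have d02 : (r2 == r0) = false by rewrite -val_eqE /=; lia.
have d12 : (r2 == r1) = false by rewrite -val_eqE /=; lia.
have b00 : (r0 == rev_ord r0) = false by rewrite -val_eqE /=; lia.
have b01 : (r0 == rev_ord r1) = false by rewrite -val_eqE /=; lia.
have b10 : (r1 == rev_ord r0) = false by rewrite -val_eqE /=; lia.
have b11 : (r1 == rev_ord r1) = false by rewrite -val_eqE /=; lia.
have A00 : A r0 c0 = 1 by rewrite mxE eqxx.
have A01 : A r0 c1 = 0 by rewrite mxE /= eq_sym d01 b00 addr0.
have A02 : A r0 c2 = 0 by rewrite mxE /= eq_sym d02 b01 b00.
have A10 : A r1 c0 = 0 by rewrite mxE /= d01.
have A11 : A r1 c1 = 1 by rewrite mxE /= eqxx b10 addr0.
have A12 : A r1 c2 = 0 by rewrite mxE /= eq_sym d12 b11 b10.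
have A20 : A r2 c0 = 0 by rewrite mxE /= d02.
have A22 : A r2 c2 = 1 by rewrite mxE /= eqxx.
have B01 : A (rev_ord r0) c1 = 1 by rewrite mxE /= eqxx eq_sym b10 add0r.
have B02 : A (rev_ord r0) c2 = 1 by rewrite mxE /= eqxx !orbT.
have B12 : A (rev_ord r1) c2 = 1 by rewrite mxE /= eqxx orbT.
have z0 j : (zR R n c0 j).@[mxvec A 0] = A (rev_ord r0) j.
  rewrite meval_zR (bigD1 r0) //= big1 => [|r rr]; last by rewrite [A r _]mxE (negPf rr) mul0r mulr0.
  by rewrite A00 v0 expr0 !mul1r addr0.
have z12 : (zR R n c1 c2).@[mxvec A 0] = -1.
  rewrite meval_zR (bigD1 r1) //= (bigD1 (rev_ord r0)) //=; last by rewrite eq_sym b10.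
  rewrite big1 => [|r /andP[h1 h2]]; last by rewrite [A r _]mxE /= (negPf h1) (negPf h2) addr0 mul0r mulr0.
  by rewrite rev_ordK A11 A02 B12 v1 expr1 !mulr1 !mulr0 !addr0.
have m01 : (minor2 R r0 r1 c0 c1).@[mxvec A 0] = 1.
  by rewrite mevalB !mevalM !meval_xR A00 A11 A01 A10 !mulr1 mul0r subr0.
have m02 : (minor2 R r0 r1 c0 c2).@[mxvec A 0] = 0.
  by rewrite mevalB !mevalM !meval_xR A00 A12 A02 A10 !mulr0 subr0.
have nz (g : {mpoly R[N * 3]}) : g.@[mxvec A 0] != 0 -> g != 0.
  by apply: contraNneq => ->; rewrite meval0.
have on := @oner_neq0 R.
rewrite /covariant !mulf_neq0 ?expf_neq0 //; apply: nz.
- by rewrite meval_xR A00.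
- by rewrite m01.
- by rewrite z0 B01.
- by rewrite mevalD mevalB !mevalM m01 m02 !meval_xR A22 A20 mul0r mulr0 mulr1 subr0 addr0.
- rewrite mevalD mevalB !mevalM !meval_xR A00 A01 A02 z12 !mul0r mul1r subr0 addr0.
  by rewrite oppr_eq0.
- by rewrite mevalB !mevalM m01 m02 z0 B02 mul0r mulr1 subr0.
Qed.

Lemma meval_base_point (F : fieldType) e1 e2 e4 :
  (covariant F r0 r1 r2 e1 e2 0 e4 0 0).@[mxvec (base_point F n) 0] = 1.
Proof.
have b p j : (xR F p j).@[mxvec (base_point F n) 0] = (p == j :> nat)%:R.
  by rewrite meval_xR mxE.
have m i j : (minor2 F r0 r1 i j).@[mxvec (base_point F n) 0] =
    ((0 == i :> nat) && (1 == j :> nat)%N)%:R - ((0 == j :> nat) && (1 == i :> nat)%N)%:R.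
  by rewrite mevalB !mevalM !b v0 v1 -!natrM !mulnb.
rewrite /covariant !expr0 !mulr1 !mevalM !rmorphXn /= b v0 expr1n mul1r.
rewrite m /= subr0 expr1n mul1r mevalD mevalB !mevalM !m !b v2 /=.
by rewrite !subr0 !mulr0 subr0 mulr1 addr0 expr1n.
Qed.

Section Covariants.
Variable F : fieldType.
Hypothesis hF : [pchar F] =i pred0.
Local Notation P := {mpoly F[N * 3]}.
Local Notation cov := (covariant F r0 r1 r2).

Lemma fischer_covariant e1 e2 e3 e4 e5 e6 :
  fischer (cov e1 e2 e3 e4 e5 e6) (cov e1 e2 e3 e4 e5 e6) != 0.
Proof.
rewrite -(map_covariant (intr : {rmorphism int -> F})).
by apply: fischer_int_neq0 => //; exact: covariant_neq0.
Qed.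

Lemma gsig_row_covariant X e1 e2 e3 e4 e5 e6 : in_gsig X -> utri X ->
  row_act X (cov e1 e2 e3 e4 e5 e6) =
  ((e1 + e2 + e4 + e5 + e6)%N%:R * X r0 r0 + (e2 + e4 + e6)%N%:R * X r1 r1 + e4%:R * X r2 r2)
    *: cov e1 e2 e3 e4 e5 e6.
Proof.
have two0 := two_neq0 hF; move=> gX uX; apply: row_covariant => // i j; apply: row_act_z.
exact: (in_gsigP two0 _ gX).
Qed.

(** The exponents found above give a covariant [G] with the same weight as [f]. A suitable
    [f - b *: G] vanishes at the point [slice1] and is still an eigenvector, hence it is zero. *)
Lemma gsig_highest_covariant lam (f : P) : colhw lam f -> f != 0 ->
  (forall X, in_gsig X -> supper X -> row_act X f = 0) ->
  (forall H, in_gsig H -> is_diag_mx H -> exists x, row_act H f = x *: f) ->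
  exists k z x y b, [/\ (x + y + z = lam c2 /\ (n = 2%N -> x = 0%N))%N, (k + lam c2 <= lam c1)%N,
    (z + lam c1 <= lam c0)%N, b != 0 &
    f = b *: cov (lam c0 - lam c1 - z) (lam c1 - lam c2 - k) k x y z].
Proof.
have two0 := two_neq0 hF.
move=> fR f0 fU fD.
have fX (p q : 'I_N) : (p <= q)%N -> exists x, row_act (gsym F p q) f = x *: f.
  rewrite leq_eqVlt => /orP[/eqP/val_inj <-|pq].
    by apply: fD; [exact: (gsym_gsig two0)|exact: gsym_diag].
  by exists 0; rewrite scale0r; apply: fU; [exact: (gsym_gsig two0)|exact: gsym_supper].
have [k [z [x [y [m [[xyz xn] hk hz mf hm]]]]]] := gsig_highest_exponents hF n2 v0 v1 v2 fR f0 fX.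
set G := cov (lam c0 - lam c1 - z) (lam c1 - lam c2 - k) k x y z.
have G0 : G != 0 := covariant_neq0 _ _ _ _ _ _ _.
have GR : colhw lam G by apply: colhw_covariant => //; lia.
have GX (p q : 'I_N) : (p <= q)%N -> exists x, row_act (gsym F p q) G = x *: G.
  by move=> pq; eexists; apply: gsig_row_covariant; [exact: (gsym_gsig two0)|exact: gsym_utri].
have fG (p q : 'I_N) : (p <= q)%N -> exists x, row_act (gsym F p q) G = x *: G /\ row_act (gsym F p q) f = x *: f.
  rewrite leq_eqVlt => /orP[/eqP/val_inj <-|pq].
    have [t ft] := fX _ _ (leqnn p); exists t; split=> //.
    rewrite (row_act_diag_eigen (gsym_diag F p) ft mf) gsym_rowdeg //.
    rewrite (gsig_row_covariant _ _ _ _ _ _ (gsym_gsig two0 p p) (gsym_utri F (leqnn p))); congr (_ *: _).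
    rewrite !hm !(inj_eq rev_ord_inj).
    have e (r : 'I_N) : gsym F p p r r = (p == r)%:R - (rev_ord p == r)%:R.
      rewrite !mxE addnn -signr_odd odd_double expr0 mul1r !andbb.
      by rewrite ![r == _]eq_sym.
    have rv (r : 'I_N) : (p == rev_ord r) = (rev_ord p == r).
      by rewrite [RHS](can2_eq (@rev_ordK _) (@rev_ordK _)).
    rewrite !e !rv.
    have -> : (lam c0 - lam c1 - z + (lam c1 - lam c2 - k) + x + y + z)%N = (lam c0 - k - z)%N by lia.
    have -> : (lam c1 - lam c2 - k + x + z)%N = (lam c1 - k - y)%N by lia.
    rewrite !natrD !natrM !natrB; try lia.
    by rewrite natrD; ring.
  exists 0; split; last by rewrite scale0r; apply: fU; [exact: (gsym_gsig two0)|exact: gsym_supper].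
  rewrite (gsig_row_covariant _ _ _ _ _ _ (gsym_gsig two0 p q) (gsym_utri F (ltnW pq))).
  by rewrite !(gsym_supper F pq) // !mulr0 !addr0.
pose A : 'M[F]_(N, 3) := \matrix_(p, j) (slice1 N p j)%:R.
have GA : G.@[mxvec A 0] != 0 := slice_neq0 hF (slice1_conormal hF n2) GR G0 GX.
pose b := f.@[mxvec A 0] / G.@[mxvec A 0].
have fbG : f = b *: G.
  apply/eqP; rewrite -subr_eq0; apply/negPn/negP => fG0.
  have fGR : colhw lam (f - b *: G) by rewrite addrC -scaleNr; exact: colhw_comb.
  have eX (p q : 'I_N) : (p <= q)%N -> exists x, row_act (gsym F p q) (f - b *: G) = x *: (f - b *: G).
    move=> /fG[t [h1 h2]]; exists t; rewrite /row_act linearB linearZ /=.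
    by rewrite [vf _ f]h2 [vf _ G]h1 scalerBr !scalerA mulrC.
  case/negP: (slice_neq0 hF (slice1_conormal hF n2) fGR fG0 eX).
  by rewrite mevalB mevalZ divfK // subrr.
exists k, z, x, y, b; split=> //.
by apply: contraNneq f0 => b0; rewrite fbG b0 scale0r.
Qed.
End Covariants.
End Nonvanishing.

(** * Dominant tableaux *)

Lemma sorted2_nseq (a b : nat) s : (a < b)%N -> sorted leq s -> all (fun c => (c == a) || (c == b)) s ->
  exists x y, s = nseq x a ++ nseq y b.
Proof.
move=> ab; elim: s => [|c s IHs]; first by exists 0%N, 0%N.
move=> ss /= /andP[hc hs]; have {}IHs := IHs (path_sorted ss) hs.
case/orP: hc => /eqP hc; first by have [x [y ->]] := IHs; exists x.+1, y; rewrite hc.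
exists 0%N, (size s).+1; rewrite /= hc; congr (_ :: _); apply/all_pred1P.
have := order_path_min leq_trans ss; rewrite hc => /allP h.
by apply/allP => d ds /=; have /orP[/eqP e|//] := allP hs d ds; have := h d ds; lia.
Qed.

Lemma sorted3_nseq (a b c : nat) s : (a < b)%N -> (b < c)%N -> sorted leq s ->
  all (fun d => [|| d == a, d == b | d == c]) s ->
  exists x y z, s = nseq x a ++ nseq y b ++ nseq z c.
Proof.
move=> ab bc; elim: s => [|d s IHs]; first by exists 0%N, 0%N, 0%N.
move=> ss /andP[hd hs]; have {}IHs := IHs (path_sorted ss) hs.
have [da|da] := eqVneq d a; first by have [x [y [z ->]]] := IHs; exists x.+1, y, z; rewrite da.
have /= hm := order_path_min leq_trans ss.
have [|y [z ->]] := @sorted2_nseq b c (d :: s) bc ss; last by exists 0%N, y, z.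
have hds : all (fun d => [|| d == a, d == b | d == c]) (d :: s) by apply/andP; split.
apply/allP => e es; have := allP hds e es.
have de : (d <= e)%N by move: es; rewrite inE => /orP[/eqP ->//|/(allP hm)].
by move: hd; rewrite (negPf da) /=; lia.
Qed.

Lemma count_take_nseq (p : pred nat) j m c s :
  count p (take j (nseq m c ++ s)) = (p c * minn j m + count p (take (j - m) s))%N.
Proof.
rewrite take_cat size_nseq; case: ltnP => jm.
  have -> : (j - m = 0)%N by lia.
  rewrite take0 addn0.
  have -> : take j (nseq m c) = nseq j c by rewrite -{1}(subnKC (ltnW jm)) nseqD take_size_cat ?size_nseq.
  by rewrite count_nseq.
by rewrite count_cat count_nseq.
Qed.

Section Tableaux.
Variables (n : nat).
Local Notation N := (n.*2).
Hypothesis n2 : (2 <= n)%N.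

(** After [u] the coordinates from [b] to [n] are all zero. The letter [l] then raises one of them
    above its predecessor, or lowers one below its successor, or makes the last one negative. *)
Lemma dominant_bad_letter b u l v : (1 <= b)%N -> all (fun c => (c < b) || (N.+1 - b < c))%N u ->
  (b < l <= N.+1 - b)%N -> ~ dominant_prefixes n (u ++ l :: v).
Proof.
move=> b1 hu hl dom; have [|hi hn] := dom (size u).+1; first by rewrite size_cat /= addnS ltnS leq_addr.
have tk : take (size u).+1 (u ++ l :: v) = rcons u l.
  by rewrite take_cat ltnNge leqnSn /= subSnn /= take0 cats1.
have cu c : (b <= c <= N.+1 - b)%N -> count_mem c u = 0%N.
  by move=> hc; apply/count_memPn/negP => /(allP hu); lia.
have cr c : count_mem c (rcons u l) = (count_mem c u + (l == c))%N.
  by rewrite -cats1 count_cat /= addn0.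
rewrite tk in hi hn.
case: (leqP l n) => ln; first by have := hi l.-1; rewrite /cco !cr !cu; lia.
case: (ltnP (N.+1 - l) n) => hln; first by have := hi (N.+1 - l)%N; rewrite /cco !cr !cu; lia.
by move: hn; rewrite /cco !cr !cu; lia.
Qed.

(** A row is read from its largest letter down. Letters beyond [N.+1 - b] preserve the hypothesis on
    [u]; the first other letter must be [b], and what follows lies between [b] and [b]. *)
Lemma dominant_row b u v w : (1 <= b)%N -> all (fun c => (c < b) || (N.+1 - b < c))%N u ->
  sorted geq v -> all (fun c => b <= c <= N)%N v -> dominant_prefixes n (u ++ v ++ w) ->
  all (fun c => (c == b) || (N.+1 - b < c))%N v.
Proof.
move=> b1; elim: v u => [//|l v IHv] u hu sv /= /andP[hl hv] dom.
have [lb|lb] := ltnP (N.+1 - b) l.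
  rewrite orbT /=; apply: (IHv (rcons u l)) => //; last by rewrite cat_rcons.
    by rewrite all_rcons hu lb orbT.
  exact: path_sorted sv.
have [bl|bl] := ltnP b l; first by case: (@dominant_bad_letter b u l (v ++ w)) => //; lia.
have -> : l = b by lia.
rewrite eqxx /=; apply/allP => c cv.
have := allP (order_path_min (rev_trans leq_trans) sv) c cv.
by have := allP hv c cv; rewrite /geq /=; lia.
Qed.

Variable a : nat -> nat.
Hypothesis ha : n = 2%N \/ (forall i, (4 <= i <= N.-1)%N -> a i = 0%N).
Local Notation L := (rowlen n a).

Lemma rowlenS r : (r < N)%N -> L r = (a r + L r.+1)%N.
Proof. by move=> rN; rewrite /rowlen big_ltn. Qed.

Lemma rowlen_ge4 r : (4 <= r)%N -> L r = 0%N.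
Proof.
move=> r4; rewrite /rowlen big_nat_cond big1 // => i /andP[/andP[ri iN] _].
case: ha => [n2'|h]; first by lia.
by apply: h; lia.
Qed.

(** The only shape that dominance allows: [k] and [z] count the letters N in the second and third
    rows, [x] and [y] the letters 3 and N-1 in the third. *)
Definition std_rows (k z x y : nat) : tableau :=
  [:: nseq (L 1) 1%N; nseq (L 2 - k) 2%N ++ nseq k N; nseq x 3 ++ nseq y (N - 1)%N ++ nseq z N].
Definition std_tab k z x y : tableau := std_rows k z x y ++ nseq (N - 4) [::].

(** The first inequality says that no box lies below a letter N, the second is dominance right after
    the letters N of the third row. For [n = 2] the letters 3 and N-1 are equal, and [x = 0] keeps
    the parameters unique. *)
Definition std_params (k z x y : nat) : Prop :=
  [/\ (x + y + z = L 3)%N, (k + L 3 <= L 2)%N, (z + L 2 <= L 1)%N & n = 2%N -> x = 0%N].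

Lemma word_std_tab k z x y : word (std_tab k z x y) =
  nseq (L 1) 1%N ++ nseq k N ++ nseq (L 2 - k) 2%N ++ nseq z N ++ nseq y (N - 1)%N ++ nseq x 3%N.
Proof.
rewrite /word /std_tab map_cat flatten_cat /= !rev_cat !rev_nseq.
have -> : flatten [seq rev i | i <- nseq (N - 4) [::]] = [::] :> seq nat by elim: (N - 4)%N.
by rewrite !cats0 -!catA.
Qed.

Lemma row_std_tab k z x y r : Defs.row (std_tab k z x y) r = nth [::] (std_rows k z x y) r.
Proof.
rewrite /Defs.row /std_tab nth_cat; case: ltnP => // r3.
by rewrite nth_nseq if_same nth_default.
Qed.

Lemma std_tab_domres k z x y : std_params k z x y -> domres n a (std_tab k z x y).
Proof.
move=> [xyz hk hz hx].
have rows (Q : nat -> seq nat -> Prop) : Q 0%N (nseq (L 1) 1%N) ->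
    Q 1%N (nseq (L 2 - k) 2%N ++ nseq k N) -> Q 2%N (nseq x 3 ++ nseq y (N - 1)%N ++ nseq z N) ->
    (forall r, (3 <= r)%N -> Q r [::]) -> forall r, Q r (Defs.row (std_tab k z x y) r).
  move=> q0 q1 q2 q3 r; rewrite row_std_tab.
  by case: r => [|[|[|r]]] //=; rewrite nth_nil; exact: q3.
split; first split.
- by rewrite size_cat size_nseq /=; lia.
- apply: (rows (fun r s => (r < N.-1)%N -> size s = L r.+1)) => [_|_|_|r r3 _].
  + by rewrite size_nseq.
  + by rewrite size_cat !size_nseq; lia.
  + by rewrite !size_cat !size_nseq; lia.
  + by rewrite rowlen_ge4.
- have an m c : (1 <= c <= N)%N -> all (fun l => 1 <= l <= N)%N (nseq m c).
    by move=> hc; apply/allP => d /nseqP[-> _].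
  have a3 : all (fun l => 1 <= l <= N)%N (nseq x 3).
    by case: (eqVneq n 2%N) => [/hx ->//|hn]; apply: an; lia.
  by apply: (rows (fun _ s => all _ s)) => [||//|]; rewrite ?all_cat ?a3 ?an //; lia.
- have sn m c : sorted leq (nseq m c) by case: m => //= m; elim: m => //= m ->; rewrite leqnn.
  have sc s1 s2 b : sorted leq s1 -> sorted leq s2 -> all (fun c => c <= b)%N s1 ->
      all (fun c => b <= c)%N s2 -> sorted leq (s1 ++ s2).
    move=> h1 h2 /allP b1 /allP b2; rewrite sorted_pairwise; last exact: leq_trans.
    rewrite pairwise_cat -!sorted_pairwise ?h1 ?h2 ?andbT //; try exact: leq_trans.
    by apply/allrelP => c d /b1 ? /b2; exact: leq_trans.
  have al m c b : (c <= b)%N -> all (fun d => d <= b)%N (nseq m c).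
    by move=> hc; apply/allP => d /nseqP[-> _].
  have ag m c b : (b <= c)%N -> all (fun d => b <= d)%N (nseq m c).
    by move=> hc; apply/allP => d /nseqP[-> _].
  apply: (rows (fun _ s => sorted leq s)) => //.
    by apply: (sc _ _ 2%N) => //; [apply: al|apply: ag; lia].
  apply: (sc _ _ 3%N) => //; first 1 last.
  + by apply: al.
  + by rewrite all_cat !ag //; lia.
  + by apply: (sc _ _ (N - 1)%N) => //; [apply: al|apply: ag; lia].
- move=> r j _; rewrite !row_std_tab; case: r => [|[|r]] /=.
  + rewrite size_cat !size_nseq => hj; rewrite nth_nseq nth_cat size_nseq !nth_nseq.
    by do !case: ifP; lia.
  + rewrite !size_cat !size_nseq => hj; rewrite !nth_cat !size_nseq !nth_nseq.
    have [n2'|n3] := eqVneq n 2%N; last by do !case: ifP; lia.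
    by rewrite (hx n2'); do !case: ifP; lia.
  + by rewrite nth_nil.
move=> j _; rewrite word_std_tab /cco.
have ct c : count_mem c (take j (nseq (L 1) 1%N ++ nseq k N ++ nseq (L 2 - k) 2%N ++ nseq z N ++
     nseq y (N - 1)%N ++ nseq x 3)) =
  ((1%N == c) * minn j (L 1) + ((N == c) * minn (j - L 1) k + ((2%N == c) * minn (j - L 1 - k) (L 2 - k) +
   ((N == c) * minn (j - L 1 - k - (L 2 - k)) z + (((N - 1)%N == c) * minn (j - L 1 - k - (L 2 - k) - z) y +
   (3%N == c) * minn (j - L 1 - k - (L 2 - k) - z - y) x)))))%N.
  by rewrite !count_take_nseq -[nseq x 3]cats0 count_take_nseq /= addn0.
set t1 := minn j _ in ct; set t2 := minn (j - L 1) k in ct.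
set t3 := minn _ (L 2 - k) in ct; set t4 := minn _ z in ct.
set t5 := minn _ y in ct; set t6 := minn _ x in ct.
(* [t1] to [t6] count the letters that a prefix takes from each block of the word. These
   inequalities are all that dominance uses of the prefix length. *)
have [h1 h2 h3] : [/\ t2 + t3 + t4 <= t1, t5 + t6 <= t3 & t1 <= L 1]%N by rewrite /t1 /t2 /t3 /t4 /t5 /t6; split; lia.
have h4 : n = 2%N -> t6 = 0%N by move/hx => x0; rewrite /t6 x0 minn0.
clearbody t1 t2 t3 t4 t5 t6.
split=> [i hi|]; rewrite !ct.
  have [i1|i1] := eqVneq i 1%N; first by rewrite i1; eqb; rewrite !mul0n !mul1n; lia.
  have [i2|i2] := eqVneq i 2%N; first by rewrite i2; eqb; rewrite !mul0n !mul1n; lia.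
  by eqb; rewrite !mul0n; lia.
have [n2'|n3] := eqVneq n 2%N; first by rewrite (h4 n2'); eqb; rewrite ?mul0n ?mul1n; lia.
have [n3'|n4] := eqVneq n 3%N; first by eqb; rewrite !mul0n !mul1n; lia.
by eqb; rewrite !mul0n; lia.
Qed.

Lemma domres_std_tab t : domres n a t -> exists k z x y, std_params k z x y /\ t = std_tab k z x y.
Proof.
move=> [[st sr al so col] dom].
have L1E : L 1 = (a 1%N + L 2)%N by rewrite rowlenS //; lia.
have L2E : L 2 = (a 2%N + L 3)%N by rewrite rowlenS //; lia.
set s0 := Defs.row t 0 in dom; set s1 := Defs.row t 1; set s2 := Defs.row t 2.
have z0 : size s0 = L 1 by apply: sr; lia.
have z1 : size s1 = L 2 by apply: sr; lia.
have z2 : size s2 = L 3 by apply: sr; lia.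
have tE : t = [:: s0; s1; s2] ++ nseq (N - 4) [::].
  apply: (@eq_from_nth _ [::]) => [|r]; first by rewrite size_cat size_nseq /= st; lia.
  rewrite st => rN; rewrite nth_cat /=; case: r rN => [|[|[|r]]] rN //=.
  by rewrite nth_nseq if_same; apply/size0nil; rewrite -/(Defs.row t _) sr ?rowlen_ge4 //; lia.
have wE : word t = rev s0 ++ rev s1 ++ rev s2.
  rewrite /word tE map_cat flatten_cat /=.
  have -> : flatten [seq rev i | i <- nseq (N - 4) [::]] = [::] :> seq nat by elim: (N - 4)%N.
  by rewrite !cats0.
have dsc r : sorted geq (rev (Defs.row t r)) by rewrite rev_sorted; exact: so.
have rng r b : (forall j, (j < size (Defs.row t r))%N -> (b <= nth 0%N (Defs.row t r) j)%N) ->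
    all (fun c => b <= c <= N)%N (rev (Defs.row t r)).
  move=> h; rewrite all_rev; apply/(all_nthP 0%N) => j hj; rewrite h //=.
  by have /andP[] := all_nthP 0%N (al r) j hj.
have pos r j : (j < size (Defs.row t r))%N -> (1 <= nth 0%N (Defs.row t r) j <= N)%N.
  by move=> hj; exact: (all_nthP 0%N (al r) j hj).
rewrite wE in dom.
have e0 : s0 = nseq (L 1) 1%N.
  rewrite -z0; apply/all_pred1P; have a0 := @rng 0%N 1%N (fun j hj => proj1 (andP (pos _ j hj))).
  have := @dominant_row 1 [::] (rev s0) (rev s1 ++ rev s2) isT isT (dsc 0%N) a0 dom.
  rewrite all_rev => /allP h; apply/allP => c cs; have := h c cs; rewrite /=.
  by move: a0; rewrite all_rev => /allP/(_ c cs); lia.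
have u1 : all (fun c => (c < 2) || (N.+1 - 2 < c))%N (rev s0).
  by rewrite e0 rev_nseq; apply/allP => c /nseqP[->].
have ge2 j : (j < size s1)%N -> (2 <= nth 0%N s1 j)%N.
  move=> hj; have := col 0%N j; rewrite -/s0 -/s1 e0 nth_nseq.
  have -> : (j < L 1)%N by lia.
  by move=> h; apply: h => //; lia.
have g1 := @dominant_row 2 (rev s0) (rev s1) (rev s2) isT u1 (dsc 1%N) (rng 1%N 2%N ge2) dom.
have [p [k e1]] : exists x y, s1 = nseq x 2%N ++ nseq y N.
  apply: sorted2_nseq; [lia|exact: so|].
  apply/allP => c cs; move: g1; rewrite all_rev => /allP/(_ c cs).
  by have /allP/(_ c cs) := al 1%N; lia.
have pk : (p + k = L 2)%N by rewrite -z1 e1 size_cat !size_nseq.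
have kL : (k + L 3 <= L 2)%N.
  (* Otherwise there would be a box below the first N of the second row, in column [p], and its
     letter would exceed N. *)
  rewrite leqNgt; apply/negP => h.
  have := col 1%N p; rewrite -/s1 -/s2 e1 nth_cat size_nseq ltnn subnn nth_nseq.
  have -> : (0 < k)%N by lia.
  move=> /(_ ltac:(lia)) h'; have hp : (p < size s2)%N by lia.
  by have := pos 2%N p hp; rewrite -/s2; move: (h' hp); lia.
have ge3 j : (j < size s2)%N -> (3 <= nth 0%N s2 j)%N.
  move=> hj; have := col 1%N j; rewrite -/s1 -/s2 e1 nth_cat size_nseq nth_nseq.
  have -> : (j < p)%N by lia.
  by move=> h; apply: h => //; lia.
have u2 : all (fun c => (c < 3) || (N.+1 - 3 < c))%N (rev s0 ++ rev s1).
  rewrite all_cat e0 e1 rev_cat !rev_nseq all_cat.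
  by apply/and3P; split; apply/allP => c /nseqP[-> _]; lia.
have g2 : all (fun c => (c == 3) || (N.+1 - 3 < c))%N (rev s2).
  apply: (@dominant_row 3 (rev s0 ++ rev s1) (rev s2) [::] isT u2 (dsc 2%N) (rng 2%N 3%N ge3)).
  by rewrite cats0 -catA.
have [x [y [z [e2 hx]]]] : exists x y z, s2 = nseq x 3%N ++ nseq y (N - 1)%N ++ nseq z N /\ (n = 2%N -> x = 0%N).
  have ok c : c \in s2 -> [|| c == 3%N, c == (N - 1)%N | c == N].
    move=> cs; move: g2; rewrite all_rev => /allP/(_ c cs).
    by have /allP/(_ c cs) := al 2%N; lia.
  have [n2'|n3] := eqVneq n 2%N.
    have [||y [z e2]] := @sorted2_nseq (N - 1) N s2 _ (so 2%N); first by lia.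
      by apply/allP => c /ok; lia.
    by exists 0%N, y, z.
  have [|||x [y [z e2]]] := @sorted3_nseq 3 (N - 1) N s2 _ _ (so 2%N); try lia.
    by apply/allP => c /ok.
  by exists x, y, z; split=> // e; rewrite e eqxx in n3.
have xyz : (x + y + z = L 3)%N by rewrite -z2 e2 !size_cat !size_nseq addnA.
have wE' : rev s0 ++ rev s1 ++ rev s2 =
    nseq (L 1) 1%N ++ nseq k N ++ nseq p 2%N ++ nseq z N ++ nseq y (N - 1)%N ++ nseq x 3%N.
  by rewrite e0 e1 e2 !rev_cat !rev_nseq -!catA.
exists k, z, x, y; split; last first.
  by rewrite tE e0 e1 e2 /std_tab /std_rows; have -> : (L 2 - k = p)%N by lia.
split=> //.
(* The critical prefix ends with the last N of the third row: the letters N-1 come later and would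
   lower the second coordinate. *)
have [|/(_ 1%N) h _] := dom (L 1 + k + p + z)%N.
  by rewrite wE' !size_cat !size_nseq; lia.
have := h ltac:(lia); rewrite wE' /cco !count_take_nseq /=.
have -> : (L 1 + k + p + z - L 1 - k - p - z)%N = 0%N by lia.
rewrite !take0 /=.
by eqb; lia.
Qed.

Lemma muT_std_tab (F : fieldType) (r0 r1 r2 : 'I_N) (H : 'M[F]_N) k z x y :
  r0 = 0%N :> nat -> r1 = 1%N :> nat -> r2 = 2%N :> nat -> std_params k z x y ->
  (forall r, H (rev_ord r) (rev_ord r) = - H r r) ->
  muT (std_tab k z x y) H =
  (L 1 - k - z)%N%:R * H r0 r0 + (L 2 - k - y)%N%:R * H r1 r1 + x%:R * H r2 r2.
Proof.
move=> v0 v1 v2 [xyz hk hz hx] Hr.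
have dgE (r : 'I_N) m : m = r.+1 -> dg H m.-1 = H r r.
  move=> ->; rewrite /dg (bigD1 r) //= big1 ?addr0 // => i /andP[/eqP e].
  by rewrite -val_eqE /= e eqxx.
have sn (s : seq nat) m c h : dg H c.-1 = h ->
    \sum_(l <- nseq m c ++ s) dg H l.-1 = m%:R * h + \sum_(l <- s) dg H l.-1.
  move=> hc; rewrite big_cat; congr (_ + _) => /=.
  by elim: m => [|m IHm]; rewrite ?big_nil ?mul0r //= big_cons IHm hc mulrSr mulrDl mul1r addrC.
rewrite /muT word_std_tab -[nseq x 3]cats0.
rewrite (sn _ _ _ (H r0 r0)); last by apply: dgE; rewrite v0.
rewrite (sn _ _ _ (- H r0 r0)); last by rewrite -Hr; apply: dgE => /=; lia.
rewrite (sn _ _ _ (H r1 r1)); last by apply: dgE; rewrite v1.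
rewrite (sn _ _ _ (- H r0 r0)); last by rewrite -Hr; apply: dgE => /=; lia.
rewrite (sn _ _ _ (- H r1 r1)); last by rewrite -Hr; apply: dgE => /=; lia.
rewrite (sn _ _ _ (H r2 r2)); last by apply: dgE; rewrite v2.
rewrite big_nil; have h1 : (k + z <= L 1)%N by lia.
have h2 : (k + y <= L 2)%N by lia.
by rewrite -!subnDA !natrB ?natrD //; [ring|lia].
Qed.
End Tableaux.

(** * The polynomial model *)

(** By excluded middle, a row space contained in [Q] either is all of [Q] or can be enlarged by a
    vector of [Q]; the rank stops this after at most [d] rounds. *)
Lemma subspace_mx (F : fieldType) d (Q : 'rV[F]_d -> Prop) : Q 0 ->
  (forall c u v, Q u -> Q v -> Q (c *: u + v)) ->
  exists W : 'M[F]_d, forall v, (v <= W)%MS <-> Q v.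
Proof.
move=> Q0 Qlin.
have Qsum m (u : 'rV_m) (A : 'M_(m, d)) : (forall i, Q (matrix.row i A)) -> Q (u *m A).
  move=> hA; rewrite mulmx_sum_row; elim/big_rec: _ => // i v _; exact: Qlin.
have key k : forall W : 'M[F]_d, (d - \rank W <= k)%N -> (forall v, (v <= W)%MS -> Q v) ->
    exists W : 'M[F]_d, forall v, (v <= W)%MS <-> Q v.
  elim: k => [|k IHk] W hW WQ; last first.
    case: (classic (forall v, Q v -> (v <= W)%MS)) => [h|]; first by exists W => v; split; [exact: WQ|exact: h].
    move=> /not_all_imply[v Qv /negP vW]; apply: (IHk (W + v)%MS) => [|u].
      have : (\rank W < \rank (W + v)%MS)%N.
        rewrite ltn_neqAle mxrankS ?addsmxSl // andbT; apply: contra vW => /eqP e.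
        by apply: submx_trans (addsmxSr W v) _; rewrite -(geq_leqif (mxrank_leqif_sup (addsmxSl W v))) e.
      by lia.
    case/sub_addsmxP => [[u1 u2]] ->; rewrite -[_ *m W]scale1r; apply: Qlin.
      by apply: WQ; exact: submxMl.
    by apply: Qsum => i; rewrite ord1 row_id.
  exists W => v; split; first exact: WQ.
  have /eqP e : \rank W == d by move: hW; have := rank_leq_row W; lia.
  by move=> _; apply: submx_full; rewrite /row_full e.
have h0 (v : 'rV_d) : (v <= (0 : 'M[F]_d))%MS -> Q v by rewrite submx0 => /eqP ->.
exact: (key _ 0 (leqnn _) h0).
Qed.

(** * Identification of the given module with the polynomial model *)

Section Transport.
Variables (F : fieldType) (hF : [pchar F] =i pred0) (n : nat) (n2 : (2 <= n)%N).
Local Notation N := (n.*2).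
Local Notation P := {mpoly F[N * 3]}.
Variables (r0 r1 r2 : 'I_N).
Hypotheses (v0 : r0 = 0%N :> nat) (v1 : r1 = 1%N :> nat) (v2 : r2 = 2%N :> nat).
Variable a : nat -> nat.
Hypothesis ha : n = 2%N \/ (forall i, (4 <= i <= N.-1)%N -> a i = 0%N).
Variables (d : nat) (rho : 'M[F]_N -> 'M[F]_d).
Hypotheses (hrho : is_sl_rep rho) (hL : is_L_sl a rho).

Definition act X (v : 'rV[F]_d) : 'rV[F]_d := v *m (rho X)^T.

Lemma actX c X Y v : act (c *: X + Y) v = c *: act X v + act Y v.
Proof. by rewrite /act (proj1 hrho) linearP /= mulmxDr -scalemxAr. Qed.

Lemma actV X c u v : act X (c *: u + v) = c *: act X u + act X v.
Proof. by rewrite /act mulmxDl -scalemxAl. Qed.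

Lemma act_bracket X Y v : in_sl X -> in_sl Y ->
  act (X *m Y - Y *m X) v = act X (act Y v) - act Y (act X v).
Proof.
by move=> hX hY; rewrite /act (proj2 hrho) // linearB /= !trmx_mul mulmxBr !mulmxA.
Qed.

Lemma act0 v : act 0 v = 0.
Proof. by have := actX (-1) 0 0 v; rewrite scaleN1r addNr scaleN1r addNr. Qed.

Lemma actV0 X : act X 0 = 0.
Proof. exact: mul0mx. Qed.

Lemma act_deltas X v : act X v = \sum_p \sum_q X p q *: act (delta_mx p q) v.
Proof.
have sumE (I : finType) (c : I -> F) (Y : I -> 'M[F]_N) :
    act (\sum_i c i *: Y i) v = \sum_i c i *: act (Y i) v.
  elim/big_rec2: _ => [|i y1 y2 _ <-]; first exact: act0.
  by rewrite actX.
rewrite {1}[X]matrix_sum_delta pair_bigA /= sumE.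
by rewrite [RHS]pair_bigA.
Qed.

Lemma delta_sl (p q : 'I_N) : p != q -> in_sl (delta_mx p q : 'M[F]_N).
Proof.
move=> pq; rewrite /in_sl /mxtrace big1 // => i _; rewrite mxE.
by case: eqP => // ->; rewrite (negPf pq).
Qed.

(** The simple root vectors generate: [E_pq] is the bracket of [E_ps] and [E_sq] with [s = p + 1],
    by induction on [q - p]. *)
Lemma supper_killed v : (forall i, (1 <= i <= N.-1)%N -> v *m (rho (xg F n i))^T = 0) ->
  forall X, supper X -> act X v = 0.
Proof.
move=> hv X sX.
have k1 (p q : 'I_N) : q = p.+1 :> nat -> act (delta_mx p q) v = 0.
  move=> e; have -> : delta_mx p q = xg F n q.
    by apply/matrixP => r s; rewrite !mxE -!val_eqE /= e.
  by apply: hv; have := ltn_ord q; lia.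
have kd k : forall p q : 'I_N, (q = p + k.+1 :> nat)%N -> act (delta_mx p q) v = 0.
  elim: k => [|k IHk] p q e; first by apply: k1; lia.
  have hs : (p.+1 < N)%N by have := ltn_ord q; lia.
  pose s := Ordinal hs.
  have e1 : delta_mx p q = delta_mx p s *m delta_mx s q - delta_mx s q *m delta_mx p s :> 'M[F]_N.
    rewrite mul_delta_mx mul_delta_mx_0 ?subr0 //.
    by rewrite -val_eqE /= e; lia.
  rewrite e1 act_bracket; try (apply: delta_sl; rewrite -val_eqE /=; lia).
  by rewrite (IHk s q) ?(k1 p s) ?actV0 ?subr0 //= e; lia.
rewrite act_deltas big1 // => p _; rewrite big1 // => q _.
have [qp|pq] := leqP q p; first by rewrite sX // scale0r.
by rewrite (kd (q - p.+1)%N) ?scaler0 //; lia.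
Qed.
Local Notation L := (rowlen n a).
Definition shape_wt (j : 'I_3) : nat := nth 0%N [:: L 1; L 2; L 3] j.
Local Notation cov := (covariant F r0 r1 r2).
(** The product of the leading minors of sizes 1, 2, 3 to the powers a_1, a_2, a_3. *)
Definition hw_poly : P := cov (L 1 - L 2) (L 2 - L 3) 0 (L 3) 0 0.

Lemma rowlen_le21 : (L 2 <= L 1)%N.
Proof. by rewrite (rowlenS a (r := 1)); lia. Qed.
Lemma rowlen_le32 : (L 3 <= L 2)%N.
Proof. by rewrite (rowlenS a (r := 2)); lia. Qed.

Lemma wt_slE (H : 'M[F]_N) : wt_sl a H = (L 1)%:R * H r0 r0 + (L 2)%:R * H r1 r1 + (L 3)%:R * H r2 r2.
Proof.
have l1 : L 1 = (a 1%N + L 2)%N by rewrite rowlenS //; lia.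
have l2 : L 2 = (a 2%N + L 3)%N by rewrite rowlenS //; lia.
have l3 : L 3 = a 3%N by rewrite rowlenS ?(rowlen_ge4 n2 ha) ?addn0 //; lia.
have om (r : 'I_N) i : i = r.+1 -> omega i H = \sum_(p < N | (p <= r)%N) H p p by move=> ->.
rewrite /wt_sl big_ltn; last lia; rewrite big_ltn; last lia; rewrite big_ltn; last lia.
rewrite big_nat_cond big1 => [|i /andP[/andP[i4 iN] _]]; last first.
  have -> : a i = 0%N; last by rewrite mul0r.
  by case: ha => [|h]; [lia|apply: h; lia].
rewrite (om r0 1%N) ?(om r1 2%N) ?(om r2 3%N); try lia.
rewrite (sum_le0 _ v0) (sum_le1 _ v0 v1) (sum_le2 _ v0 v1 v2) l1 l2 l3 !natrD; ring.
Qed.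

Lemma hw_poly_colhw : colhw shape_wt hw_poly.
Proof.
have := rowlen_le21; have := rowlen_le32 => h1 h2.
by apply: colhw_covariant; rewrite ?(two_neq0 hF) // /shape_wt /=; lia.
Qed.

Lemma hw_poly_row X : utri X ->
  row_act X hw_poly = ((L 1)%:R * X r0 r0 + (L 2)%:R * X r1 r1 + (L 3)%:R * X r2 r2) *: hw_poly.
Proof.
have := rowlen_le21; have := rowlen_le32 => h1 h2 uX.
rewrite /hw_poly row_covariant_sl ?(two_neq0 hF) //.
have -> : (L 1 - L 2 + (L 2 - L 3) + L 3 = L 1)%N by lia.
by rewrite subnK.
Qed.

Lemma hw_poly_base : hw_poly.@[mxvec (base_point F n) 0] = 1.
Proof. exact: meval_base_point. Qed.

(** The base point is an identity block above zeros. There a strictly lower [X] moves the point in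
    the same direction as a combination of strictly upper column operations, and those kill [f]. *)
Lemma row_act_lower_base X (f : P) : colhw shape_wt f -> supper X^T ->
  (row_act X f).@[mxvec (base_point F n) 0] = 0.
Proof.
move=> [fU _] lX; set b := base_point F n.
pose g p j := (f^`M(mxvec_index p j)).@[mxvec b 0].
have dot (Y : 'M[F]_(N, 3)) : (mxvec Y *m (\col_i (f^`M(i)).@[mxvec b 0])) 0 0 = \sum_p \sum_j Y p j * g p j.
  rewrite mxE sum_mxvec; apply: eq_bigr => p _; apply: eq_bigr => j _.
  by rewrite mxvecE !mxE.
rewrite /row_act meval_vf mxvec_rowmx dot big1 // => p _; rewrite big1 // => j _.
have jN : (j < N)%N by have := ltn_ord j; lia.
have -> : (X^T *m b) p j = X (Ordinal jN) p.
  rewrite mxE (bigD1 (Ordinal jN)) //= big1 => [|k kj]; first by rewrite !mxE eqxx mulr1 addr0.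
  by rewrite [b _ _]mxE; move: kj; rewrite -val_eqE /= => /negPf ->; rewrite mulr0.
have [pj|jp] := ltnP p j; last by have := lX p (Ordinal jN) jp; rewrite mxE => ->; rewrite mul0r.
have p3 : (p < 3)%N := ltn_trans pj (ltn_ord j).
have := congr1 (meval (mxvec b 0)) (fU (Ordinal p3) j pj).
rewrite meval0 /col_act meval_vf mxvec_colmx dot => gpj.
suff -> : g p j = 0 by rewrite mulr0.
rewrite -[RHS]gpj (bigD1 p) //= (bigD1 j) //=.
have bd q k : (b *m delta_mx (Ordinal p3) j) q k = if (q == p) && (k == j) then 1 else 0.
  rewrite mxE (bigD1 (Ordinal p3)) //= big1 => [|i ip]; last by rewrite !mxE (negPf ip) mulr0.
  rewrite !mxE eqxx addr0 /= val_eqE.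
  by case: (q == p); case: (k == j); rewrite /= ?mulr1 ?mulr0.
rewrite bd !eqxx mul1r !big1 ?addr0 // => [q qp|k kj]; last by rewrite bd (negPf kj) andbF mul0r.
by rewrite big1 // => k _; rewrite bd (negPf qp) mul0r.
Qed.

Section Graph.
Variable u0 : 'rV[F]_d.
Hypotheses (u0_neq0 : u0 != 0)
  (u0_killed : forall i, (1 <= i <= N.-1)%N -> u0 *m (rho (xg F n i))^T = 0)
  (u0_wt : forall H, in_h H -> u0 *m (rho H)^T = wt_sl a H *: u0).

Definition pair_act X (e : 'rV[F]_d * P) : 'rV[F]_d * P := (act X e.1, row_act X e.2).

(* the graph of an isomorphism from the given module to the polynomial model *)
Definition graph v f := cyclic pair_act (@in_sl F n) (u0, hw_poly) (v, f).

Lemma graph_comb c u f v g : graph u f -> graph v g -> graph (c *: u + v) (c *: f + g).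
Proof. by move=> h1 h2; exact: (cyclic_comb c h1 h2). Qed.

Lemma graph_act X v f : in_sl X -> graph v f -> graph (act X v) (row_act X f).
Proof.
move=> hX h; apply: (cyclic_stable (sl_split F n) _ _ _ _ _ h hX).
- by move=> c Y Z [v' f']; rewrite /pair_act actX /row_act rowmxP vfP.
- by move=> Y c [v' f'] [v2' f2']; rewrite /pair_act actV /row_act linearP.
- by move=> Y Z [v' f'] hY hZ; rewrite /pair_act act_bracket // /row_act rowmx_bracket vf_bracket.
- move=> Y hY sY; rewrite /pair_act supper_killed // hw_poly_row => [|p q qp]; last by rewrite sY // ltnW.
  by rewrite !sY // !mulr0 !addr0 scale0r.
- move=> H hH dH; exists (wt_sl a H); rewrite /pair_act /act u0_wt; last by rewrite /in_h dH hH.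
  rewrite wt_slE hw_poly_row // => p q qp; apply: (is_diag_mxP dH).
  by rewrite neq_ltn qp orbT.
Qed.

Lemma graph_colhw v f : graph v f -> colhw shape_wt f.
Proof.
rewrite /graph -[f]/((v, f).2); elim=> [||c e1 e2 _ h1 _ h2|X e _ _ _ h] /=.
- exact: hw_poly_colhw.
- exact: colhw0.
- exact: colhw_comb.
- exact: colhw_row_act.
Qed.

(* twice the sum of the fundamental coweights *)
Let rhoH : 'M[F]_N := diag_mx (\row_p ((N.-1)%:R - (2 * p)%N%:R)).

Lemma rhoH_in_h : in_h rhoH.
Proof.
rewrite /in_h diag_mx_is_diag /in_sl mxtrace_diag; apply/eqP.
under eq_bigr do rewrite mxE.
apply: (double_eq0 (two_neq0 hF)).
rewrite {2}(reindex_inj rev_ord_inj) -big_split big1 //= => p _.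
rewrite addrACA -opprD -!natrD.
have -> : (2 * p + 2 * (N - p.+1) = N.-1 + N.-1)%N by have := ltn_ord p; lia.
by rewrite subrr.
Qed.

Let h0 := wt_sl a rhoH.
(* lower_span is spanned by the weight vectors of weight below that of u0 *)
Definition below (w : nat -> 'rV[F]_d) (J : nat) :=
  (forall j, act rhoH (w j) = (h0 - (2 * j.+1)%:R) *: w j) /\ (forall j, (J <= j)%N -> w j = 0).
Definition lower_span v := exists w J, below w J /\ v = \sum_(j < J) w j.

Lemma lower_span_comb c u v : lower_span u -> lower_span v -> lower_span (c *: u + v).
Proof.
move=> [w1 [J1 [[e1 z1] ->]]] [w2 [J2 [[e2 z2] ->]]].
exists (fun j => c *: w1 j + w2 j), (J1 + J2)%N; split; first split.
- by move=> j; rewrite actV e1 e2 scalerDr !scalerA mulrC.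
- by move=> j hj; rewrite z1 ?z2 ?scaler0 ?addr0 //; lia.
have ext w J m : (forall j, (J <= j)%N -> w j = 0) -> \sum_(j < J) w j = \sum_(j < J + m) w j :> 'rV[F]_d.
  move=> z; rewrite big_split_ord /= [X in _ = _ + X]big1 ?addr0 // => j _.
  by rewrite z //= leq_addr.
by rewrite (ext w1 J1 J2) // (ext w2 J2 J1) // [(J2 + J1)%N]addnC scaler_sumr -big_split.
Qed.

Lemma lower_span0 : lower_span 0.
Proof. by exists (fun=> 0), 0%N; split; [split=> // j; rewrite actV0 scaler0|rewrite big_ord0]. Qed.

Lemma lower_span_sum (I : finType) (c : I -> F) (Y : I -> 'rV[F]_d) :
  (forall i, c i = 0 \/ lower_span (Y i)) -> lower_span (\sum_i c i *: Y i).
Proof.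
move=> h; elim/big_rec: _ => [|i v _ hv]; first exact: lower_span0.
by case: (h i) => [->|hi]; [rewrite scale0r add0r|exact: lower_span_comb].
Qed.

Lemma lower_span_eigen v j : act rhoH v = (h0 - (2 * j.+1)%:R) *: v -> lower_span v.
Proof.
move=> e; exists (fun i => if i == j then v else 0), j.+1; split; first split.
- by move=> i; case: eqP => [->|_]; rewrite ?e // actV0 scaler0.
- by move=> i hi; rewrite ifF //; lia.
rewrite (bigD1 ord_max) //= eqxx big1 ?addr0 // => i.
by rewrite -val_eqE /= => /negPf ->.
Qed.

Lemma act_delta_eigen (p q : 'I_N) v x : (q < p)%N -> act rhoH v = x *: v ->
  act rhoH (act (delta_mx p q) v) = (x - (2 * (p - q))%:R) *: act (delta_mx p q) v.
Proof.
move=> qp e; have sd : in_sl (delta_mx p q : 'M[F]_N) by apply: delta_sl; rewrite -val_eqE /=; lia.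
have sH : in_sl rhoH by case/andP: rhoH_in_h.
have br : rhoH *m delta_mx p q - delta_mx p q *m rhoH = (- (2 * (p - q))%:R) *: delta_mx p q + 0.
  rewrite addr0 /rhoH mul_diag_mx mul_mx_diag; apply/matrixP => r s; rewrite !mxE.
  case: eqP => [->|_] /=; last by rewrite !mulr0 mul0r subr0.
  case: eqP => [->|_] /=; last by rewrite !mulr0 mul0r subr0.
  by rewrite !mulr1 mul1r mulnBr natrB; [ring|lia].
have := act_bracket v sH sd; rewrite br actX act0 addr0 e => /eqP.
rewrite eq_sym subr_eq => /eqP ->.
by rewrite /act -scalemxAl scalerBl scaleNr addrC.
Qed.

Lemma lower_span_act X v : supper X^T -> lower_span v -> lower_span (act X v).
Proof.
move=> lX [w [J [[e z] ->]]]; rewrite act_deltas.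
have -> : \sum_p \sum_q X p q *: act (delta_mx p q) (\sum_(j < J) w j) =
   \sum_p 1 *: (\sum_q 1 *: (\sum_(j < J) X p q *: act (delta_mx p q) (w j))).
  apply: eq_bigr => p _; rewrite scale1r; apply: eq_bigr => q _.
  by rewrite scale1r /act mulmx_suml scaler_sumr.
apply: lower_span_sum => p; right; apply: lower_span_sum => q; right; apply: lower_span_sum => j.
have [pq|qp] := leqP p q; first by left; have := lX q p pq; rewrite mxE.
right; apply: (@lower_span_eigen _ (j + (p - q))).
rewrite (act_delta_eigen qp (e j)); congr (_ *: _).
have -> : (2 * (j + (p - q)).+1 = 2 * j.+1 + 2 * (p - q))%N by lia.
by rewrite natrD opprD addrA.
Qed.

(** The value at the base point records the coefficient of [u0]: a lowering operator makes that
    value zero on the polynomial side and lands in [lower_span] on the module side. *)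
Lemma graph_lower v f : graph v f ->
  exists2 v', lower_span v' & v = f.@[mxvec (base_point F n) 0] *: u0 + v'.
Proof.
pose Q (e : 'rV[F]_d * P) := exists2 v', lower_span v' & e.1 = e.2.@[mxvec (base_point F n) 0] *: u0 + v'.
move=> g; suff : Q (v, f) by [].
have [_] : colhw shape_wt (v, f).2 /\ Q (v, f); last by [].
elim: g => [||c e1 e2 _ [c1 [w1 l1 h1]] _ [c2 [w2 l2 h2]]|X e hX lX _ [ce [w lw h]]].
- split; first exact: hw_poly_colhw.
  by exists 0; [exact: lower_span0|rewrite /= hw_poly_base scale1r addr0].
- split; first exact: colhw0.
  by exists 0; [exact: lower_span0|rewrite /= meval0 scale0r addr0].
- split; first exact: colhw_comb.
  exists (c *: w1 + w2); first exact: lower_span_comb.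
  by rewrite /= mevalD mevalZ h1 h2 !scalerDr scalerDl scalerA addrACA.
- split; first exact: colhw_row_act.
  exists (act X e.1); last by rewrite /= row_act_lower_base // scale0r add0r.
  rewrite h actV; apply: lower_span_comb; last exact: lower_span_act.
  rewrite act_deltas.
  have -> : \sum_p \sum_q X p q *: act (delta_mx p q) u0 =
     \sum_p 1 *: (\sum_q X p q *: act (delta_mx p q) u0).
    by apply: eq_bigr => p _; rewrite scale1r.
  apply: lower_span_sum => p; right; apply: lower_span_sum => q.
  have [pq|qp] := leqP p q; first by left; have := lX q p pq; rewrite mxE.
  right; apply: (@lower_span_eigen _ (p - q).-1).
  rewrite (act_delta_eigen qp (u0_wt rhoH_in_h)); congr ((_ - _%:R) *: _); lia.
Qed.

Lemma lower_span_u0 : ~ lower_span u0.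
Proof.
move=> [w [J [[e _] E]]]; case/negP: u0_neq0; apply/eqP.
elim: J w e E => [|J IHJ] w e E; first by rewrite E big_ord0.
have j0 j : (2 * j.+1)%:R != 0 :> F by rewrite (natrF_eq0 hF).
(* Applying [rhoH - (h0 - 2(J+1))] to [u0] multiplies it by [2(J+1)] and removes the summand [w J];
   dividing by [2(J+1)] gives these coefficients. *)
apply: (IHJ (fun j => (((2 * J.+1)%:R - (2 * j.+1)%:R) / (2 * J.+1)%:R) *: w j)) => [j|].
  by rewrite /act -scalemxAl -/(act _ _) e !scalerA mulrC.
have /eqP := u0_wt rhoH_in_h; rewrite -/(act _ _) -/h0 {1}E.
have actS : act rhoH (\sum_(j < J.+1) w j) = \sum_(j < J.+1) (h0 - (2 * j.+1)%:R) *: w j.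
  by rewrite /act mulmx_suml; apply: eq_bigr => j _; rewrite -/(act _ _) e.
rewrite actS big_ord_recr /= => /eqP E1.
have E2 : w J = u0 - \sum_(j < J) w j by rewrite E big_ord_recr /= addrAC subrr add0r.
apply: (scalerI (j0 J)); rewrite scaler_sumr.
have -> : \sum_(j < J) (2 * J.+1)%:R *: (((2 * J.+1)%:R - (2 * j.+1)%:R) / (2 * J.+1)%:R *: w j) =
   \sum_(j < J) (h0 - (2 * j.+1)%:R) *: w j - (h0 - (2 * J.+1)%:R) *: \sum_(j < J) w j.
  rewrite scaler_sumr -sumrB; apply: eq_bigr => j _.
  by rewrite scalerA mulrCA divff // mulr1 -scalerBl; congr (_ *: _); ring.
have -> : \sum_(j < J) (h0 - (2 * j.+1)%:R) *: w j = h0 *: u0 - (h0 - (2 * J.+1)%:R) *: w J.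
  by rewrite -E1 addrK.
rewrite E2 scalerBr opprB addrA addrAC addrK -scalerBl; congr (_ *: _); ring.
Qed.

(** The polynomials paired with 0 form a submodule. A highest weight vector in it would be nonzero
    at the base point, and [graph_lower] would put [u0] into [lower_span]. *)
Lemma graph0_eq0 f : graph 0 f -> f = 0.
Proof.
move=> g0; apply/eqP/negPn/negP => f0.
have [f' gf' [f'0 f'U _]] : exists2 f', graph 0 f' & [/\ f' != 0,
    (forall X, in_sl X -> supper X -> row_act X f' = 0) &
    (forall H, in_sl H -> is_diag_mx H -> exists x, row_act H f' = x *: f')].
  apply: (exists_highest hF (sl_split F n) (lam := shape_wt)) => [c f1 f2 h1 h2|f1|X f1 hX h1|].
  - by have := graph_comb c h1 h2; rewrite scaler0 addr0.
  - exact: graph_colhw.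
  - by have := graph_act hX h1; rewrite actV0.
  - by exists f.
have fb : f'.@[mxvec (base_point F n) 0] != 0.
  by apply: contraNneq f'0 => fb; apply/eqP; exact: (sl_highest_eq0 hF n2 (graph_colhw gf') f'U fb).
have [w lw /eqP] := graph_lower gf'; rewrite eq_sym addr_eq0 => /eqP e.
apply: lower_span_u0; have -> : u0 = (- (f'.@[mxvec (base_point F n) 0])^-1) *: w + 0; last first.
  exact: lower_span_comb lw lower_span0.
by rewrite addr0 scaleNr -scalerN -e scalerA mulVf // scale1r.
Qed.

Lemma stable_row_sub (g : pred 'M[F]_N) (W : 'M[F]_d) :
  (forall X v, g X -> (v <= W)%MS -> (act X v <= W)%MS) -> stable g rho W.
Proof.
move=> h X gX; apply/row_subP => i; rewrite row_mul.
by apply: h => //; exact: row_sub.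
Qed.

Lemma irreducible (Q : 'rV[F]_d -> Prop) u : Q 0 ->
  (forall c v w, Q v -> Q w -> Q (c *: v + w)) -> (forall X v, in_sl X -> Q v -> Q (act X v)) ->
  Q u -> u != 0 -> forall v, Q v.
Proof.
move=> Q0 Ql Qs Qu un0 v; have [W hW] := subspace_mx Q0 Ql.
have [[_ [_ irr]] _] := hL.
have [|/eqP W0|/eqmxP W1] := irr W (submx1 W).
- by apply: stable_row_sub => X w hX /hW; move/(Qs _ _ hX); rewrite -hW.
- by move/hW: Qu; rewrite W0 submx0 => u00; rewrite u00 in un0.
- by apply/hW; rewrite W1 submx1.
Qed.

(** By simplicity a nonzero [v] paired with 0 would force [u0] to be paired with 0; subtracting the
    generator leaves [hw_poly] paired with 0. *)
Lemma graph_eq0 v : graph v 0 -> v = 0.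
Proof.
move=> gv; apply/eqP/negPn/negP => vn0.
have gu : graph u0 0.
  apply: (irreducible (Q := fun v => graph v 0) _ _ _ gv vn0).
  - exact: cyclic_zero.
  - by move=> c v' w h1 h2; have := graph_comb c h1 h2; rewrite scaler0 addr0.
  - by move=> X v' hX h; have := graph_act hX h; rewrite /row_act linear0.
have : graph 0 hw_poly.
  have := graph_comb (-1) gu (cyclic_base _ _ _).
  by rewrite scaleN1r addNr scaler0 add0r.
move/graph0_eq0 => h; have := hw_poly_base; rewrite h meval0 => /eqP.
by rewrite eq_sym oner_eq0.
Qed.

Lemma graph_total v : exists f, graph v f.
Proof.
apply: (irreducible (Q := fun v => exists f, graph v f) (u := u0)) => //.
- by exists 0; exact: cyclic_zero.
- by move=> c u w [f hf] [g hg]; exists (c *: f + g); exact: graph_comb.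
- by move=> X u hX [f hf]; exists (row_act X f); exact: graph_act.
- by exists hw_poly; exact: cyclic_base.
Qed.

Theorem polynomial_model : exists Phi : {linear 'rV[F]_d -> P},
  [/\ forall X v, in_sl X -> Phi (act X v) = row_act X (Phi v),
      forall v, Phi v = 0 -> v = 0,
      forall v, colhw shape_wt (Phi v) &
      forall f, colhw shape_wt f -> exists v, Phi v = f].
Proof.
have [b hb] := fin_all_exists (fun i : 'I_d => graph_total (delta_mx 0 i)).
pose Phi (v : 'rV[F]_d) : P := \sum_i v 0 i *: b i.
have PhiL : linear Phi.
  move=> c u v; rewrite /Phi scaler_sumr -big_split; apply: eq_bigr => i _ /=.
  by rewrite !mxE scalerDl scalerA.
have gPhi v : graph v (Phi v).
  rewrite {1}[v]row_sum_delta /Phi; elim/big_rec2: _ => [|i f w _ h]; first exact: cyclic_zero.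
  exact: graph_comb.
have uniq_graph v f : graph v f -> f = Phi v.
  move=> gf; apply/eqP; rewrite -subr_eq0; apply/eqP/graph0_eq0.
  have := graph_comb (-1) (gPhi v) gf; rewrite scaleN1r addNr scaleN1r addrC.
  by [].
have PhiX X v : in_sl X -> Phi (act X v) = row_act X (Phi v).
  by move=> hX; apply/esym/uniq_graph/graph_act.
have Phi0 v : Phi v = 0 -> v = 0 by move=> e; apply: graph_eq0; rewrite -e.
have PhiR v : colhw shape_wt (Phi v) := graph_colhw (gPhi v).
pose PhiM : {linear 'rV[F]_d -> P} := HB.pack Phi (GRing.isLinear.Build F _ _ _ Phi PhiL).
exists PhiM; split=> //.
(* Towards surjectivity: a nonzero orthogonal complement of the image in the model would contain a
   highest weight vector, necessarily a multiple of [hw_poly]. But [hw_poly] is the image of [u0]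
   and is not isotropic. *)
have orth f : colhw shape_wt f -> (forall v, fischer f (Phi v) = 0) -> f = 0.
  move=> fR fo; apply/eqP/negPn/negP => f0.
  pose Q g := colhw shape_wt g /\ (forall v, fischer g (Phi v) = 0).
  have [f' [f'R f'o] [f'0 f'U _]] : exists2 f', Q f' & [/\ f' != 0,
      (forall X, in_sl X -> supper X -> row_act X f' = 0) &
      (forall H, in_sl H -> is_diag_mx H -> exists x, row_act H f' = x *: f')].
    apply: (exists_highest hF (sl_split F n) (lam := shape_wt)) => [c f1 f2 [h1 o1] [h2 o2]|f1 []//|X f1 hX [h1 o1]|].
    - split=> [|v]; first exact: colhw_comb.
      by rewrite fischerC fischerPr fischerC o1 fischerC o2 mulr0 addr0.
    - split=> [|v]; first exact: colhw_row_act.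
      by rewrite /row_act fischer_vf rowmx_tr -[vf _ _]/(row_act _ _) -PhiX ?o1 // (split_tr (sl_split F n)).
    - by exists f.
  set x := f'.@[mxvec (base_point F n) 0].
  have e : f' = x *: hw_poly.
    apply/eqP; rewrite -subr_eq0; apply/eqP; apply: (sl_highest_eq0 hF n2 (lam := shape_wt)).
    - by rewrite addrC -scaleNr; apply: colhw_comb => //; exact: hw_poly_colhw.
    - move=> X hX sX; rewrite /row_act linearB linearZ /= [vf _ f']f'U // [vf _ hw_poly]hw_poly_row.
        by rewrite !sX // !mulr0 !addr0 scale0r scaler0 subr0.
      by move=> p q qp; rewrite sX // ltnW.
    - by rewrite mevalB mevalZ hw_poly_base mulr1 subrr.
  have := f'o u0; rewrite -(uniq_graph _ _ (cyclic_base _ _ _)) e fischerC fischerZr => /eqP.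
  rewrite mulf_eq0 (negPf (fischer_covariant n2 v0 v1 v2 hF _ _ _ _ _ _)) orbF => /eqP x0.
  by rewrite e x0 scale0r eqxx in f'0.
(* [B] is the Gram matrix of the image, invertible by [orth]. Its inverse gives the orthogonal
   projection of [f] to the image, and [orth] shows that nothing is left over. *)
move=> f fR; pose B : 'M[F]_d := \matrix_(i, j) fischer (Phi (delta_mx 0 i)) (Phi (delta_mx 0 j)).
have fischer_Phi g v : fischer g (Phi v) = \sum_i v 0 i * fischer g (Phi (delta_mx 0 i)).
  have -> : Phi v = \sum_i v 0 i *: Phi (delta_mx 0 i).
    rewrite -[LHS]/(PhiM v) {1}[v]row_sum_delta linear_sum.
    by apply: eq_bigr => i _; rewrite linearZ.
  by rewrite linear_sum; apply: eq_bigr => i _; exact: fischerZr.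
have fPhi g v : (forall j, fischer g (Phi (delta_mx 0 j)) = 0) -> fischer g (Phi v) = 0.
  by move=> h; rewrite fischer_Phi big1 // => j _; rewrite h mulr0.
have vB v j : (v *m B) 0 j = fischer (Phi v) (Phi (delta_mx 0 j)).
  rewrite mxE fischerC fischer_Phi; apply: eq_bigr => i _.
  by rewrite mxE fischerC.
have Bu : B \in unitmx.
  rewrite -row_free_unit -kermx_eq0; apply/eqP/row_matrixP => i; rewrite row0.
  have kB : matrix.row i (kermx B) *m B = 0 by apply/sub_kermxP/row_sub.
  apply: Phi0; apply: orth => // v; apply: fPhi => j.
  by rewrite -vB kB mxE.
pose r : 'rV[F]_d := \row_j fischer f (Phi (delta_mx 0 j)).
exists (r *m invmx B) => /=.
apply/esym/eqP; rewrite -subr_eq0; apply/eqP/orth.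
  by rewrite addrC -scaleN1r; apply: colhw_comb.
move=> v; apply: fPhi => j.
rewrite fischerC linearB /= ![fischer (Phi (delta_mx 0 j)) _]fischerC -vB mulmxKV // mxE.
by rewrite subrr.
Qed.
End Graph.
End Transport.

(** * Decomposition *)

Lemma xhat_supper (F : fieldType) n i : (1 <= i <= n)%N -> supper (xhat F n i).
Proof.
move=> hi p q qp; rewrite /xhat; case: ifP => _; rewrite !mxE.
  have -> : (p == i.-1 :> nat) && (q == i :> nat) = false by lia.
  have -> : (p == (n.*2 - i).-1 :> nat)%N && (q == n.*2 - i :> nat)%N = false by lia.
  by rewrite addr0.
by have -> : (p == n.-1 :> nat) && (q == n :> nat) = false by lia.
Qed.

Lemma xhat_gsig (F : fieldType) n i : (2%:R : F) != 0 -> (1 <= i <= n)%N -> in_gsig (xhat F n i).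
Proof.
move=> two0 hi; apply/(in_gsigP two0) => r s.
have hr := ltn_ord r; have hs := ltn_ord s.
have sgn (b : bool) : (b -> odd (r + s)) -> b%:R = - (-1) ^+ (r + s) * b%:R :> F.
  by case: b => [/(_ isT) o|_]; rewrite ?mulr0 // -signr_odd o expr1 opprK mul1r.
have both (x y x' y' : nat) : ((r == x :> nat) /\ (s == y :> nat) <-> (n.*2 - s.+1 = x')%N /\ (n.*2 - r.+1 = y')%N) ->
    (n.*2 - s.+1 == x')%N && (n.*2 - r.+1 == y')%N = (r == x :> nat) && (s == y :> nat).
  move=> [h1 h2]; apply/idP/idP => /andP[h h'].
    by have [-> ->] := h2 (conj (eqP h) (eqP h')).
  by have [-> ->] := h1 (conj h h'); rewrite !eqxx.
have odd_entry (x y : nat) : odd (x + y) -> (r == x :> nat) && (s == y :> nat) -> odd (r + s).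
  by move=> o /andP[/eqP -> /eqP ->].
have oddS i' : odd (i'.-1 + i') = (0 < i')%N.
  by case: i' => //= k; rewrite addnS /= oddD addbb.
rewrite /xhat; case: ifP => hin; rewrite !mxE /=.
  have -> := both (n.*2 - i).-1 (n.*2 - i)%N i.-1 i; last first.
    by split=> -[]; [move=> /eqP h1 /eqP h2; split; lia|move=> h1 h2; split; apply/eqP; lia].
  have -> := both i.-1 i (n.*2 - i).-1 (n.*2 - i)%N; last first.
    by split=> -[]; [move=> /eqP h1 /eqP h2; split; lia|move=> h1 h2; split; apply/eqP; lia].
  by rewrite mulrDr addrC; congr (_ + _); apply: sgn; apply: odd_entry; rewrite oddS; lia.
have -> := both n.-1 n n.-1 n; first by apply: sgn; apply: odd_entry; rewrite oddS; lia.
by split=> -[]; [move=> /eqP h1 /eqP h2; split; lia|move=> h1 h2; split; apply/eqP; lia].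
Qed.

Lemma hsig_rev (F : fieldType) n (H : 'M[F]_(n.*2)) : (2%:R : F) != 0 -> in_gsig H ->
  forall r, H (rev_ord r) (rev_ord r) = - H r r.
Proof.
move=> two0 /(in_gsigP two0) sH r.
by rewrite [H r r]sH -signr_odd addnn odd_double expr0 mulN1r opprK.
Qed.

Section Decomposition.
Variables (F : fieldType) (hF : [pchar F] =i pred0) (n : nat) (n2 : (2 <= n)%N).
Local Notation N := (n.*2).
Local Notation P := {mpoly F[N * 3]}.
Variables (r0 r1 r2 : 'I_N).
Hypotheses (v0 : r0 = 0%N :> nat) (v1 : r1 = 1%N :> nat) (v2 : r2 = 2%N :> nat).
Variable a : nat -> nat.
Local Notation L := (rowlen n a).
Local Notation lam := (shape_wt n a).
Let two0 := two_neq0 hF.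

Definition par_ok (p : nat * nat * nat * nat) : Prop :=
  let: (k, z, x, y) := p in std_params n a k z x y.
Definition par_cov (p : nat * nat * nat * nat) : P :=
  let: (k, z, x, y) := p in covariant F r0 r1 r2 (L 1 - L 2 - z) (L 2 - L 3 - k) k x y z.
Definition par_wt (p : nat * nat * nat * nat) (H : 'M[F]_N) : F :=
  let: (k, z, x, y) := p in
  (L 1 - k - z)%N%:R * H r0 r0 + (L 2 - k - y)%N%:R * H r1 r1 + x%:R * H r2 r2.

Lemma par_cov_colhw p : par_ok p -> colhw lam (par_cov p).
Proof.
case: p => [[[k z] x] y] [xyz hk hz _].
by apply: colhw_covariant; rewrite // /shape_wt /=; lia.
Qed.

Lemma par_cov_row X p : par_ok p -> in_gsig X -> utri X ->
  row_act X (par_cov p) = par_wt p X *: par_cov p.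
Proof.
case: p => [[[k z] x] y] [xyz hk hz _] gX uX.
rewrite /par_cov (gsig_row_covariant v0 v1 v2 hF) //; congr (_ *: _).
by rewrite /par_wt; congr (_%:R * _ + _%:R * _ + _); lia.
Qed.

Lemma par_cov_killed X p : par_ok p -> in_gsig X -> supper X -> row_act X (par_cov p) = 0.
Proof.
move=> hp gX sX; rewrite par_cov_row // => [|r s sr]; last by rewrite sX // ltnW.
by case: p {hp} => [[[k z] x] y]; rewrite /par_wt !sX // !mulr0 !addr0 scale0r.
Qed.

Lemma diag_utri (H : 'M[F]_N) : is_diag_mx H -> utri H.
Proof. by move=> dH p q qp; apply: (is_diag_mxP dH); rewrite neq_ltn qp orbT. Qed.

(** The weight determines [x], [k + z] and [k + y], and [y + z] is [L 3 - x]; so [k] is determined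
    as well. For [n = 2] the third coordinate is not independent, and [x = 0] takes its place. *)
Lemma par_wt_inj p p' : par_ok p -> par_ok p' ->
  (forall r, par_wt p (gsym F r r) = par_wt p' (gsym F r r)) -> p = p'.
Proof.
case: p p' => [[[k z] x] y] [[[k' z'] x'] y'] [xyz hk hz hx] [xyz' hk' hz' hx'] e.
have gE (r s : 'I_N) : gsym F r r s s = (r == s)%:R - (rev_ord r == s)%:R.
  rewrite !mxE addnn -signr_odd odd_double expr0 mul1r !andbb ![s == _]eq_sym.
  by [].
have neq (r s : 'I_N) : (r : nat) != s -> (r == s) = false by move/negPf.
have e0 : (L 1 - k - z = L 1 - k' - z')%N.
  apply: (natrF_inj hF); have := e r0; rewrite /par_wt !gE eqxx.
  rewrite !neq /= ?v0 ?v1 ?v2; try lia.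
  by rewrite !subr0 !mulr1 !mulr0 !addr0.
have [n2'|n3] := eqVneq n 2%N.
  have e1 : (L 2 - k - y = L 2 - k' - y')%N.
    apply: (natrF_inj hF); have := e r1; rewrite /par_wt !gE eqxx.
    rewrite (hx n2') (hx' n2') !mul0r !addr0 !neq /= ?v0 ?v1 ?v2; try lia.
    by rewrite !subr0 !mulr1 !mulr0 !add0r.
  by move: (hx n2') (hx' n2') => x0 x0'; congr (_, _, _, _); lia.
have e2 : x = x'.
  apply: (natrF_inj hF); have := e r2; rewrite /par_wt !gE eqxx.
  rewrite !neq /= ?v0 ?v1 ?v2; try lia.
  by rewrite !subr0 !mulr1 !mulr0 !add0r.
have e1 : (L 2 - k - y = L 2 - k' - y')%N.
  apply: (natrF_inj hF); have := e r1; rewrite /par_wt !gE eqxx.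
  rewrite !neq /= ?v0 ?v1 ?v2; try lia.
  by rewrite !subr0 !mulr1 !mulr0 !add0r !addr0.
by congr (_, _, _, _); lia.
Qed.

(** Diagonal elements are self-adjoint for the form, so eigenvectors with different weights are
    orthogonal. *)
Lemma fischer_par_cov_neq p p' : par_ok p -> par_ok p' -> p <> p' ->
  fischer (par_cov p) (par_cov p') = 0.
Proof.
move=> hp hp' pp'; apply/eqP/negPn/negP => f0; apply: pp'; apply: par_wt_inj => // r.
apply: (mulIf f0).
have gr := gsym_gsig two0 r r; have dr := gsym_diag F r.
have e := fischer_vf (rowmx (gsym F r r)) (par_cov p) (par_cov p').
move: e; rewrite rowmx_tr -!/(row_act _ _).
have -> : (gsym F r r)^T = gsym F r r.
  apply/matrixP => i j; rewrite mxE; have [->//|ij] := eqVneq i j.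
  by rewrite !(is_diag_mxP dr) // eq_sym.
rewrite !par_cov_row ?diag_utri //; try exact: diag_utri.
by rewrite fischerC !fischerZr [fischer (par_cov p') _]fischerC.
Qed.

Definition gcyc p := cyclic (@row_act F N) (@in_gsig F n) (par_cov p).

Lemma gcyc_stable p X f : par_ok p -> in_gsig X -> gcyc p f -> gcyc p (row_act X f).
Proof.
move=> hp gX h; apply: (cyclic_stable (gsig_split n two0) _ _ _ _ _ h gX).
- by move=> c Y Z g; rewrite /row_act rowmxP vfP.
- by move=> Y c g g'; rewrite /row_act linearP.
- by move=> Y Z g _ _; rewrite /row_act rowmx_bracket vf_bracket.
- by move=> Y gY sY; exact: par_cov_killed.
- by move=> H gH dH; exists (par_wt p H); apply: par_cov_row => //; exact: diag_utri.
Qed.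

(** Across the form a lowering operator becomes a raising operator, which kills [par_cov p]; only
    the generator of the other component remains to be compared. *)
Lemma gcyc_orth p p' f : par_ok p -> par_ok p' -> p <> p' -> gcyc p' f -> fischer (par_cov p) f = 0.
Proof.
move=> hp hp' pp'; elim=> [||c f1 f2 _ h1 _ h2|X g gX lX _ h].
- exact: fischer_par_cov_neq.
- exact: linear0.
- by rewrite fischerPr h1 h2 mulr0 addr0.
- have -> : fischer (par_cov p) (row_act X g) = fischer (row_act X^T (par_cov p)) g.
    by rewrite /row_act fischer_vf rowmx_tr trmxK.
  rewrite par_cov_killed //; last exact: (split_tr (gsig_split n two0)).
  by rewrite fischerC linear0.
Qed.

Lemma fischer_par_cov p : fischer (par_cov p) (par_cov p) != 0.
Proof. by case: p => [[[k z] x] y]; exact: fischer_covariant. Qed.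

(** * The simple components and their direct sum *)

Section Module.
Variables (d : nat) (rho : 'M[F]_N -> 'M[F]_d) (Phi : {linear 'rV[F]_d -> P}).
Hypotheses (PhiX : forall X v, in_sl X -> Phi (act rho X v) = row_act X (Phi v))
  (Phi0 : forall v, Phi v = 0 -> v = 0) (PhiR : forall v, colhw lam (Phi v)).

Lemma Phi_inj u v : Phi u = Phi v -> u = v.
Proof. by move=> e; apply/eqP; rewrite -subr_eq0; apply/eqP/Phi0; rewrite linearB /= e subrr. Qed.

Lemma PhiG X v : in_gsig X -> Phi (act rho X v) = row_act X (Phi v).
Proof. by case/andP => sX _; exact: PhiX. Qed.

Lemma stable_mem (g : pred 'M[F]_N) (V : 'M[F]_d) X v : stable g rho V -> g X ->
  (v <= V)%MS -> (act rho X v <= V)%MS.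
Proof. by move=> sV gX vV; apply: submx_trans (sV X gX); exact: submxMr. Qed.

Lemma highest_in_stable (V : 'M[F]_d) : stable (@in_gsig F n) rho V -> V != 0 ->
  exists2 p, par_ok p & exists2 v, (v <= V)%MS & Phi v = par_cov p.
Proof.
move=> sV V0.
have [f [u uV <-] [f0 fU fD]] : exists2 f, (exists2 v, (v <= V)%MS & Phi v = f) &
   [/\ f != 0, (forall X, in_gsig X -> supper X -> row_act X f = 0) &
    (forall H, in_gsig H -> is_diag_mx H -> exists x, row_act H f = x *: f)].
  apply: (exists_highest hF (gsig_split n two0) (lam := lam)) => [c _ _ [u hu <-] [w hw <-]|_ [u _ <-]|X _ gX [u hu <-]|].
  - by exists (c *: u + w); [rewrite addmx_sub ?scalemx_sub|rewrite linearP].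
  - exact: PhiR.
  - by exists (act rho X u); [exact: stable_mem sV gX hu|exact: PhiG].
  - have /rowV0Pn[u uV un0] := V0; exists (Phi u); first by exists u.
    by apply: contraNneq un0 => /Phi0 ->.
have [k [z [x [y [b [[xyz hx] hk hz b0 e]]]]]] := gsig_highest_covariant n2 v0 v1 v2 hF (PhiR u) f0 fU fD.
exists (k, z, x, y); first by split.
exists (b^-1 *: u); first exact: scalemx_sub.
by rewrite linearZ /= e scalerA mulVf // scale1r.
Qed.
Lemma gcyc_span p : exists W : 'M[F]_d, forall v, (v <= W)%MS <-> gcyc p (Phi v).
Proof.
apply: subspace_mx => [|c u v hu hv]; rewrite ?linear0 ?linearP; first exact: cyclic_zero.
exact: cyclic_comb.
Qed.

Section Component.
Variables (p : nat * nat * nat * nat) (W : 'M[F]_d) (u : 'rV[F]_d).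
Hypotheses (hp : par_ok p) (hW : forall v, (v <= W)%MS <-> gcyc p (Phi v)) (hu : Phi u = par_cov p).

Lemma component_stable : stable (@in_gsig F n) rho W.
Proof.
apply: stable_row_sub => X v gX /hW hv; apply/hW; rewrite PhiG //.
exact: gcyc_stable.
Qed.

Lemma component_mem : (u <= W)%MS.
Proof. by apply/hW; rewrite hu; exact: cyclic_base. Qed.

Lemma component_neq0 : u != 0.
Proof.
apply/eqP => u0; have := fischer_par_cov p.
by rewrite -hu u0 linear0 linear0 eqxx.
Qed.

Lemma component_min (V : 'M[F]_d) : stable (@in_gsig F n) rho V -> (u <= V)%MS -> (W <= V)%MS.
Proof.
move=> sV uV; have cyc f : gcyc p f -> exists2 v, (v <= V)%MS & Phi v = f.
  elim=> [||c _ _ _ [w1 h1 <-] _ [w2 h2 <-]|X _ gX _ _ [w h <-]].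
  - by exists u.
  - by exists 0; [exact: sub0mx|exact: linear0].
  - by exists (c *: w1 + w2); [rewrite addmx_sub ?scalemx_sub|rewrite linearP].
  - by exists (act rho X w); [exact: stable_mem sV gX h|exact: PhiG].
apply/row_subP => i; have /hW/cyc[v vV /Phi_inj <-] := row_sub i W; exact: vV.
Qed.

(** A nonzero stable subspace of [W] contains some [par_cov p']. For [p'] different from [p] this
    vector would be orthogonal to all of [W], itself included; so it is the generator of [W]. *)
Lemma component_simple : simple_sub (@in_gsig F n) rho W.
Proof.
split; first by apply: contraNneq component_neq0 => W0; have := component_mem; rewrite W0 submx0.
split=> [|V VW sV]; first exact: component_stable.
have [V0|V0] := eqVneq V 0; first by left.
right; apply/andP; split=> //.
have [p' hp' [v vV ev]] := highest_in_stable sV V0.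
suff pp : p' = p.
  by apply: component_min => //; rewrite -(_ : v = u) //; apply: Phi_inj; rewrite ev hu pp.
apply: NNPP => pp'; have /hW h := submx_trans vV VW.
by have := gcyc_orth hp' hp pp' h; rewrite ev => /eqP; rewrite (negPf (fischer_par_cov p')).
Qed.

Lemma component_is_L mu : (forall H, in_hsig H -> mu H = par_wt p H) -> is_L_gsig mu rho W.
Proof.
move=> hmu; split; first exact: component_simple.
exists u; split; [exact: component_mem|exact: component_neq0|move=> i hi|move=> H hH].
- apply: Phi0; rewrite -/(act _ _ _) PhiG ?xhat_gsig // hu.
  by apply: par_cov_killed; [|exact: xhat_gsig|exact: xhat_supper].
- have /andP[dH gH] := hH; apply: Phi_inj; rewrite linearZ /= -/(act _ _ _) PhiG // hu hmu //.
  by apply: par_cov_row => //; exact: diag_utri.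
Qed.
End Component.

Lemma gram_matrix :
  exists B : 'M[F]_d, forall v s : 'rV[F]_d, fischer (Phi v) (Phi s) = (v *m B *m s^T) 0 0.
Proof.
exists (\matrix_(i, j) fischer (Phi (delta_mx 0 i)) (Phi (delta_mx 0 j))) => v s.
have fischer_Phi g w : fischer g (Phi w) = \sum_i w 0 i * fischer g (Phi (delta_mx 0 i)).
  have -> : Phi w = \sum_i w 0 i *: Phi (delta_mx 0 i).
    by rewrite {1}[w]row_sum_delta linear_sum; apply: eq_bigr => i _; rewrite linearZ.
  by rewrite linear_sum; apply: eq_bigr => i _; exact: fischerZr.
rewrite [RHS]mxE fischer_Phi; apply: eq_bigr => j _; rewrite [s^T _ _]mxE mulrC; congr (_ * _).
by rewrite mxE fischerC fischer_Phi; apply: eq_bigr => i _; rewrite mxE fischerC.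
Qed.

Section Sum.
Variables (m : nat) (p : 'I_m -> nat * nat * nat * nat) (W : 'I_m -> 'M[F]_d) (u : 'I_m -> 'rV[F]_d).
Hypotheses (hp : forall i, par_ok (p i)) (hW : forall i v, (v <= W i)%MS <-> gcyc (p i) (Phi v))
  (hu : forall i, Phi (u i) = par_cov (p i)) (p_inj : injective p)
  (p_onto : forall q, par_ok q -> exists i, p i = q).

(** The orthogonal complement [K] of the sum is stable because the fixed subalgebra is closed under
    transposition. A covariant in [K] also lies in one of the components, so it would be
    isotropic. *)
Lemma components_full : (\sum_i W i :=: 1%:M)%MS.
Proof.
pose Q v := forall i s, (s <= W i)%MS -> fischer (Phi v) (Phi s) = 0.
have [K hK] : exists K : 'M[F]_d, forall v, (v <= K)%MS <-> Q v.
  apply: subspace_mx => [i s _|c v w hv hw i s sW]; rewrite fischerC.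
    by rewrite linear0 linear0.
  by rewrite linearP linearP /= fischerC (hv i) // fischerC (hw i) // mulr0 addr0.
have sK : stable (@in_gsig F n) rho K.
  apply: stable_row_sub => X v gX /hK hv; apply/hK => i s sW.
  have gXT := split_tr (gsig_split n two0) gX.
  rewrite PhiG // /row_act fischer_vf rowmx_tr -/(row_act _ _) -PhiG //; apply: (hv i).
  exact: stable_mem (component_stable (hp i) (hW i)) gXT sW.
have K0 : K = 0.
  apply/eqP/negPn/negP => Kn0; have [q hq [v /hK hv ev]] := highest_in_stable sK Kn0.
  have [i ei] := p_onto hq.
  have vW : (v <= W i)%MS by apply/hW; rewrite ev ei; exact: cyclic_base.
  by have := hv i v vW; rewrite ev => /eqP; rewrite (negPf (fischer_par_cov q)).
have [B hB] := gram_matrix; set S := (\sum_i W i)%MS.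
(* In matrix terms [K = 0] says that [v *m B *m S^T = 0] forces [v = 0], so [S] has full rank;
   nothing is assumed about [B] itself. *)
have free : row_free (B *m S^T).
  rewrite -kermx_eq0; apply/eqP/row_matrixP => j; rewrite row0.
  apply/eqP; rewrite -submx0 -K0; apply/hK => i s sW.
  have /submxP[t ->] : (s <= S)%MS by apply: submx_trans sW (sumsmx_sup i _ _).
  have /sub_kermxP e := row_sub j (kermx (B *m S^T)).
  by rewrite hB trmx_mul mulmxA -[_ *m B *m S^T]mulmxA e mul0mx mxE.
apply/eqmxP; rewrite submx1 sub1mx /row_full.
have : (\rank (B *m S^T) <= \rank S)%N by rewrite -[X in (_ <= X)%N]mxrank_tr; exact: mxrankM_maxr.
by rewrite (eqP free) => h; rewrite eqn_leq h rank_leq_row.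
Qed.

(** By simplicity a component meets the sum of the others in zero or is contained in it. The latter
    would make its generator orthogonal to itself. *)
Lemma components_direct : mxdirect (\sum_i W i).
Proof.
apply/mxdirect_sumsP => i _; set T := (\sum_(j | _) W j)%MS.
have T_orth v : (v <= T)%MS -> fischer (par_cov (p i)) (Phi v) = 0.
  move=> /sub_sumsmxP[t ->]; rewrite linear_sum linear_sum big1 // => j ji.
  apply: (gcyc_orth (p' := p j)) => //; first by move/p_inj => e; rewrite e eqxx in ji.
  by apply/hW; exact: submxMl.
have sT : stable (@in_gsig F n) rho T.
  apply: stable_row_sub => X v gX /sub_sumsmxP[t ->]; rewrite /act mulmx_suml.
  apply: summx_sub => j ji; apply: submx_trans (sumsmx_sup j ji (submx_refl _)).
  by apply: (stable_mem (component_stable (hp j) (hW j)) gX); exact: submxMl.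
have sU : stable (@in_gsig F n) rho (W i :&: T)%MS.
  apply: stable_row_sub => X v gX; rewrite !sub_capmx => /andP[h1 h2].
  by rewrite (stable_mem (component_stable (hp i) (hW i)) gX h1) (stable_mem sT gX h2).
have [_ [_ irr]] := component_simple (hp i) (hW i) (hu i).
have [|/eqP //|/eqmxP e] := irr _ _ sU; first exact: capmxSl.
have : (u i <= W i :&: T)%MS by rewrite e; exact: (component_mem (hW i) (hu i)).
rewrite sub_capmx => /andP[_ /T_orth]; rewrite hu => /eqP.
by rewrite (negPf (fischer_par_cov (p i))).
Qed.
End Sum.
End Module.
End Decomposition.

Theorem theorem6p5 (F : closedFieldType) (hF : [pchar F] =i pred0)
  (n : nat) (hn : (2 <= n)%N) (a : nat -> nat)
  (ha : n = 2%N \/ (forall i, (4 <= i <= (n.*2).-1)%N -> a i = 0%N))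
  (d : nat) (rho : 'M[F]_(n.*2) -> 'M[F]_d)
  (hrho : is_sl_rep rho) (hL : is_L_sl a rho)
  (ts : seq (tableau)) (hts_uniq : uniq ts)
  (hts : forall t, t \in ts <-> domres n a t) :
  exists W : 'I_(size ts) -> 'M[F]_d,
    [/\ (\sum_i W i :=: 1%:M)%MS,
        mxdirect (\sum_i W i) &
        forall i : 'I_(size ts), is_L_gsig (muT (nth [::] ts i)) rho (W i)].
Proof.
have l0 : (0 < n.*2)%N by lia.
have l1 : (1 < n.*2)%N by lia.
have l2 : (2 < n.*2)%N by lia.
pose r0 := Ordinal l0; pose r1 := Ordinal l1; pose r2 := Ordinal l2.
have v0 : r0 = 0%N :> nat by []. have v1 : r1 = 1%N :> nat by []. have v2 : r2 = 2%N :> nat by [].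
have [u0 [_ u0_neq0 u0_killed u0_wt]] := proj2 hL.
have [Phi [PhiX Phi0 PhiR PhiS]] := polynomial_model hF hn v0 v1 v2 ha hrho hL u0_neq0 u0_killed u0_wt.
have /fin_all_exists[p hp] : forall i : 'I_(size ts), exists p : nat * nat * nat * nat,
    par_ok n a p /\ nth [::] ts i = let: (k, z, x, y) := p in std_tab n a k z x y.
  move=> i; have /hts/(domres_std_tab hn ha)[k [z [x [y [hk e]]]]] := mem_nth [::] (ltn_ord i).
  by exists (k, z, x, y).
have p_ok i : par_ok n a (p i) := proj1 (hp i).
have /fin_all_exists[W hW] := fun i => gcyc_span r0 r1 r2 a Phi (p i).
have /fin_all_exists[u hu] := fun i => PhiS _ (par_cov_colhw hF hn v0 v1 v2 (p_ok i)).
have p_inj : injective p.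
  move=> i j e; apply/val_inj/eqP; rewrite -(nth_uniq [::] (ltn_ord i) (ltn_ord j) hts_uniq).
  by rewrite (proj2 (hp i)) (proj2 (hp j)) e.
have p_onto q : par_ok n a q -> exists i, p i = q.
  case: q => [[[k z] x] y] hq.
  have mt : std_tab n a k z x y \in ts by apply/hts; exact: std_tab_domres.
  have it : (index (std_tab n a k z x y) ts < size ts)%N by rewrite index_mem.
  (* The parameters chosen for this position and those of [q] describe the same tableau, hence have
     the same weight, which determines them. *)
  exists (Ordinal it); have := proj2 (hp (Ordinal it)); rewrite /= nth_index //.
  move: (p_ok (Ordinal it)); case: (p _) => [[[k' z'] x'] y'] hq' e.
  apply: (par_wt_inj hF hn v0 v1 v2 (p := (k', z', x', y')) (p' := (k, z, x, y)) hq' hq) => r.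
  have Hr := hsig_rev (two_neq0 hF) (gsym_gsig (two_neq0 hF) r r).
  rewrite /par_wt -(muT_std_tab hn ha v0 v1 v2 hq' Hr) -(muT_std_tab hn ha v0 v1 v2 hq Hr).
  by rewrite e.
exists W; split.
- exact: (components_full hF hn v0 v1 v2 PhiX Phi0 PhiR p_ok hW p_onto).
- exact: (components_direct hF hn v0 v1 v2 PhiX Phi0 PhiR p_ok hW hu p_inj).
- move=> i; apply: (component_is_L hF hn v0 v1 v2 PhiX Phi0 PhiR (p_ok i) (hW i) (hu i)) => H hH.
  rewrite (proj2 (hp i)); move: (p_ok i); case: (p i) => [[[k z] x] y] hk.
  by apply: muT_std_tab => //; apply: (hsig_rev (two_neq0 hF)); case/andP: hH.
Qed.
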